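(* Let $\varphi$ be a scalar function such that either $\varphi\in\dot H^1(\mathbb{T}^2)$ (a function with zero mean on the torus), or $\varphi\in H^1_0(\Omega)$, where $\Omega\subseteq\mathbb{R}^2$ is an arbitrary domain. Then for every $q$ with $2\le q<\infty$ the following interpolation inequality holds: $$ \|\varphi\|_{L^q}\le\left(\frac1{4\pi}\right)^{\frac{q-2}{2q}}\left(\frac q2\right)^{1/2} \|\varphi\|^{2/q}\,\|\nabla\varphi\|^{1-2/q}. $$
   Context: $\mathbb{T}^2=[0,2\pi]^2$ is the two-dimensional torus with periodic boundary conditions, and $\dot H^1(\mathbb{T}^2)$ is the space of functions $\varphi\in H^1(\mathbb{T}^2)$ with zero mean, $\int_{\mathbb{T}^2}\varphi(x)\,dx=0$. $H^1_0(\Omega)$ is the closure of $C_c^\infty(\Omega)$ in $H^1(\Omega)$ (so $H^1_0(\mathbb{R}^2)=H^1(\mathbb{R}^2)$). Scalar functions are real- or complex-valued. $\|\cdot\|$ denotes the $L^2$-norm and $\|\cdot\|_{L^q}$ the $L^q$-norm, both over $\mathbb{T}^2$ in the first case and over $\Omega$ in the second. For $q=2$ the factor $\|\nabla\varphi\|^{0}$ is read as $1$. *)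

(* Defs.v *)
From HB Require Import structures.
From mathcomp Require Import all_boot all_order all_algebra.
From mathcomp Require Import complex.
From mathcomp Require Import all_classical all_reals all_analysis.

Set Implicit Arguments.
Unset Strict Implicit.
Unset Printing Implicit Defensive.
Import Order.TTheory GRing.Theory Num.Theory.
Import numFieldNormedType.Exports.

Local Open Scope classical_set_scope.
Local Open Scope ring_scope.

(* All functions are complex-valued; a real-valued function is one whose
   imaginary part vanishes. *)

Section Sobolev2D.
Variable R : realType.

(* R * R with the sigma-algebra on which the library defines Lebesgue measure. *)
Definition mplane := (measurableTypeR R * measurableTypeR R)%type.

Definition leb2 : {measure set mplane -> \bar R} :=
  (@lebesgue_measure R \x @lebesgue_measure R)%E.

Definition e1 : R * R := (1, 0).
Definition e2 : R * R := (0, 1).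

Definition ReF (f : R * R -> R[i]) : R * R -> R := fun x => complex.Re (f x).
Definition ImF (f : R * R -> R[i]) : R * R -> R := fun x => complex.Im (f x).

(* The modulus as an element of R: in real-closed, [`|z|] lives in R[i]. *)
Definition cmod (z : R[i]) : R := ComplexField.Normc.normc z.

Definition cmod2 (z : R[i] * R[i]) : R :=
  Num.sqrt (cmod z.1 ^+ 2 + cmod z.2 ^+ 2).

Definition cintegral (D : set (R * R)) (f : R * R -> R[i]) : R[i] :=
  Complex (\int[leb2]_(x in D) ReF f x) (\int[leb2]_(x in D) ImF f x).

Definition normL (D : set (R * R)) (q : R) (f : R * R -> R) : \bar R :=
  Lnorm leb2 q%:E (EFin \o (f \* \1_D)).

Definition L2 (D : set (R * R)) (f : R * R -> R[i]) : Prop :=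
  [/\ measurable_fun (D : set mplane) (ReF f : mplane -> R),
      measurable_fun (D : set mplane) (ImF f : mplane -> R) &
      (normL D 2 (cmod \o f) < +oo)%E].

Fixpoint Ck (k : nat) (f : R * R -> R) : Prop :=
  continuous f /\
  match k with
  | 0 => True
  | k'.+1 => [/\ forall x, derivable f x e1, forall x, derivable f x e2,
                 Ck k' (fun x => 'D_e1 f x) & Ck k' (fun x => 'D_e2 f x)]
  end.

Definition Cinfty (f : R * R -> R[i]) : Prop :=
  forall k, Ck k (ReF f) /\ Ck k (ImF f).

Definition cpartial (v : R * R) (f : R * R -> R[i]) : R * R -> R[i] :=
  fun x => Complex ('D_v (ReF f) x) ('D_v (ImF f) x).

Definition cgrad (f : R * R -> R[i]) : R * R -> R[i] * R[i] :=
  fun x => (cpartial e1 f x, cpartial e2 f x).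

Definition domain (Omega : set (R * R)) : Prop :=
  [/\ open Omega, connected Omega & Omega !=set0].

(* C_c^oo(Omega), each function being extended by zero to the plane. *)
Definition Cc_infty (Omega : set (R * R)) (psi : R * R -> R[i]) : Prop :=
  [/\ Cinfty psi, compact (closure [set x | psi x != 0]) &
      closure [set x | psi x != 0] `<=` Omega].

(* The torus is R^2 / (2 pi Z)^2: functions on it are doubly periodic functions
   on the plane, and integrals and norms are taken over one period cell. *)
Definition T2 : set (R * R) := `[0, 2 * pi] `*` `[0, 2 * pi].

Definition doubly_periodic (V : zmodType) (f : R * R -> V) : Prop :=
  periodic f (2 * pi, 0) /\ periodic f (0, 2 * pi).

Definition Cinfty_T2 (psi : R * R -> R[i]) : Prop :=
  Cinfty psi /\ doubly_periodic psi.

(* [f] and [df] are in L^2(D) and [df] is the distributional gradient of [f]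
   when tested against [test]. *)
Definition weakly_differentiable (D : set (R * R))
    (test : (R * R -> R[i]) -> Prop)
    (f : R * R -> R[i]) (df : R * R -> R[i] * R[i]) : Prop :=
  [/\ L2 D f, L2 D (fst \o df), L2 D (snd \o df) &
      forall psi, test psi ->
        cintegral D (fun x => f x * cpartial e1 psi x)
          = - cintegral D (fun x => (df x).1 * psi x) /\
        cintegral D (fun x => f x * cpartial e2 psi x)
          = - cintegral D (fun x => (df x).2 * psi x)].

(* The weak gradient is determined by the function only almost everywhere, so
   each Sobolev space below is presented as the graph of its gradient:
   [X f df] says that [f] belongs to X and that [df] represents its gradient.
   Membership of [f] alone is [exists df, X f df]. *)

Definition H1 (Omega : set (R * R)) (f : R * R -> R[i])
    (df : R * R -> R[i] * R[i]) : Prop :=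
  weakly_differentiable Omega (Cc_infty Omega) f df.

Definition H1norm (D : set (R * R)) (f : R * R -> R[i])
    (df : R * R -> R[i] * R[i]) : \bar R :=
  ((normL D 2 (cmod \o f) `^ 2 + normL D 2 (cmod2 \o df) `^ 2) `^ 2^-1)%E.

Definition H10 (Omega : set (R * R)) (f : R * R -> R[i])
    (df : R * R -> R[i] * R[i]) : Prop :=
  H1 Omega f df /\
  forall eps : R, 0 < eps -> exists psi, Cc_infty Omega psi /\
    (H1norm Omega (fun x => (f x - psi x)%R)
       (fun x => ((df x).1 - (cgrad psi x).1, (df x).2 - (cgrad psi x).2)%R)
     < eps%:E)%E.

Definition H1dot_T2 (f : R * R -> R[i]) (df : R * R -> R[i] * R[i]) : Prop :=
  [/\ doubly_periodic f, doubly_periodic df,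
      weakly_differentiable T2 Cinfty_T2 f df &
      cintegral T2 f = 0].

End Sobolev2D.
Arguments T2 : clear implicits.
Arguments cmod {R}.
Arguments cmod2 {R}.

(* Main.v *)
(* Expand a function on a square cell of side [L] in the exponentials [e_k] of
   frequency [2 pi k / L]. With [p = q / (q - 1)], the Hausdorff-Young
   inequality bounds the average of [|f - mean|^q] by the [(q-1)]-th power of
   [sum |a_k|^p], and Hoelder's inequality with the weights [(|k|^2 + M)^(p/2)]
   bounds the latter by powers of [sum (|k|^2 + M) |a_k|^2] and of the lattice
   sum [sum (|k|^2 + M)^-r] over [k <> 0], with [r = q / (q - 2)]. The lattice
   sum is at most the integral [pi M^(1-r) / (r-1)] of [(|x|^2 + M)^-r] over the
   plane; optimizing [M] gives the constant, and Bessel's inequality recovers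
   the norms of [f] and of its gradient.

   The resulting constant does not depend on [L]. The torus is the cell with
   [L = 2 pi] and zero mean; a test function on the plane is put in larger and
   larger cells, on which its mean tends to zero, and [H10] follows by density.

   The Hausdorff-Young inequality is proved for finite orthonormal families
   bounded by 1, by F. Riesz's argument on a maximizer, which avoids
   interpolation theory. *)

Require Import Defs.
From HB Require Import structures.
From mathcomp Require Import all_boot all_order all_algebra.
From mathcomp Require Import complex.
From mathcomp Require Import all_classical all_reals all_analysis measurable_realfun.
From mathcomp Require Import ring lra.
Import Order.TTheory GRing.Theory Num.Theory.
Import numFieldNormedType.Exports.
Local Open Scope classical_set_scope.
Local Open Scope ring_scope.
Set Implicit Arguments.
Unset Strict Implicit.
Unset Printing Implicit Defensive.

(** * The modulus and averages of complex-valued functions *)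

(** The delicate point is the lattice bound: a sum over k <> 0 is compared with an integral over the
    whole plane, without loss in the constant and for every M > 0. Comparing the term of k with the
    integral over the unit square around k shifts M by 1/6, because |x|^2 averages to |k|^2 + 1/6
    there. The missing square around 0 pays for this: what remains has max(|x|, |y|) >= 1/2, and in
    a sector bounded by the diagonals the radial integral starts at x = 1/2, where x^2 (1 + t^2) -
    1/6 >= 0. The exclusion of k = 0 is also why the mean has to vanish or be removed.

    Hausdorff-Young has to hold with constant 1. A maximizer at exponent q shows that a constant K
    at 2q - 2 gives the square root of K at q; starting from the number n of functions, repeated
    square roots tend to 1.

    The side L drops out because L^2 omega^2 = 4 pi^2, and pi / (4 pi^2) = 1 / (4 pi). No
    convergence of Fourier series in L^q is used: bounds for finite sums pass to the limit by L^2
    approximation and Fatou's lemma. *)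

Section modulus.
Variable R : realType.
Implicit Types z w : R[i].

Lemma cmodE z : cmod z = Num.sqrt (complex.Re z ^+ 2 + complex.Im z ^+ 2).
Proof. by case: z. Qed.

Lemma cmod_ge0 z : 0 <= cmod z.
Proof. by rewrite cmodE sqrtr_ge0. Qed.

Lemma cmod_sqr z : cmod z ^+ 2 = complex.Re z ^+ 2 + complex.Im z ^+ 2.
Proof. by rewrite cmodE sqr_sqrtr// addr_ge0// sqr_ge0. Qed.

Lemma cmodM z w : cmod (z * w) = cmod z * cmod w.
Proof. exact: ComplexField.Normc.normcM. Qed.

Lemma cmodD z w : cmod (z + w) <= cmod z + cmod w.
Proof. exact: le_normcD. Qed.

Lemma cmodN z : cmod (- z) = cmod z.
Proof. exact: normcN. Qed.

Lemma cmod0 : cmod (0 : R[i]) = 0.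
Proof. exact: ComplexField.Normc.normc0. Qed.

Lemma cmod_conj z : cmod (conjc z) = cmod z.
Proof. by rewrite !cmodE; case: z => a b /=; rewrite sqrrN. Qed.

Lemma cmod_real (x : R) : cmod (Complex x 0) = `|x|.
Proof. by rewrite cmodE /= expr0n addr0 sqrtr_sqr. Qed.

Lemma cmod_eq0 z : (cmod z == 0) = (z == 0).
Proof.
apply/eqP/eqP => [|->]; last exact: cmod0.
exact: ComplexField.Normc.eq0_normc.
Qed.

Lemma Re_le_cmod z : `|complex.Re z| <= cmod z.
Proof.
rewrite -ler_sqr ?nnegrE ?cmod_ge0// cmod_sqr (real_normK (num_real _)).
by rewrite lerDl sqr_ge0.
Qed.

Lemma Im_le_cmod z : `|complex.Im z| <= cmod z.
Proof.
rewrite -ler_sqr ?nnegrE ?cmod_ge0// cmod_sqr (real_normK (num_real _)).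
by rewrite lerDr sqr_ge0.
Qed.

Lemma cmod_le_ReIm z : cmod z <= `|complex.Re z| + `|complex.Im z|.
Proof.
rewrite -ler_sqr ?nnegrE ?cmod_ge0 ?addr_ge0// cmod_sqr sqrrD !(real_normK (num_real _)).
by rewrite lerD2r lerDl mulrn_wge0// mulr_ge0.
Qed.

Lemma cmod_sum (I : Type) (s : seq I) (P : pred I) (F : I -> R[i]) :
  cmod (\sum_(i <- s | P i) F i) <= \sum_(i <- s | P i) cmod (F i).
Proof.
elim/big_ind2 : _ => //; first by rewrite cmod0.
by move=> x a y b xa yb; rewrite (le_trans (cmodD _ _))// lerD.
Qed.

Lemma ler_dist_cmod z w : `|cmod z - cmod w| <= cmod (z - w).
Proof.
rewrite ler_norml; apply/andP; split.
  by rewrite lerNl opprB lerBlDr -[cmod (z - w)]cmodN opprB -{1}(subrK z w) cmodD.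
by rewrite lerBlDr -{1}(subrK w z) cmodD.
Qed.

Lemma Re_mul_conj z : complex.Re (z * conjc z) = cmod z ^+ 2.
Proof. by rewrite cmod_sqr; case: z => a b /=; ring. Qed.

Lemma ReD z w : complex.Re (z + w) = complex.Re z + complex.Re w.
Proof. by case: z; case: w. Qed.

Lemma ImD z w : complex.Im (z + w) = complex.Im z + complex.Im w.
Proof. by case: z; case: w. Qed.

Lemma ReM z w : complex.Re (z * w) = complex.Re z * complex.Re w - complex.Im z * complex.Im w.
Proof. by case: z; case: w. Qed.

Lemma ImM z w : complex.Im (z * w) = complex.Re z * complex.Im w + complex.Im z * complex.Re w.
Proof. by case: z; case: w. Qed.

Lemma ReN z : complex.Re (- z) = - complex.Re z.
Proof. by case: z. Qed.

Lemma ImN z : complex.Im (- z) = - complex.Im z.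
Proof. by case: z. Qed.

Lemma Re_sum (I : Type) (s : seq I) (P : pred I) (F : I -> R[i]) :
  complex.Re (\sum_(i <- s | P i) F i) = \sum_(i <- s | P i) complex.Re (F i).
Proof. by apply: (big_morph (@complex.Re R)) => //; exact: ReD. Qed.

Lemma Im_sum (I : Type) (s : seq I) (P : pred I) (F : I -> R[i]) :
  complex.Im (\sum_(i <- s | P i) F i) = \sum_(i <- s | P i) complex.Im (F i).
Proof. by apply: (big_morph (@complex.Im R)) => //; exact: ImD. Qed.

Lemma Re_conj z : complex.Re (conjc z) = complex.Re z.
Proof. by case: z. Qed.

Lemma Im_conj z : complex.Im (conjc z) = - complex.Im z.
Proof. by case: z. Qed.

Lemma cmod_sub_sqr z w :
  cmod (z - w) ^+ 2
  = cmod z ^+ 2 - complex.Re (conjc w * z) *+ 2 + cmod w ^+ 2.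
Proof. by rewrite !cmod_sqr; case: z => a b; case: w => c e /=; ring. Qed.

End modulus.

Section average.
Context d (T : measurableType d) (R : realType).
Variables (mu : {measure set T -> \bar R}) (D : set T).
Hypothesis mD : measurable D.
Hypothesis muD : (0 < mu D < +oo)%E.

Let V := fine (mu D).

Lemma fine_measure_gt0 : 0 < V.
Proof. by rewrite fine_gt0. Qed.
Let V0 := fine_measure_gt0.

Definition avg (f : T -> R) : R := V^-1 * \int[mu]_(x in D) f x.

Definition rint (f : T -> R) := mu.-integrable D (EFin \o f).

Lemma rintD f g : rint f -> rint g -> rint (fun x => f x + g x).
Proof. by move=> hf hg; exact: (integrableD mD hf hg). Qed.

Lemma rintZ k f : rint f -> rint (fun x => k * f x).
Proof. by move=> hf; have := integrableZl mD k hf. Qed.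

Lemma rintB f g : rint f -> rint g -> rint (fun x => f x - g x).
Proof. by move=> hf hg; exact: (integrableB mD hf hg). Qed.

Lemma rint_sum (I : Type) (s : seq I) (F : I -> T -> R) :
  (forall i, rint (F i)) -> rint (fun x => \sum_(i <- s) F i x).
Proof.
move=> hF; elim: s => [|i s ih].
  under eq_fun do rewrite big_nil.
  exact: integrable0.
under eq_fun do rewrite big_cons.
exact: rintD.
Qed.

Lemma avgD f g : rint f -> rint g -> avg (fun x => f x + g x) = avg f + avg g.
Proof. by move=> hf hg; rewrite /avg RintegralD// mulrDr. Qed.

Lemma avgB f g : rint f -> rint g -> avg (fun x => f x - g x) = avg f - avg g.
Proof. by move=> hf hg; rewrite /avg RintegralB// mulrBr. Qed.

Lemma avgZ k f : rint f -> avg (fun x => k * f x) = k * avg f.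
Proof. by move=> hf; rewrite /avg RintegralZl// mulrCA. Qed.

Lemma avg_cst k : avg (fun=> k) = k.
Proof. by rewrite /avg Rintegral_cst// mulrCA mulVf ?mulr1// gt_eqF. Qed.

Lemma avg_ge0 f : (forall x, D x -> 0 <= f x) -> 0 <= avg f.
Proof. by move=> f0; apply: mulr_ge0; [rewrite invr_ge0 ltW|exact: Rintegral_ge0]. Qed.

Lemma le_avg f g : rint f -> rint g -> (forall x, D x -> f x <= g x) ->
  avg f <= avg g.
Proof.
move=> hf hg fg; apply: ler_wpM2l; first by rewrite invr_ge0 ltW.
exact: le_Rintegral.
Qed.

Lemma eq_avg f g : (forall x, D x -> f x = g x) -> avg f = avg g.
Proof.
by move=> fg; congr (_ * _); apply: eq_Rintegral => x /set_mem/fg.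
Qed.

Lemma rint_cst k : rint (fun=> k).
Proof.
apply: measurable_bounded_integrable => //; first by case/andP: muD.
exact: bounded_cst.
Qed.

(** Both conditions concern the whole space rather than [D], so that one function can be averaged
    over cells of different sizes. *)
Definition bmeas (f : T -> R) :=
  measurable_fun setT f /\ exists M, forall x, `|f x| <= M.

Lemma bmeas_mul_rint f g : bmeas f -> rint g -> rint (fun x => f x * g x).
Proof.
move=> [mf [M hM]] hg.
have : mu.-integrable D ((EFin \o f) \* (EFin \o g))%E.
  apply: (@integrableMr _ _ _ mu D mD f (EFin \o g)) => //.
    exact: measurable_funS mf.
  exists `|M|; split; first exact: num_real.
  move=> N MN x Dx /=; rewrite (le_trans (hM x))//.
  by rewrite (le_trans (ler_norm _))// ltW.
by apply: eq_integrable.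
Qed.

Lemma bmeas_rint f : bmeas f -> rint f.
Proof.
move=> hf; have := bmeas_mul_rint hf (rint_cst 1).
by under eq_fun do rewrite mulr1.
Qed.

Lemma bmeas_cst k : bmeas (fun=> k).
Proof. by split => //; exists `|k|. Qed.

Lemma bmeasD f g : bmeas f -> bmeas g -> bmeas (fun x => f x + g x).
Proof.
move=> [mf [M hM]] [mg [N hN]]; split; first exact: (measurable_funD mf mg).
by exists (M + N) => x; rewrite (le_trans (ler_normD _ _))// lerD.
Qed.

Lemma bmeasM f g : bmeas f -> bmeas g -> bmeas (fun x => f x * g x).
Proof.
move=> [mf [M hM]] [mg [N hN]]; split; first exact: measurable_funM.
by exists (M * N) => x; rewrite normrM ler_pM.
Qed.

Lemma bmeasN f : bmeas f -> bmeas (fun x => - f x).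
Proof.
move=> hf; have := bmeasM (bmeas_cst (-1)) hf.
by under eq_fun do rewrite mulN1r.
Qed.

Lemma bmeasB f g : bmeas f -> bmeas g -> bmeas (fun x => f x - g x).
Proof. by move=> hf hg; apply: bmeasD => //; exact: bmeasN. Qed.

Lemma bmeas_sum (I : Type) (s : seq I) (F : I -> T -> R) :
  (forall i, bmeas (F i)) -> bmeas (fun x => \sum_(i <- s) F i x).
Proof.
move=> hF; elim: s => [|i s ih].
  under eq_fun do rewrite big_nil.
  exact: bmeas_cst.
under eq_fun do rewrite big_cons.
exact: bmeasD.
Qed.

Definition cbmeas (f : T -> R[i]) :=
  bmeas (fun x => complex.Re (f x)) /\ bmeas (fun x => complex.Im (f x)).

Definition crint (f : T -> R[i]) :=
  rint (fun x => complex.Re (f x)) /\ rint (fun x => complex.Im (f x)).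

Definition cavg (f : T -> R[i]) : R[i] :=
  Complex (avg (fun x => complex.Re (f x))) (avg (fun x => complex.Im (f x))).

Lemma cbmeas_crint f : cbmeas f -> crint f.
Proof. by move=> [? ?]; split; exact: bmeas_rint. Qed.

Lemma cbmeas_cst k : cbmeas (fun=> k).
Proof. by split; exact: bmeas_cst. Qed.

Lemma cbmeasD f g : cbmeas f -> cbmeas g -> cbmeas (fun x => f x + g x).
Proof.
move=> [? ?] [? ?]; split.
  by under eq_fun do rewrite ReD; exact: bmeasD.
by under eq_fun do rewrite ImD; exact: bmeasD.
Qed.

Lemma cbmeasM f g : cbmeas f -> cbmeas g -> cbmeas (fun x => f x * g x).
Proof.
move=> [? ?] [? ?]; split.
  by under eq_fun do rewrite ReM; apply: bmeasB; exact: bmeasM.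
by under eq_fun do rewrite ImM; apply: bmeasD; exact: bmeasM.
Qed.

Lemma cbmeas_conj f : cbmeas f -> cbmeas (fun x => conjc (f x)).
Proof.
move=> [? ?]; split; first by under eq_fun do rewrite Re_conj.
by under eq_fun do rewrite Im_conj; exact: bmeasN.
Qed.

Lemma cbmeas_sum (I : Type) (s : seq I) (F : I -> T -> R[i]) :
  (forall i, cbmeas (F i)) -> cbmeas (fun x => \sum_(i <- s) F i x).
Proof.
move=> hF; split.
  by under eq_fun do rewrite Re_sum; apply: bmeas_sum => i; case: (hF i).
by under eq_fun do rewrite Im_sum; apply: bmeas_sum => i; case: (hF i).
Qed.

Lemma cbmeas_mul_crint f g : cbmeas f -> crint g -> crint (fun x => f x * g x).
Proof.
move=> [? ?] [? ?]; split.
  by under eq_fun do rewrite ReM; apply: rintB; exact: bmeas_mul_rint.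
by under eq_fun do rewrite ImM; apply: rintD; exact: bmeas_mul_rint.
Qed.

Lemma crintZ k f : crint f -> crint (fun x => k * f x).
Proof. by move=> hf; apply: cbmeas_mul_crint => //; exact: cbmeas_cst. Qed.

Lemma cavgD f g : crint f -> crint g ->
  cavg (fun x => f x + g x) = cavg f + cavg g.
Proof.
move=> [? ?] [? ?]; rewrite /cavg.
under eq_fun do rewrite ReD.
under [X in Complex _ (avg X)]eq_fun do rewrite ImD.
by rewrite !avgD.
Qed.

Lemma cavgZ k f : crint f -> cavg (fun x => k * f x) = k * cavg f.
Proof.
move=> [? ?]; rewrite /cavg.
under eq_fun do rewrite ReM.
under [X in Complex _ (avg X)]eq_fun do rewrite ImM.
rewrite avgB ?avgD ?avgZ//; last 4 first. 
- exact: rintZ.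
- exact: rintZ.
- exact: rintZ.
- exact: rintZ.
by case: k.
Qed.

Lemma cavg0 : cavg (fun=> 0) = 0.
Proof. by rewrite /cavg /= !avg_cst. Qed.

Lemma crint_sum (I : Type) (s : seq I) (F : I -> T -> R[i]) :
  (forall i, crint (F i)) -> crint (fun x => \sum_(i <- s) F i x).
Proof.
move=> hF; split.
  by under eq_fun do rewrite Re_sum; apply: rint_sum => i; case: (hF i).
by under eq_fun do rewrite Im_sum; apply: rint_sum => i; case: (hF i).
Qed.

Lemma cavg_sum (I : Type) (s : seq I) (F : I -> T -> R[i]) :
  (forall i, crint (F i)) ->
  cavg (fun x => \sum_(i <- s) F i x) = \sum_(i <- s) cavg (F i).
Proof.
move=> hF; elim: s => [|i s ih].
  under eq_fun do rewrite big_nil.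
  by rewrite cavg0 big_nil.
under eq_fun do rewrite big_cons.
by rewrite cavgD ?ih ?big_cons//; exact: crint_sum.
Qed.

Lemma Re_cavg f : complex.Re (cavg f) = avg (fun x => complex.Re (f x)).
Proof. by []. Qed.

Lemma eq_cavg f g : (forall x, D x -> f x = g x) -> cavg f = cavg g.
Proof. by move=> fg; congr Complex; apply: eq_avg => x /fg ->. Qed.

Definition sqint (f : T -> R[i]) :=
  [/\ measurable_fun D (fun x => complex.Re (f x)),
      measurable_fun D (fun x => complex.Im (f x)) &
      rint (fun x => cmod (f x) ^+ 2)].

Lemma cbmeas_sqr f : cbmeas f -> bmeas (fun x => cmod (f x) ^+ 2).
Proof.
move=> [h1 h2]; under eq_fun do rewrite cmod_sqr !expr2.
by apply: bmeasD; exact: bmeasM.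
Qed.

Lemma cbmeas_sqint f : cbmeas f -> sqint f.
Proof.
move=> hf; split.
- by case: hf => -[+ _] _; exact: measurable_funS.
- by case: hf => _ [+ _]; exact: measurable_funS.
- by apply: bmeas_rint; exact: cbmeas_sqr.
Qed.

Lemma rint_le (f g : T -> R) : measurable_fun D f -> rint g ->
  (forall x, D x -> `|f x| <= g x) -> rint f.
Proof.
move=> mf hg fg; apply: (le_integrable mD _ _ hg); first exact/measurable_EFinP.
by move=> x Dx /=; rewrite lee_fin (le_trans (fg x Dx))// ler_norm.
Qed.

Lemma sqint_crint f : sqint f -> crint f.
Proof.
move=> [m1 m2 h]; have hle (z : R[i]) : cmod z <= 1 + cmod z ^+ 2.
  have := sqr_ge0 (cmod z - 1); have := cmod_ge0 z; nra.
split; apply: (@rint_le _ (fun x => 1 + cmod (f x) ^+ 2)) => //.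
- by apply: rintD => //; exact: rint_cst.
- by move=> x _; rewrite (le_trans (Re_le_cmod _)).
- by apply: rintD => //; exact: rint_cst.
- by move=> x _; rewrite (le_trans (Im_le_cmod _)).
Qed.

End average.

(** * The Hausdorff-Young inequality *)

Section powers.
Variable R : realType.
Implicit Types (x y z p q r s t : R).

(** Young's inequality, applied to each pair F i / a and G i / b and summed. *)
Lemma hoelder_sum_normalized (I : Type) (u : seq I) (F G : I -> R) p q (a b : R) :
  0 < p -> 0 < q -> p^-1 + q^-1 = 1 ->
  (forall i, 0 <= F i) -> (forall i, 0 <= G i) -> 0 < a -> 0 < b ->
  \sum_(i <- u) F i `^ p = a `^ p -> \sum_(i <- u) G i `^ q = b `^ q ->
  \sum_(i <- u) F i * G i <= a * b.
Proof.
move=> p0 q0 pq F0 G0 a0 b0 Fa Gb.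
have step i : F i * G i <= a * b * ((a `^ p)^-1 / p * F i `^ p + (b `^ q)^-1 / q * G i `^ q).
  have Fi : F i = a * (F i / a) by rewrite mulrC divfK ?gt_eqF.
  have Gi : G i = b * (G i / b) by rewrite mulrC divfK ?gt_eqF.
  have x0 : 0 <= F i / a by rewrite divr_ge0// ltW.
  have y0 : 0 <= G i / b by rewrite divr_ge0// ltW.
  have h := conjugate_powR x0 y0 p0 q0 pq.
  rewrite Fi Gi !(powRM p (ltW a0) x0) !(powRM q (ltW b0) y0).
  rewrite mulrACA ler_pM2l ?mulr_gt0// (le_trans h)// le_eqVlt; apply/orP; left; apply/eqP.
  have ap := powR_gt0 p a0; have bq := powR_gt0 q b0.
  by field; rewrite !gt_eqF.
apply: le_trans (ler_sum _ (fun i _ => step i)) _.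
rewrite -mulr_sumr big_split/= -!mulr_sumr Fa Gb.
have ap := powR_gt0 p a0; have bq := powR_gt0 q b0.
have -> : (a `^ p)^-1 / p * a `^ p = p^-1 by field; rewrite !gt_eqF.
have -> : (b `^ q)^-1 / q * b `^ q = q^-1 by field; rewrite !gt_eqF.
by rewrite pq mulr1.
Qed.

Lemma hoelder_sum (I : Type) (u : seq I) (F G : I -> R) p q :
  0 < p -> 0 < q -> p^-1 + q^-1 = 1 ->
  (forall i, 0 <= F i) -> (forall i, 0 <= G i) ->
  \sum_(i <- u) F i * G i <=
  (\sum_(i <- u) F i `^ p) `^ p^-1 * (\sum_(i <- u) G i `^ q) `^ q^-1.
Proof.
move=> p0 q0 pq F0 G0.
have SF0 : 0 <= \sum_(i <- u) F i `^ p by apply: sumr_ge0 => i _; exact: powR_ge0.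
have SG0 : 0 <= \sum_(i <- u) G i `^ q by apply: sumr_ge0 => i _; exact: powR_ge0.
(* The normalized form divides by both norms, so a vanishing norm is treated apart: then every
   product is zero. *)
have vanish (H : I -> R) r : 0 < r -> (forall i, 0 <= H i) ->
    \sum_(i <- u) H i `^ r = 0 -> \sum_(i <- u) H i = 0.
  move=> r0 H0; elim: u {SF0 SG0} => [|i u ih]; first by rewrite !big_nil.
  rewrite !big_cons => /eqP; rewrite paddr_eq0 ?powR_ge0 ?sumr_ge0//.
    by move=> /andP[/eqP/powR_eq0_eq0 -> /eqP/ih ->]; rewrite addr0.
  by move=> *; exact: powR_ge0.
have vanish2 (H K : I -> R) : (forall i, 0 <= H i) -> (forall i, 0 <= K i) ->
    \sum_(i <- u) H i = 0 -> \sum_(i <- u) H i * K i = 0.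
  move=> H0 K0; elim: u {SF0 SG0 vanish} => [|i u ih]; first by rewrite !big_nil.
  rewrite !big_cons => /eqP; rewrite paddr_eq0 ?sumr_ge0//.
  by move=> /andP[/eqP -> /eqP/ih ->]; rewrite mul0r addr0.
move: (SF0); rewrite le_eqVlt => /predU1P[/esym SF|SFp].
  by rewrite vanish2 ?mulr_ge0 ?powR_ge0// (vanish _ p).
move: (SG0); rewrite le_eqVlt => /predU1P[/esym SG|SGp].
  under eq_bigr do rewrite mulrC.
  by rewrite vanish2 ?mulr_ge0 ?powR_ge0// (vanish _ q).
apply: (@hoelder_sum_normalized _ _ _ _ p q); rewrite ?powR_gt0//.
  by rewrite -powRrM mulVf ?powRr1// gt_eqF.
by rewrite -powRrM mulVf ?powRr1// gt_eqF.
Qed.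

(** Convexity: y^q lies above its tangent at x. It is Young's inequality for x^(q-1) and y with
    exponents q/(q-1) and q, which also covers x = 0 and y = 0. *)
Lemma powR_tangent q x y : 1 < q -> 0 <= x -> 0 <= y ->
  q * (x `^ (q - 1) * y) <= y `^ q + (q - 1) * x `^ q.
Proof.
move=> q1 x0 y0; have q0 : 0 < q by lra.
have q10 : 0 < q - 1 by rewrite subr_gt0.
have := @conjugate_powR _ (x `^ (q - 1)) y (q / (q - 1)) q.
rewrite powR_ge0 y0 divr_gt0// q0 => /(_ isT isT isT isT).
have -> : (q / (q - 1))^-1 + q^-1 = 1 by field; rewrite !gt_eqF.
move=> /(_ erefl).
rewrite -powRrM mulrCA divff ?gt_eqF// mulr1 => /(ler_wpM2l (ltW q0)).
move/le_trans; apply; rewrite le_eqVlt; apply/orP; left; apply/eqP.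
by field; rewrite !gt_eqF.
Qed.

(** The tangent at the first point gives a^q - b^q <= q a^(q-1) (a - b); exchanging the points gives
    the other sign. *)
Lemma powR_lipschitz q M x y : 1 < q -> 0 <= x <= M -> 0 <= y <= M ->
  `|x `^ q - y `^ q| <= q * M `^ (q - 1) * `|x - y|.
Proof.
move=> q1 /andP[x0 xM] /andP[y0 yM]; have q0 : 0 < q by lra.
have H a b : 0 <= a <= M -> 0 <= b <= M ->
    a `^ q - b `^ q <= q * M `^ (q - 1) * `|a - b|.
  move=> /andP[a0 aM] /andP[b0 bM].
  have := powR_tangent q1 a0 b0.
  have := mulr_powRB1 a0 q0 => aE.
  have h1 : q * (a `^ (q - 1) * (a - b)) <= q * M `^ (q - 1) * `|a - b|.
    rewrite -mulrA ler_pM2l//.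
    apply: (@le_trans _ _ (a `^ (q - 1) * `|a - b|)).
      by rewrite ler_wpM2l ?powR_ge0// ler_norm.
    rewrite ler_wpM2r//; apply: ge0_ler_powR; rewrite ?nnegrE//; last exact: le_trans aM.
    by lra.
  by move: h1 aE; nra.
rewrite ler_norml; apply/andP; split; last by apply: H; rewrite ?x0 ?y0.
by rewrite lerNl opprB distrC; apply: H; rewrite ?x0 ?y0.
Qed.

(** The two sides agree at t = 0, so their difference has an interior minimum there and its
    derivative vanishes. That derivative is q (N A - b), because (q - 1) p = q. This extracts an
    Euler-Lagrange equation from a one-parameter variation. *)
Lemma first_order_touching p q (A N b : R) :
  1 < q -> p = q / (q - 1) -> 0 <= A <= 1 ->
  (forall t, -1 < t < 1 ->
     N + q * t * b <= N * (1 + A * ((1 + t) `^ p - 1)) `^ (q - 1)) ->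
  b = N * A.
Proof.
move=> q1 pE /andP[A0 A1] H; have q0 : 0 < q by lra.
have q10 : q - 1 != 0 by rewrite subr_eq0 gt_eqF.
pose g t : R := N * (1 + A * ((1 + t) `^ p - 1)) `^ (q - 1) - (N + q * t * b).
have dg t : -1 < t < 1 -> is_derive t (1 : R) g
    (N * ((q - 1) * (1 + A * ((1 + t) `^ p - 1)) `^ (q - 1 - 1) *
      (A * (p * (1 + t) `^ (p - 1)))) - q * b).
  move=> /andP[t1 t2].
  have t0 : 0 < 1 + t by rewrite -ltrBlDl add0r.
  have d1 : is_derive t (1 : R) (fun t : R => 1 + t) 1.
    by apply: is_derive_eq; rewrite add0r mulr1.
  have d2 : is_derive t (1 : R) (fun t : R => (1 + t) `^ p) (p * (1 + t) `^ (p - 1)).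
    have := @is_derive1_comp R (@powR R ^~ p) (fun t => 1 + t) t (p * (1 + t) `^ (p - 1)) 1.
    by move=> /(_ (is_derive1_powR _ t0) d1); rewrite !mulr1.
  have d3 : is_derive t (1 : R) (fun t : R => 1 + A * ((1 + t) `^ p - 1))
      (A * (p * (1 + t) `^ (p - 1))).
    by apply: is_derive_eq; rewrite /GRing.scale/=; ring.
  have pos : 0 < 1 + A * ((1 + t) `^ p - 1).
    have := powR_gt0 p t0; move: A0; rewrite le_eqVlt => /predU1P[<-|A0]; nra.
  have d4 := @is_derive1_comp R (@powR R ^~ (q - 1)) (fun t => 1 + A * ((1 + t) `^ p - 1)) t _ _
    (is_derive1_powR (q - 1) pos) d3.
  rewrite /= in d4.
  by apply: is_derive_eq; rewrite /GRing.scale/=; ring.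
have : is_derive (0 : R) (1 : R) g 0.
  apply: (@derive1_at_min R g (-1) 1 0) => //.
  - by move=> t; rewrite in_itv/= => /dg[].
  - by rewrite in_itv/= ltrN10 ltr01.
  - move=> t; rewrite in_itv/= => t1.
    have -> : g 0 = 0 by rewrite /g addr0 powR1 subrr mulr0 addr0 powR1; ring.
    by rewrite /g subr_ge0 H.
move=> dg0; have h0 : -1 < (0 : R) < 1 by rewrite ltrN10 ltr01.
have := @derive_val _ _ _ _ _ _ _ (dg 0 h0).
rewrite derive_val addr0 powR1 subrr mulr0 addr0 !powR1 pE => h.
have : q * (N * A - b) = 0 by rewrite [RHS]h; field.
move/eqP; rewrite mulf_eq0 gt_eqF//= subr_eq0 => /eqP //.
Qed.

End powers.

Section orthonormal.
Context d (T : measurableType d) (R : realType).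
Variables (mu : {measure set T -> \bar R}) (D : set T).
Hypothesis mD : measurable D.
Hypothesis muD : (0 < mu D < +oo)%E.
Variables (n : nat) (e : 'I_n -> T -> R[i]).
Hypothesis he : forall k, cbmeas (e k).
Hypothesis orth : forall k l,
  cavg mu D (fun x => e k x * conjc (e l x)) = (k == l)%:R.

Definition synth (a : 'I_n -> R[i]) (x : T) : R[i] := \sum_k a k * e k x.

Definition coef (f : T -> R[i]) (k : 'I_n) : R[i] :=
  cavg mu D (fun x => f x * conjc (e k x)).

Lemma cbmeas_synth a : cbmeas (synth a).
Proof. by apply: cbmeas_sum => k; apply: cbmeasM => //; exact: cbmeas_cst. Qed.

Lemma crint_mul_conj f k : crint mu D f -> crint mu D (fun x => f x * conjc (e k x)).
Proof.
move=> hf; under eq_fun do rewrite mulrC.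
by apply: cbmeas_mul_crint => //; exact: cbmeas_conj.
Qed.

Lemma coef_synth a k : coef (synth a) k = a k.
Proof.
rewrite /coef /synth; under eq_fun do rewrite mulr_suml.
under eq_fun do under eq_bigr do rewrite -mulrA.
rewrite cavg_sum//; last first.
  move=> i; apply: cbmeas_crint => //; apply: cbmeasM; first exact: cbmeas_cst.
  by apply: cbmeasM => //; exact: cbmeas_conj.
rewrite (bigD1 k)//= big1 ?addr0.
  rewrite cavgZ// ?orth ?eqxx ?mulr1//.
  apply: crint_mul_conj; exact: cbmeas_crint.
move=> i ik; rewrite cavgZ// ?orth ?(negbTE ik) ?mulr0//.
apply: crint_mul_conj; exact: cbmeas_crint.
Qed.

Lemma avg_Re_synth f a : crint mu D f ->
  avg mu D (fun x => complex.Re (conjc (synth a x) * f x)) =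
  \sum_k complex.Re (conjc (a k) * coef f k).
Proof.
move=> hf; rewrite -Re_cavg -Re_sum; congr complex.Re.
have -> : (fun x => conjc (synth a x) * f x) =
  (fun x => \sum_k conjc (a k) * (f x * conjc (e k x))).
  apply/funext => x; rewrite /synth rmorph_sum mulr_suml.
  by apply: eq_bigr => k _; rewrite rmorphM/= -mulrA [conjc (e k x) * _]mulrC.
rewrite cavg_sum//; last by move=> k; apply: crintZ => //; exact: crint_mul_conj.
by apply: eq_bigr => k _; rewrite cavgZ//; exact: crint_mul_conj.
Qed.

Lemma rint_Re_synth f a : crint mu D f ->
  rint mu D (fun x => complex.Re (conjc (synth a x) * f x)).
Proof.
move=> hf.
have [] := @cbmeas_mul_crint _ _ _ mu D mD (fun x => conjc (synth a x)) f _ hf => //.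
by apply: cbmeas_conj; exact: cbmeas_synth.
Qed.

Lemma parseval_synth a :
  avg mu D (fun x => cmod (synth a x) ^+ 2) = \sum_k cmod (a k) ^+ 2.
Proof.
have -> : (fun x => cmod (synth a x) ^+ 2) =
    (fun x => complex.Re (conjc (synth a x) * synth a x)).
  by apply/funext => x; rewrite mulrC Re_mul_conj.
rewrite avg_Re_synth; last by apply: cbmeas_crint => //; exact: cbmeas_synth.
by apply: eq_bigr => k _; rewrite coef_synth mulrC Re_mul_conj.
Qed.

Lemma rint_sub_synth f a : sqint mu D f ->
  rint mu D (fun x => cmod (f x - synth a x) ^+ 2).
Proof.
move=> hf; have hc := sqint_crint mD muD hf.
under eq_fun do rewrite cmod_sub_sqr.
apply: rintD => //.
  apply: rintB => //; first by case: hf.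
  by under eq_fun do rewrite mulr2n; apply: rintD => //; exact: rint_Re_synth.
by apply: bmeas_rint => //; apply: cbmeas_sqr; exact: cbmeas_synth.
Qed.

(** Expand the square and complete it in each coefficient. Only the last sum depends on [a], so
    Bessel's inequality and the best approximation property can both be read off. *)
Lemma avg_sub_synth f a : sqint mu D f ->
  avg mu D (fun x => cmod (f x - synth a x) ^+ 2) =
  avg mu D (fun x => cmod (f x) ^+ 2)
  - \sum_k cmod (coef f k) ^+ 2 + \sum_k cmod (a k - coef f k) ^+ 2.
Proof.
move=> hf; have hc := sqint_crint mD muD hf.
have h2 : rint mu D (fun x => complex.Re (conjc (synth a x) * f x) *+ 2).
  by under eq_fun do rewrite mulr2n; apply: rintD => //; exact: rint_Re_synth.
under eq_fun do rewrite cmod_sub_sqr.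
rewrite avgD//; last 2 first.
- by apply: rintB => //; case: hf.
- by apply: bmeas_rint => //; apply: cbmeas_sqr; exact: cbmeas_synth.
rewrite avgB//; last by case: hf.
under [X in _ - avg _ _ X + _]eq_fun do rewrite mulr2n.
rewrite avgD//; [|exact: rint_Re_synth..].
rewrite !avg_Re_synth// parseval_synth.
have -> : \sum_k cmod (a k - coef f k) ^+ 2 = \sum_k (cmod (a k) ^+ 2
    - complex.Re (conjc (a k) * coef f k) *+ 2 + cmod (coef f k) ^+ 2).
  by apply: eq_bigr => k _; rewrite cmod_sub_sqr !ReM !Re_conj !Im_conj; ring.
rewrite !big_split/= sumrN sumrMnl; ring.
Qed.

Lemma bessel f : sqint mu D f ->
  \sum_k cmod (coef f k) ^+ 2 <= avg mu D (fun x => cmod (f x) ^+ 2).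
Proof.
move=> hf; have := avg_sub_synth (coef f) hf.
rewrite [X in _ = _ + X]big1 ?addr0 => [h|k _]; last by rewrite subrr cmod0 expr0n.
rewrite -subr_ge0 -h.
by apply: avg_ge0 => // x _; rewrite sqr_ge0.
Qed.

Lemma synth_coef_best f a : sqint mu D f ->
  avg mu D (fun x => cmod (f x - synth (coef f) x) ^+ 2) <=
  avg mu D (fun x => cmod (f x - synth a x) ^+ 2).
Proof.
move=> hf; rewrite !avg_sub_synth// lerD2l [leLHS]big1 ?sumr_ge0//.
- by move=> k _; rewrite sqr_ge0.
- by move=> k _; rewrite subrr cmod0 expr0n.
Qed.

Hypothesis e1 : forall k x, cmod (e k x) <= 1.

Definition powsum (p : R) (a : 'I_n -> R[i]) : R := \sum_k cmod (a k) `^ p.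

Definition powavg (q : R) (a : 'I_n -> R[i]) : R :=
  avg mu D (fun x => cmod (synth a x) `^ q).

(** The inequality raised to the power q: with p = q / (q - 1) one has q / p = q - 1, so the
    right-hand factor is the q-th power of the l^p norm. *)
Definition hausdorff_young_const (q K : R) :=
  forall a, powavg q a <= K * (powsum (q / (q - 1)) a) `^ (q - 1).

Lemma powsum_ge0 p a : 0 <= powsum p a.
Proof. by apply: sumr_ge0 => k _; exact: powR_ge0. Qed.

Lemma bmeas_powR q (f : T -> R) : 0 <= q -> bmeas f -> (forall x, 0 <= f x) ->
  bmeas (fun x => f x `^ q).
Proof.
move=> q0 [mf [M hM]] f0; split.
  by have := measurableT_comp (measurable_powR q) mf.
exists (M `^ q) => x; rewrite ger0_norm ?powR_ge0//.
have fM : f x <= M by rewrite (le_trans _ (hM x))// ler_norm.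
by apply: ge0_ler_powR; rewrite ?nnegrE// (le_trans _ fM).
Qed.

Lemma cbmeas_cmod (f : T -> R[i]) : cbmeas f -> bmeas (fun x : T => cmod (f x)).
Proof.
move=> hf; have h2 : 0 <= (2 : R)^-1 by rewrite invr_ge0.
have := bmeas_powR h2 (cbmeas_sqr hf) (fun x => sqr_ge0 _).
by under eq_fun do rewrite powR12_sqrt ?sqr_ge0// sqrtr_sqr ger0_norm ?cmod_ge0//.
Qed.

Lemma bmeas_powsynth q a : 0 <= q -> bmeas (fun x : T => cmod (synth a x) `^ q).
Proof.
move=> q0; apply: bmeas_powR => //; last by move=> x; exact: cmod_ge0.
by apply: cbmeas_cmod; exact: cbmeas_synth.
Qed.

Lemma cmod_synth_le a x : cmod (synth a x) <= \sum_k cmod (a k).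
Proof.
rewrite (le_trans (cmod_sum _ _ _))//; apply: ler_sum => k _.
by rewrite cmodM ler_piMr ?cmod_ge0.
Qed.

(** Since each |e_k| <= 1, Hoelder's inequality against the constant sequence 1 gives |synth a| <=
    n^(1/q) times the l^p norm of [a], pointwise. The size of this constant is harmless because the
    iteration takes its 2^j-th root. *)
Lemma hausdorff_young_crude q : 1 < q -> hausdorff_young_const q n%:R.
Proof.
move=> q1 a; have q0 : 0 < q by lra.
have q10 : 0 < q - 1 by rewrite subr_gt0.
pose Z := n%:R * (powsum (q / (q - 1)) a) `^ (q - 1).
apply: (@le_trans _ _ (avg mu D (fun=> Z))); last by rewrite avg_cst.
apply: le_avg => //.
- by apply: bmeas_rint => //; apply: bmeas_powsynth; exact: ltW.
- exact: rint_cst.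
move=> x _; rewrite /Z.
have h := @hoelder_sum R 'I_n (index_enum _) (fun k => cmod (a k)) (fun=> 1)
   (q / (q - 1)) q.
have h2 : cmod (synth a x) <= (powsum (q / (q - 1)) a) `^ (q / (q - 1))^-1 * n%:R `^ q^-1.
  rewrite (le_trans (cmod_synth_le _ _))//.
  have := h (divr_gt0 q0 q10) q0.
  have -> : (q / (q - 1))^-1 + q^-1 = 1 by field; rewrite !gt_eqF.
  move=> /(_ erefl (fun k => cmod_ge0 _) (fun=> ler01)).
  under eq_bigr do rewrite mulr1; under [X in _ * X `^ _]eq_bigr do rewrite powR1.
  by rewrite [X in _ * X `^ _]sumr_const card_ord.
have := @ge0_ler_powR R q (ltW q0) _ _ _ _ h2.
rewrite !nnegrE cmod_ge0 mulr_ge0 ?powR_ge0// => /(_ isT isT) /le_trans; apply.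
rewrite powRM ?powR_ge0// -!powRrM mulVf ?gt_eqF// powRr1// mulrC.
have -> // : (q / (q - 1))^-1 * q = q - 1 by field; rewrite !gt_eqF.
Qed.

(** Real coordinates for the coefficients, so that compactness and the extreme value theorem for
    real row vectors apply. *)
Definition complex_coords (v : 'rV[R]_(n + n)) (k : 'I_n) : R[i] :=
  Complex (v ord0 (lshift n k)) (v ord0 (rshift n k)).

Lemma coords_surj a : exists v, complex_coords v = a.
Proof.
exists (row_mx (\row_k complex.Re (a k)) (\row_k complex.Im (a k))).
apply/funext => k; rewrite /complex_coords row_mxEl row_mxEr !mxE.
by case: (a k).
Qed.

Lemma coord_le_norm m (v : 'rV[R]_m) j : `|v ord0 j| <= `|v|.
Proof.
have /mapP[i Hi ->] : `|v ord0 j| \in [seq `|v x.1 x.2| | x : 'I_1 * 'I_m].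
  by apply/mapP; exists (ord0, j) => //=; rewrite mem_enum.
by rewrite [leRHS]/Num.norm /= mx_normrE; apply/bigmax_geP; right => /=; exists i.
Qed.

Lemma cmod_complex_coords_sub v w k : cmod (complex_coords v k - complex_coords w k) <= 2 * `|v - w|.
Proof.
rewrite (le_trans (cmod_le_ReIm _))// ReD ImD ReN ImN /=.
have := coord_le_norm (v - w) (lshift n k); have := coord_le_norm (v - w) (rshift n k).
rewrite !mxE; lra.
Qed.

Lemma local_lipschitz_continuous m (Phi : 'rV[R]_m -> R) :
  (forall v, exists c, forall w, `|v - w| <= 1 -> `|Phi v - Phi w| <= c * `|v - w|) ->
  continuous Phi.
Proof.
move=> H v; have [c hc] := H v; apply/(@cvgrPdist_le _ _ _ (nbhs v) (nbhs_filter v)) => eps eps0.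
have c0 : 0 < `|c| + 1 by rewrite ltr_wpDl.
near=> w.
have vw1 : `|v - w| <= 1.
  by near: w; apply: cvgr_dist_le => //; exact: cvg_id.
have vw2 : `|v - w| <= eps / (`|c| + 1).
  by near: w; apply: cvgr_dist_le; rewrite ?divr_gt0//; exact: cvg_id.
rewrite (le_trans (hc w vw1))// (@le_trans _ _ ((`|c| + 1) * `|v - w|))//.
  by rewrite ler_wpM2r// (le_trans (ler_norm _))// lerDl.
by rewrite mulrC -ler_pdivlMr.
Unshelve. all: by end_near. Qed.

Lemma bound_complex_coords v w : `|v - w| <= 1 -> forall k, cmod (complex_coords w k) <= 2 * `|v| + 2.
Proof.
move=> vw k; have := cmod_complex_coords_sub w v k; rewrite distrC.
have := cmod_complex_coords_sub v 0 k; rewrite subr0.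
have -> : complex_coords v k - complex_coords 0 k = complex_coords v k.
  by rewrite /complex_coords !mxE; simpc.
have := cmodD (complex_coords w k - complex_coords v k) (complex_coords v k); rewrite subrK.
lra.
Qed.

Lemma bound_complex_coords0 v k : cmod (complex_coords v k) <= 2 * `|v| + 2.
Proof. by apply: bound_complex_coords; rewrite subrr normr0. Qed.

Lemma powsum_continuous p : 1 < p -> continuous (fun v => powsum p (complex_coords v)).
Proof.
move=> p1; apply: local_lipschitz_continuous => v.
pose M := 2 * `|v| + 2.
exists (n%:R * (p * M `^ (p - 1) * 2)) => w vw.
rewrite /powsum -sumrB (le_trans (ler_norm_sum _ _ _))//.
apply: (@le_trans _ _ (\sum_(k < n) (p * M `^ (p - 1) * 2 * `|v - w|))); last first.
  by rewrite sumr_const card_ord -[leLHS]mulr_natl !mulrA.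
apply: ler_sum => k _.
apply: le_trans (@powR_lipschitz R p M _ _ p1 _ _) _.
- by rewrite cmod_ge0 bound_complex_coords0.
- by rewrite cmod_ge0 bound_complex_coords.
rewrite -[leRHS]mulrA ler_wpM2l ?mulr_ge0 ?powR_ge0//; first lra.
by rewrite (le_trans (ler_dist_cmod _ _))// cmod_complex_coords_sub.
Qed.

Lemma powavg_continuous q : 1 < q -> continuous (fun v => powavg q (complex_coords v)).
Proof.
move=> q1; apply: local_lipschitz_continuous => v.
have q0 : 0 <= q by lra.
pose M := n%:R * (2 * `|v| + 2).
have SM w : `|v - w| <= 1 -> forall x, cmod (synth (complex_coords w) x) <= M.
  move=> vw x; rewrite (le_trans (cmod_synth_le _ _))//.
  apply: (@le_trans _ _ (\sum_(k < n) (2 * `|v| + 2))).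
    by apply: ler_sum => k _; exact: bound_complex_coords.
  by rewrite sumr_const card_ord -[leLHS]mulr_natl.
exists (q * M `^ (q - 1) * (n%:R * 2)) => w vw.
set Z := _ * `|v - w|.
have pt x : `|cmod (synth (complex_coords v) x) `^ q - cmod (synth (complex_coords w) x) `^ q| <= Z.
  apply: le_trans (@powR_lipschitz R q M _ _ q1 _ _) _.
  - by rewrite cmod_ge0 SM// subrr normr0.
  - by rewrite cmod_ge0 SM.
  rewrite /Z -[leRHS]mulrA ler_wpM2l ?mulr_ge0 ?powR_ge0//.
  rewrite (le_trans (ler_dist_cmod _ _))//.
  have -> : synth (complex_coords v) x - synth (complex_coords w) x = synth (fun k => complex_coords v k - complex_coords w k) x.
    by rewrite /synth -sumrB; apply: eq_bigr => k _; rewrite mulrBl.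
  rewrite (le_trans (cmod_synth_le _ _))//.
  apply: (@le_trans _ _ (\sum_(k < n) (2 * `|v - w|))).
    by apply: ler_sum => k _; exact: cmod_complex_coords_sub.
  by rewrite sumr_const card_ord -[leLHS]mulr_natl mulrA.
have hv a : rint mu D (fun x => cmod (synth a x) `^ q).
  by apply: bmeas_rint => //; exact: bmeas_powsynth.
rewrite /powavg -(avgB mD (hv _) (hv _)) ler_norml; apply/andP; split.
  rewrite -[leLHS](avg_cst mD muD); apply: le_avg => //.
  - exact: rint_cst.
  - exact: rintB.
  - by move=> x _; have := pt x; rewrite ler_norml => /andP[].
rewrite -[leRHS](avg_cst mD muD); apply: le_avg => //.
- exact: rintB.
- exact: rint_cst.
- by move=> x _; have := pt x; rewrite ler_norml => /andP[].
Qed.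

Lemma powsum_scale p s a : 0 <= s ->
  powsum p (fun k => Complex s 0 * a k) = s `^ p * powsum p a.
Proof.
move=> s0; rewrite /powsum mulr_sumr; apply: eq_bigr => k _.
by rewrite cmodM cmod_real ger0_norm// powRM// cmod_ge0.
Qed.

Lemma powavg_scale q s a : 0 <= q -> 0 <= s ->
  powavg q (fun k => Complex s 0 * a k) = s `^ q * powavg q a.
Proof.
move=> q0 s0; rewrite /powavg -avgZ//; last first.
  by apply: bmeas_rint => //; exact: bmeas_powsynth.
apply: eq_avg => x _; rewrite -powRM ?cmod_ge0//; congr (_ `^ _).
have -> : synth (fun k => Complex s 0 * a k) x = Complex s 0 * synth a x.
  by rewrite /synth mulr_sumr; apply: eq_bigr => k _; rewrite mulrA.
by rewrite cmodM cmod_real ger0_norm.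
Qed.

Lemma powsum_eq0 p a : powsum p a = 0 -> forall k, a k = 0.
Proof.
move=> /eqP; rewrite /powsum psumr_eq0 => [/allP h k|k _]; last exact: powR_ge0.
have /eqP/powR_eq0_eq0/eqP := h k (mem_index_enum _).
by rewrite cmod_eq0 => /eqP.
Qed.

(** The unit sphere of l^p is compact and nonempty and [powavg] is continuous, so a maximum is
    attained on it. Homogeneity extends the bound from the sphere to all families. *)
Lemma hausdorff_young_maximizer q : 1 < q -> (0 < n)%N ->
  exists a, powsum (q / (q - 1)) a = 1 /\ hausdorff_young_const q (powavg q a).
Proof.
move=> q1 n0; set p := q / (q - 1).
have q0 : 0 < q by lra.
have q10 : 0 < q - 1 by rewrite subr_gt0.
have p1 : 1 < p by rewrite /p ltr_pdivlMr// mul1r; lra.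
have p0 : 0 < p by lra.
pose A : set 'rV[R]_(n + n) := [set v | powsum p (complex_coords v) = 1].
have A0 : A !=set0.
  have [v hv] := coords_surj (fun k : 'I_n => if val k == 0%N then 1 else 0).
  exists v; rewrite /A/= hv /powsum (bigD1 (Ordinal n0))//= big1 => [|k].
    by rewrite addr0 expr0n expr1n addr0 sqrtr1 powR1.
  by rewrite -val_eqE/= => /negbTE ->; rewrite cmod0 powR0 ?gt_eqF.
have cA : compact A.
  apply: bounded_closed_compact.
    exists 1; split => // M M1 v Av /=.
    rewrite (le_trans _ (ltW M1))//.
    rewrite [leLHS]/Num.norm /= mx_normrE; apply/bigmax_leP; split => //= -[i j] _ /=.
    have key k : cmod (complex_coords v k) <= 1.
      have hk : cmod (complex_coords v k) `^ p <= 1.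
        rewrite -Av /powsum (bigD1 k)//= lerDl.
        by apply: sumr_ge0 => *; exact: powR_ge0.
      rewrite leNgt; apply/negP => h.
      have := @gt0_ltr_powR _ p p0 1 (cmod (complex_coords v k)).
      rewrite !nnegrE ler01 cmod_ge0 => /(_ isT isT h).
      by rewrite powR1 ltNge hk.
    rewrite (ord1 i); case: (splitP j) => k jk.
      have -> : j = lshift n k by exact: val_inj.
      exact: le_trans (Re_le_cmod (complex_coords v k)) (key k).
    have -> : j = rshift n k by exact: val_inj.
    exact: le_trans (Im_le_cmod (complex_coords v k)) (key k).
  have -> : A = (fun v => powsum p (complex_coords v)) @^-1` [set 1].
    by apply/seteqP; split.
  apply: closed_comp => //.
  by move=> v _; exact: powsum_continuous.
have [v + hmax] := @EVT_max_rV R _ (fun v => powavg q (complex_coords v)) A A0 cA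
   (continuous_subspaceT (powavg_continuous q1)).
rewrite inE => Av; exists (complex_coords v); split => // a.
set sg := powsum p a.
have : 0 <= sg by exact: powsum_ge0.
rewrite le_eqVlt => /predU1P[/esym sg0|sg0].
  have a0 := powsum_eq0 sg0.
  rewrite /powavg.
  rewrite (@eq_avg _ _ _ mu D _ (fun=> 0)) ?avg_cst//; last first.
    move=> x _; rewrite /synth big1 ?cmod0 ?powR0 ?gt_eqF// => k _.
    by rewrite a0 mul0r.
  by rewrite mulr_ge0 ?powR_ge0// avg_ge0// => x _; exact: powR_ge0.
(* Dividing by the l^p norm sg^(1/p) moves [a] onto the sphere. *)
have [w hw] := coords_surj (fun k => Complex (sg `^ (- p^-1)) 0 * a k).
have Aw : w \in A.
  rewrite inE /A/= hw powsum_scale ?powR_ge0// -powRrM mulNr mulVf ?gt_eqF//.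
  by rewrite powR_inv1 ?ltW// mulVf ?gt_eqF.
have := hmax w Aw; rewrite hw powavg_scale ?powR_ge0 ?(ltW q0)//.
rewrite -powRrM => h.
have -> : q - 1 = p^-1 * q by rewrite /p; field; rewrite !gt_eqF.
have sp : 0 < sg `^ (p^-1 * q) by exact: powR_gt0.
by rewrite -ler_pdivrMr// mulrC -powRN -mulNr.
Qed.

(** Convexity of |z|^q on the complex plane, with gradient q |z|^(q-2) z at z. It combines the
    tangent inequality for the moduli with Re (conj z (z + w)) <= |z| |z + w|. *)
Lemma powR_tangent_complex (q : R) (z w : R[i]) : 2 < q ->
  cmod z `^ q + q * (cmod z `^ (q - 2) * complex.Re (conjc z * w))
  <= cmod (z + w) `^ q.
Proof.
move=> q2; have q1 : 1 < q by lra.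
have := powR_tangent q1 (cmod_ge0 z) (cmod_ge0 (z + w)).
have E1 : cmod z * cmod z `^ (q - 2) = cmod z `^ (q - 1).
  have -> : q - 2 = q - 1 - 1 by ring.
  by rewrite mulr_powRB1 ?cmod_ge0//; lra.
have E2 : cmod z * cmod z `^ (q - 1) = cmod z `^ q.
  by rewrite mulr_powRB1 ?cmod_ge0//; lra.
have h : complex.Re (conjc z * (z + w)) <= cmod z * cmod (z + w).
  by rewrite (le_trans (ler_norm _))// (le_trans (Re_le_cmod _))// cmodM cmod_conj.
have E3 : complex.Re (conjc z * (z + w)) = cmod z * cmod z + complex.Re (conjc z * w).
  by rewrite -expr2 cmod_sqr !ReM !Re_conj !Im_conj ReD ImD; ring.
have := ler_wpM2l (powR_ge0 (cmod z) (q - 2)) h; rewrite E3 => h2 h3.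
have q0 : 0 < q by lra.
have := ler_wpM2l (ltW q0) h2.
have -> : q * (cmod z `^ (q - 2) * (cmod z * cmod (z + w))) =
  q * (cmod z `^ (q - 1) * cmod (z + w)) by rewrite -E1; ring.
have -> : q * (cmod z `^ (q - 2) * (cmod z * cmod z + complex.Re (conjc z * w))) =
  q * cmod z `^ q + q * (cmod z `^ (q - 2) * complex.Re (conjc z * w)).
  by rewrite -E2 -E1; ring.
move: h3; lra.
Qed.

(* F. Riesz's convexity argument: the Euler-Lagrange relations of a maximizer
   [a] for the exponent [q] compare the Fourier coefficients of
   [|f|^(q-2) f] to [a]; Bessel's inequality for that function then involves
   the exponent [2q-2]. *)
Lemma hausdorff_young_step q K : 2 < q -> (0 < n)%N -> hausdorff_young_const (2 * q - 2) K ->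
  hausdorff_young_const q (Num.sqrt K).
Proof.
move=> q2 n0 HK; have q1 : 1 < q by lra.
have q0 : 0 < q by lra.
have q10 : 0 < q - 1 by lra.
have [a [a1 amax]] := hausdorff_young_maximizer q1 n0.
set N := powavg q a in amax; set p := q / (q - 1) in a1.
have p0 : 0 < p by rewrite /p divr_gt0.
have p1E : p - 1 = (q - 1)^-1 by rewrite /p; field; rewrite !gt_eqF.
have p1 : 0 < p - 1 by rewrite p1E invr_gt0.
have N0 : 0 <= N by apply: avg_ge0 => // x _; exact: powR_ge0.
suff NK : N <= Num.sqrt K.
  by move=> c; rewrite (le_trans (amax c))// ler_wpM2r// powR_ge0.
move: (N0); rewrite le_eqVlt => /predU1P[<-|Np]; first by rewrite sqrtr_ge0.
pose S := synth a.
pose g x : R[i] := Complex (cmod (S x) `^ (q - 2)) 0 * S x.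
have hS : cbmeas S by exact: cbmeas_synth.
have hg : cbmeas g.
  apply: cbmeasM => //; split => /=; last exact: bmeas_cst.
  by apply: bmeas_powsynth; lra.
have lagrange k : complex.Re (conjc (a k) * coef g k) = N * cmod (a k) `^ p.
  have hAk : 0 <= cmod (a k) `^ p <= 1.
    rewrite powR_ge0 -a1 /powsum (bigD1 k)//= lerDl.
    by apply: sumr_ge0 => *; exact: powR_ge0.
  apply: (@first_order_touching _ p q _ N _ q1 erefl hAk) => t /andP[t1 t2].
  (* Vary the modulus of the single coefficient a_k. Maximality bounds the q-th power average from
     above, convexity bounds it from below by its first-order part, and the two bounds touch at t =
     0. *)
  pose a' j := if j == k then Complex (1 + t) 0 * a j else a j.
  have t0 : 0 <= 1 + t by lra.
  have synthE x : synth a' x = S x + Complex t 0 * (a k * e k x).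
    rewrite /S /synth (bigD1 k)//= [in RHS](bigD1 k)//= /a' eqxx.
    rewrite (eq_bigr (fun j => a j * e j x)); last by move=> j /negbTE ->.
    have -> : Complex (1 + t) 0 = 1 + Complex t 0 by rewrite /=; simpc.
    by ring.
  have sumE : powsum p a' = 1 + cmod (a k) `^ p * ((1 + t) `^ p - 1).
    have h : powsum p a = 1 by exact: a1.
    rewrite /powsum (bigD1 k)//= in h.
    rewrite /powsum (bigD1 k)//= /a' eqxx cmodM cmod_real ger0_norm// powRM// ?cmod_ge0//.
    rewrite (eq_bigr (fun j => cmod (a j) `^ p)); last by move=> j /negbTE ->.
    by move: h; set u := \sum_(j < n | _) _; lra.
  have := amax a'; rewrite -/p sumE; apply: le_trans.
  have hSp r : 0 <= r -> rint mu D (fun x => cmod (S x) `^ r).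
    by move=> r0; apply: bmeas_rint => //; exact: bmeas_powsynth.
  have hRe : rint mu D (fun x => complex.Re (conjc (a k) * (g x * conjc (e k x)))).
    have [] // : crint mu D (fun x => conjc (a k) * (g x * conjc (e k x))).
    by apply: crintZ => //; apply: crint_mul_conj; exact: cbmeas_crint.
  have -> : N + q * t * complex.Re (conjc (a k) * coef g k) =
      avg mu D (fun x => cmod (S x) `^ q + q * t *
          complex.Re (conjc (a k) * (g x * conjc (e k x)))).
    rewrite avgD//; [|exact/hSp/ltW|exact: rintZ].
    rewrite avgZ//; congr (_ + _ * _).
    rewrite -Re_cavg cavgZ//; apply: crint_mul_conj; exact: cbmeas_crint.
  apply: le_avg => //.
  - by apply: rintD => //; [exact/hSp/ltW|exact: rintZ].
  - by apply: bmeas_rint => //; apply: bmeas_powsynth; exact: ltW.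
  move=> x _; rewrite synthE.
  apply: le_trans (powR_tangent_complex _ _ q2).
  have -> // : q * t * complex.Re (conjc (a k) * (g x * conjc (e k x))) =
    q * (cmod (S x) `^ (q - 2) * complex.Re (conjc (S x) * (Complex t 0 * (a k * e k x)))).
  rewrite /g; case: (S x) => z1 z2; case: (a k) => u1 u2; case: (e k x) => v1 v2.
  by rewrite /=; ring.
(* The relation [lagrange] and Re <= modulus give |coef g k| >= N |a_k|^(p-1) wherever a_k <> 0; the
   power vanishes otherwise. *)
have coef_ge k : N ^+ 2 * cmod (a k) `^ (2 * p - 2) <= cmod (coef g k) ^+ 2.
  have -> : 2 * p - 2 = (p - 1) * 2 by ring.
  rewrite powRrM (@powR_mulrn _ _ 2) ?powR_ge0// -exprMn.
  rewrite ler_sqr ?nnegrE ?cmod_ge0 ?(mulr_ge0 N0 (powR_ge0 _ _))//.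
  have [ak0|ak0] := eqVneq (cmod (a k)) 0.
    by rewrite ak0 powR0 ?gt_eqF// mulr0 cmod_ge0.
  have akp : 0 < cmod (a k) by rewrite lt_neqAle eq_sym ak0 cmod_ge0.
  rewrite -(ler_pM2l akp) mulrCA mulr_powRB1 ?cmod_ge0// -lagrange.
  by rewrite (le_trans (ler_norm _))// (le_trans (Re_le_cmod _))// cmodM cmod_conj.
set Sg := powsum (2 * p - 2) a.
have Sg0 : 0 < Sg.
  rewrite lt_neqAle powsum_ge0 andbT eq_sym; apply/eqP => /powsum_eq0 a0.
  have : powsum p a = 0 by apply: big1 => j _; rewrite a0 cmod0 powR0// gt_eqF.
  by rewrite a1 => /eqP; rewrite oner_eq0.
(* Bessel's inequality for [g], whose squared modulus is |S|^(2q-2). *)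
have step1 : N ^+ 2 * Sg <= powavg (2 * q - 2) a.
  apply: (@le_trans _ _ (\sum_k cmod (coef g k) ^+ 2)).
    by rewrite /Sg /powsum mulr_sumr; apply: ler_sum => j _; exact: coef_ge.
  apply: le_trans (bessel (cbmeas_sqint mD muD hg)) _.
  rewrite le_eqVlt; apply/orP; left; apply/eqP; apply: eq_avg => x _.
  rewrite /g cmodM cmod_real ger0_norm ?powR_ge0// mulrC.
  have -> : q - 2 = q - 1 - 1 by ring.
  rewrite mulr_powRB1 ?cmod_ge0//.
  have -> : 2 * q - 2 = (q - 1) * 2 by ring.
  by rewrite powRrM (@powR_mulrn _ _ 2) ?powR_ge0.
have r0 : 0 < 2 * q - 3 by lra.
have r1 : 0 < 2 * q - 4 by lra.
(* The exponent dual to 2q - 2 lies between 2p - 2 and p, being (2p - 2) / (2q - 3) + p (2q - 4) /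
   (2q - 3). Hoelder's inequality interpolates, and the p-sum equals 1 and drops out. This makes the
   factor [Sg] cancel at the end, leaving N^2 <= K. *)
have lyapunov : powsum ((2 * q - 2) / (2 * q - 2 - 1)) a <= Sg `^ (2 * q - 3)^-1.
  have -> : (2 * q - 2 - 1) = 2 * q - 3 by ring.
  have := @hoelder_sum R 'I_n (index_enum _)
    (fun k => cmod (a k) `^ ((2 * p - 2) / (2 * q - 3)))
    (fun k => cmod (a k) `^ (p * (2 * q - 4) / (2 * q - 3)))
    (2 * q - 3) ((2 * q - 3) / (2 * q - 4)) r0 (divr_gt0 r0 r1).
  have -> : (2 * q - 3)^-1 + ((2 * q - 3) / (2 * q - 4))^-1 = 1.
    by field; rewrite !gt_eqF.
  move=> /(_ erefl (fun k => powR_ge0 _ _) (fun k => powR_ge0 _ _)).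
  rewrite [X in _ <= X `^ _ * _](eq_bigr (fun k => cmod (a k) `^ (2 * p - 2))); last first.
    by move=> k _; rewrite -powRrM; congr (_ `^ _); field; rewrite gt_eqF.
  rewrite [X in _ <= _ * X `^ _](eq_bigr (fun k => cmod (a k) `^ p)); last first.
    by move=> k _; rewrite -powRrM; congr (_ `^ _); field; rewrite !gt_eqF.
  rewrite [X in _ <= _ * X `^ _]a1 powR1 mulr1; apply: le_trans.
  apply: ler_sum => k _; rewrite -powRD.
    rewrite le_eqVlt; apply/orP; left; apply/eqP; congr (_ `^ _).
    by rewrite /p; field; rewrite !gt_eqF.
  apply/implyP => /eqP h; exfalso; move: h.
  apply/eqP; rewrite gt_eqF// addr_gt0// divr_gt0// ?mulr_gt0//; lra.
have step2 : powavg (2 * q - 2) a <= K * Sg.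
  apply: le_trans (HK a) _.
  have K0 : 0 <= K.
    rewrite leNgt; apply/negP => K0.
    have := HK a; rewrite leNgt => /negP; apply.
    apply: (@lt_le_trans _ _ (N ^+ 2 * Sg)) => //.
    apply: (@le_lt_trans _ _ 0); last by rewrite mulr_gt0// exprn_gt0.
    by rewrite mulr_le0_ge0 ?powR_ge0// ltW.
  rewrite ler_wpM2l//.
  have -> : 2 * q - 2 - 1 = 2 * q - 3 by ring.
  have := @ge0_ler_powR R (2 * q - 3) (ltW r0) _ _ _ _ lyapunov.
  rewrite !nnegrE powsum_ge0 powR_ge0 => /(_ isT isT).
  have -> : 2 * q - 2 - 1 = 2 * q - 3 by ring.
  by rewrite -powRrM mulVf ?gt_eqF// powRr1// ltW.
have NK : N ^+ 2 <= K by rewrite -(ler_pM2r Sg0) (le_trans step1).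
by rewrite -(ger0_norm N0) -sqrtr_sqr ler_wsqrtr.
Qed.

(** The map q |-> 2q - 2 keeps exponents above 2, so j steps lead to the crude bound at a larger
    exponent, and each step back takes one square root. *)
Lemma hausdorff_young_iter j q : 2 < q -> (0 < n)%N -> hausdorff_young_const q (n%:R `^ (2^-1 ^+ j)).
Proof.
elim: j q => [|j ih] q q2 n0.
  by rewrite expr0 powRr1//; apply: hausdorff_young_crude; lra.
rewrite exprS mulrC powRrM powR12_sqrt ?powR_ge0//.
by apply: hausdorff_young_step => //; apply: ih => //; lra.
Qed.

Lemma hausdorff_young q a : 2 <= q ->
  powavg q a <= (powsum (q / (q - 1)) a) `^ (q - 1).
Proof.
(* At q = 2 the claim is Parseval's identity; above 2, j tends to infinity in the iterated bound and
   n^(2^-j) tends to 1. *)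
rewrite le_eqVlt => /predU1P[<-|q2].
  have -> : (2 : R) - 1 = 1 by ring.
  rewrite divr1 powRr1 ?powsum_ge0// /powavg /powsum.
  have -> : \sum_k cmod (a k) `^ 2 = \sum_k cmod (a k) ^+ 2.
    by apply: eq_bigr => k _; rewrite -powR_mulrn ?cmod_ge0.
  rewrite -parseval_synth le_eqVlt; apply/orP; left; apply/eqP.
  by apply: eq_avg => x _; rewrite -powR_mulrn ?cmod_ge0.
have [n0|n0] := posnP n.
  rewrite /powavg (@eq_avg _ _ _ mu D _ (fun=> 0)) ?avg_cst ?powR_ge0// => x _.
  rewrite /synth big1 ?cmod0 ?powR0 ?gt_eqF//; first lra.
  by move=> k; have := ltn_ord k; rewrite {2}n0.
set X := _ `^ (q - 1).
have h j : powavg q a <= n%:R `^ (2^-1 ^+ j) * X by exact: hausdorff_young_iter.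
have l1 : (2^-1 : R) ^+ j @[j --> \oo] --> (0 : R).
  by apply: cvg_expr; rewrite ger0_norm ?invr_ge0// invf_lt1// ltr1n.
have l2 : 2^-1 ^+ j * ln (n%:R : R) @[j --> \oo] --> 0 * ln (n%:R : R).
  exact: (cvgMr_tmp (b := ln n%:R) l1).
have l3 : expR (2^-1 ^+ j * ln (n%:R : R)) @[j --> \oo] --> expR (0 * ln (n%:R : R)).
  exact: (continuous_cvg _ (@continuous_expR R _) l2).
have lim : n%:R `^ (2^-1 ^+ j) * X @[j --> \oo] --> X.
  rewrite mul0r expR0 in l3.
  rewrite -[X in _ --> X]mul1r; apply: cvgMr_tmp.
  rewrite (_ : (fun j => _) = (fun j => expR (2^-1 ^+ j * ln (n%:R : R))))//.
  by apply/funext => j; rewrite /powR pnatr_eq0 -[_ == _]negbK -lt0n n0.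
rewrite -(cvg_lim _ lim)//; apply: limr_ge; first by apply/cvg_ex; exists X.
by near=> j; exact: h.
Unshelve. all: by end_near.
Qed.

End orthonormal.

(** * A sum over the nonzero points of the square lattice *)

Lemma ge0_integralD4 d (T : measurableType d) (R : realType)
    (m : {measure set T -> \bar R}) (f1 f2 f3 f4 : T -> \bar R) :
  measurable_fun setT f1 -> measurable_fun setT f2 ->
  measurable_fun setT f3 -> measurable_fun setT f4 ->
  (forall x, (0 <= f1 x)%E) -> (forall x, (0 <= f2 x)%E) ->
  (forall x, (0 <= f3 x)%E) -> (forall x, (0 <= f4 x)%E) ->
  (\int[m]_x (f1 x + f2 x + (f3 x + f4 x)) =
   \int[m]_x f1 x + \int[m]_x f2 x + (\int[m]_x f3 x + \int[m]_x f4 x))%E.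
Proof.
move=> m1 m2 m3 m4 p1 p2 p3 p4.
rewrite ge0_integralD//; [|by move=> *; rewrite adde_ge0|exact: emeasurable_funD
  |by move=> *; rewrite adde_ge0|exact: emeasurable_funD].
by rewrite ge0_integralD// ge0_integralD.
Qed.

Section calculus.
Variable R : realType.
Notation mu := (@lebesgue_measure R).

Lemma is_derive_continuous (F : R -> R) (x l : R) : is_derive x 1 F l ->
  {for x, continuous F}.
Proof.
by move=> dF; apply: differentiable_continuous; apply/derivable1_diffP; case: dF.
Qed.

Lemma integral_derive_itv (f F : R -> R) (a b : R) : a < b ->
  (forall x, a <= x <= b -> is_derive x 1 F (f x)) ->
  (forall x, a <= x <= b -> {for x, continuous f}) ->
  (\int[mu]_(x in `[a, b]) (f x)%:E = (F b - F a)%:E)%E.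
Proof.
move=> ab dF cf; rewrite (@continuous_FTC2 _ _ F)//.
- by apply: continuous_in_subspaceT => x; rewrite inE/= in_itv/=; exact: cf.
- split.
  + move=> x; rewrite in_itv/= => /andP[ax xb].
    by have [] : is_derive x 1 F (f x) by apply: dF; rewrite !ltW.
  + apply: cvg_at_right_filter; apply: (@is_derive_continuous _ _ (f a)).
    by apply: dF; rewrite lexx ltW.
  + apply: cvg_at_left_filter; apply: (@is_derive_continuous _ _ (f b)).
    by apply: dF; rewrite lexx ltW.
- move=> x; rewrite in_itv/= => /andP[ax xb]; rewrite derive1E.
  by have [] : is_derive x 1 F (f x) by apply: dF; rewrite !ltW.
Qed.

Lemma integrable_itv_continuous (f : R -> R) (a b : R) :
  (forall x, a <= x <= b -> {for x, continuous f}) ->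
  mu.-integrable `[a, b] (EFin \o f).
Proof.
move=> cf; apply: continuous_compact_integrable; first exact: segment_compact.
by apply: continuous_in_subspaceT => x; rewrite inE/= in_itv/=; exact: cf.
Qed.

Lemma continuous_powR (u : R -> R) (c x : R) : 0 < u x -> {for x, continuous u} ->
  {for x, continuous (fun y => u y `^ c)}.
Proof.
move=> ux cu; have h := is_derive_continuous (is_derive1_powR c ux).
exact: (@continuous_comp _ _ _ u (@powR R ^~ c) x cu h).
Qed.

Lemma ge0_integral_opp (f : R -> \bar R) : measurable_fun setT f ->
  (forall x, (0 <= f x)%E) -> (\int[mu]_x f (- x)%R = \int[mu]_x f x)%E.
Proof.
move=> mf f0.
have mN : measurable_fun setT (-%R : measurableTypeR R -> measurableTypeR R).
  by apply: continuous_measurable_fun; exact: opp_continuous.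
have h := @ge0_integral_pushforward _ _ (measurableTypeR R) (measurableTypeR R) R
  -%R mN mu setT f measurableT mf (fun x _ => f0 x).
rewrite preimage_setT in h; rewrite -[LHS]h.
by apply: eq_measure_integral => //= A mA _; exact: lebesgue_measureN.
Qed.

(** With u = s / s0 this reads 1 - r (u - 1) <= exp (- r ln u), which follows from exp x >= 1 + x
    and ln u <= u - 1. *)
Lemma powRN_tangent (r s s0 : R) : 0 < r -> 0 < s -> 0 < s0 ->
  s0 `^ (- r) - r * s0 `^ (- r - 1) * (s - s0) <= s `^ (- r).
Proof.
move=> r0 s_gt0 s0_gt0.
have E : s0 `^ (- r - 1) = s0 `^ (- r) / s0.
  by rewrite powRD ?powR_inv1 ?ltW//; apply/implyP => _; rewrite gt_eqF.
have u0 : 0 < s / s0 by rewrite divr_gt0.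
have -> : s `^ (- r) = s0 `^ (- r) * (s / s0) `^ (- r).
  by rewrite -powRM ?(ltW s0_gt0) ?(ltW u0)// mulrC divfK// gt_eqF.
rewrite E.
have -> : s0 `^ (- r) - r * (s0 `^ (- r) / s0) * (s - s0) =
   s0 `^ (- r) * (1 - r * (s / s0 - 1)) by field; rewrite gt_eqF.
rewrite ler_wpM2l ?powR_ge0// /powR gt_eqF//.
apply: le_trans (expR_ge1Dx _).
have := @le_ln1Dx R (s / s0 - 1).
have -> : 1 + (s / s0 - 1) = s / s0 by ring.
rewrite ltrBrDr addrC subrr => /(_ u0); nra.
Qed.

(* Jensen's inequality at the constant, which is the average of [C + y^2] over
   the interval. *)
Lemma jensen_unit_interval (C r j : R) : 0 < r ->
  (forall y, j - 2^-1 <= y <= j + 2^-1 -> 0 < C + y ^+ 2) ->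
  0 < C + j ^+ 2 + 12^-1 ->
  (((C + j ^+ 2 + 12^-1) `^ (- r))%R%:E <=
   \int[mu]_(y in `[(j - 2^-1)%R, (j + 2^-1)%R]) ((C + y ^+ 2) `^ (- r))%R%:E)%E.
Proof.
move=> r0 Cpos s0; set s := C + j ^+ 2 + 12^-1 in s0 *.
(* [l] is the tangent of s^-r at the mean, composed with C + y^2; its integral over the interval of
   length 1 is the value at the mean. *)
pose k := r * s `^ (- r - 1).
pose l y := s `^ (- r) - k * (C + y ^+ 2 - s).
have cC x : {for x, continuous (fun y : R => C + y ^+ 2)}.
  by apply: (@is_derive_continuous _ _ (x *+ 2)); apply: is_derive_eq;
     rewrite /GRing.scale/=; ring.
have -> : (s `^ (- r))%:E = (\int[mu]_(y in `[(j - 2^-1)%R, (j + 2^-1)%R]) (l y)%:E)%E.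
  have dl x : is_derive x (1 : R)
      (fun y => s `^ (- r) * y - k * (y ^+ 3 / 3 + (C - s) * y)) (l x).
    by apply: is_derive_eq; rewrite /l /GRing.scale/=; field.
  have cl x : {for x, continuous l}.
    apply: (@is_derive_continuous _ _ (- k * (x *+ 2))).
    by apply: is_derive_eq; rewrite /GRing.scale/=; ring.
  have jj : j - 2^-1 < j + 2^-1 by lra.
  have -> := integral_derive_itv jj (fun x _ => dl x) (fun x _ => cl x).
  by congr (_%:E); rewrite /s; field.
apply: le_integral => //.
- apply: integrable_itv_continuous => x _.
  apply: (@is_derive_continuous _ _ (- k * (x *+ 2))).
  by apply: is_derive_eq; rewrite /GRing.scale/=; ring.
- apply: integrable_itv_continuous => x hx.
  by apply: continuous_powR; [exact: Cpos|exact: cC].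
- move=> x; rewrite inE/= in_itv/= => hx; rewrite lee_fin /l /k.
  by apply: powRN_tangent => //; exact: Cpos.
Qed.

Lemma tonelli_setX (I J : set R) (f : R -> R -> \bar R) :
  measurable I -> measurable J ->
  measurable_fun setT (fun z : mplane R => f z.1 z.2) ->
  (forall x y, I x -> J y -> (0 <= f x y)%E) ->
  (\int[mu]_(x in I) \int[mu]_(y in J) f x y =
   \int[mu]_(y in J) \int[mu]_(x in I) f x y)%E.
Proof.
move=> mI mJ mf f0.
pose g : mplane R -> \bar R := (fun z : mplane R => f z.1 z.2) \_ (I `*` J).
have mg : measurable_fun setT g.
  apply/(measurable_restrictT _ _).1; first exact: measurableX.
  exact: measurable_funS mf.
have g0 z : (0 <= g z)%E.
  by rewrite /g patchE; case: ifPn => // /set_mem[/= h1 h2]; exact: f0.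
have := fubini_tonelli (m1 := mu) (m2 := mu) g mg g0.
have E1 x : (\int[mu]_y g (x, y) = (fun x => \int[mu]_(y in J) f x y) \_ I x)%E.
  rewrite patchE; case: ifPn => xI.
    rewrite [RHS]integral_mkcond; apply: eq_integral => y _; rewrite /g !patchE.
    by congr (if _ then _ else _); apply/idP/idP; rewrite !inE/=; [case|split => //; exact: set_mem].
  apply: integral0_eq => y _; rewrite /g patchE ifF//; apply/negbTE/negP.
  by rewrite inE/= => -[xI' _]; move/negP: xI; apply; rewrite inE.
have E2 y : (\int[mu]_x g (x, y) = (fun y => \int[mu]_(x in I) f x y) \_ J y)%E.
  rewrite patchE; case: ifPn => yJ.
    rewrite [RHS]integral_mkcond; apply: eq_integral => x _; rewrite /g !patchE.
    by congr (if _ then _ else _); apply/idP/idP; rewrite !inE/=; [case|split => //; exact: set_mem].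
  apply: integral0_eq => x _; rewrite /g patchE ifF//; apply/negbTE/negP.
  by rewrite inE/= => -[_ yJ']; move/negP: yJ; apply; rewrite inE.
under eq_integral do rewrite E1.
under [X in _ = X -> _]eq_integral do rewrite E2.
by rewrite -!integral_mkcond.
Qed.

Lemma measurable_integral_section (I : set R) (f : R -> R -> \bar R) :
  measurable I -> measurable_fun setT (fun z : mplane R => f z.1 z.2) ->
  (forall x y, I x -> (0 <= f x y)%E) ->
  measurable_fun setT (fun y => \int[mu]_(x in I) f x y)%E.
Proof.
move=> mI mf f0.
pose g : mplane R -> \bar R := (fun z : mplane R => f z.1 z.2) \_ (I `*` setT).
have mg : measurable_fun setT g.
  apply/(measurable_restrictT _ _).1; first exact: measurableX.
  exact: measurable_funS mf.
have g0 z : (0 <= g z)%E.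
  by rewrite /g patchE; case: ifPn => // /set_mem[/= h1 _]; exact: f0.
have := measurable_fun_fubini_tonelli_G (m1 := mu) g mg g0.
congr (measurable_fun _ _); apply/funext => y.
rewrite [RHS]integral_mkcond; apply: eq_integral => x _; rewrite /g !patchE.
by congr (if _ then _ else _); apply/idP/idP; rewrite !inE/=; [case|split].
Qed.

Lemma integral_oneDsqr : (\int[mu]_(t in `[(-1)%R, 1%R]) ((1 + t ^+ 2)^-1)%R%:E = (pi / 2)%:E)%E.
Proof.
have m11 : (-1 : R) < 1 by lra.
have -> := integral_derive_itv m11 (fun x _ => is_derive1_atan x).
  by rewrite atanN atan1; congr (_%:E); field.
by move=> x _; exact: continuous_oneDsqrV.
Qed.

Section cone.
Variables (M r N : R).
Hypotheses (M0 : 0 < M) (r1 : 1 < r) (N1 : 1 <= N).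

(* The average of [x^2 + y^2] over the unit square centred at a lattice point [k]
   is [|k|^2 + 1/6], so that Jensen's inequality bounds the lattice term of [k]
   by the integral of [shifted_radial] over that square. *)
Definition shifted_radial (x y : R) : R := (x ^+ 2 + y ^+ 2 + (M - 6^-1)) `^ (- r).

(** Putting y = x t straightens the cone |y| <= x into a product set, so that the order of
    integration can be exchanged and the radial integral done first, in closed form. *)
Lemma cone_substitution (x : R) : 2^-1 <= x ->
  (\int[mu]_(y in `[(- x)%R, x]) (shifted_radial x y)%:E =
   \int[mu]_(t in `[(-1)%R, 1%R]) (x * (x ^+ 2 * (1 + t ^+ 2) + (M - 6^-1)) `^ (- r))%R%:E)%E.
Proof.
have M0' := M0; move=> x2.
(* The base may be negative near the origin; here x^2 >= 1/4 outweighs 1/6 for every M > 0. *)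
have pos (y : R) : 0 < x ^+ 2 + y ^+ 2 + (M - 6^-1).
  have h4 : 4^-1 <= x ^+ 2 by nra.
  have y2 : 0 <= y ^+ 2 by exact: sqr_ge0.
  by lra.
have dF t : is_derive t (1 : R) (fun t => x * t) x.
  by apply: is_derive_eq; rewrite /GRing.scale/=; ring.
have F'E : (fun t => x * t)^`()%classic = cst x.
  by apply/funext => t; rewrite derive1E; have [] := dF t.
have := @integration_by_substitution_increasing R (fun t => x * t) (shifted_radial x) (-1) 1.
rewrite F'E mulrN mulr1; move=> ->.
- apply: eq_integral => t _; rewrite /= /shifted_radial; congr EFin.
  rewrite fctE mulrC; congr (_ * _ `^ _); ring.
- lra.
- move=> a b _ _ ab; rewrite ltr_pM2l//; lra.
- move=> t _; exact: cst_continuous.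
- exact: is_cvg_cst.
- exact: is_cvg_cst.
- split.
  + by move=> t _; have [] := dF t.
  + by apply: cvg_at_right_filter; exact: (is_derive_continuous (dF _)).
  + by apply: cvg_at_left_filter; exact: (is_derive_continuous (dF _)).
- apply: continuous_in_subspaceT => y _.
  apply: (@continuous_powR (fun y => x ^+ 2 + y ^+ 2 + (M - 6^-1)) (- r) y).
    exact: pos.
  apply: (@is_derive_continuous _ _ (y *+ 2)); apply: is_derive_eq;
     rewrite /GRing.scale/=; ring.
Qed.

(** The integrand has an explicit antiderivative. At x = 1/2 the base is u/4 + M - 1/6 with u = 1 +
    t^2 >= 1, hence at least M: the omitted central square compensates the shift. The contribution
    of x = N has the favourable sign. *)
Lemma cone_radial (t : R) :
  (\int[mu]_(x in `[2^-1%R, N]) (x * (x ^+ 2 * (1 + t ^+ 2) + (M - 6^-1)) `^ (- r))%R%:E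
   <= (M `^ (1 - r) / (2 * (r - 1)) * (1 + t ^+ 2)^-1)%R%:E)%E.
Proof.
have M0' := M0; have r1' := r1; have N1' := N1.
set u := 1 + t ^+ 2; have u1 : 1 <= u by rewrite lerDl sqr_ge0.
have u0 : u != 0 by rewrite gt_eqF//; lra.
have r0 : 1 - r != 0 by rewrite lt_eqF//; lra.
have base x : 2^-1 <= x <= N -> 0 < x ^+ 2 * u + (M - 6^-1).
  by move=> /andP[x2 _]; nra.
have dB x : is_derive x (1 : R) (fun x => x ^+ 2 * u + (M - 6^-1)) (2 * x * u).
  by apply: is_derive_eq; rewrite /GRing.scale/=; ring.
have h : 2^-1 < N by lra.
pose F x := (x ^+ 2 * u + (M - 6^-1)) `^ (1 - r) * (2 * (1 - r) * u)^-1.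
have dF x : 2^-1 <= x <= N -> is_derive x (1 : R) F (x * (x ^+ 2 * u + (M - 6^-1)) `^ (- r)).
  move=> hx.
  have d := @is_derive1_comp R (@powR R ^~ (1 - r)) (fun x => x ^+ 2 * u + (M - 6^-1)) x _ _
    (is_derive1_powR (1 - r) (base x hx)) (dB x).
  rewrite /= in d.
  have -> : - r = 1 - r - 1 by ring.
  apply: is_derive_eq; rewrite /GRing.scale/=; field.
  by rewrite u0 r0.
have -> := integral_derive_itv h dF.
  rewrite lee_fin /F.
  have hN : 0 <= (N ^+ 2 * u + (M - 6^-1)) `^ (1 - r) by exact: powR_ge0.
  have hM : (2^-1 ^+ 2 * u + (M - 6^-1)) `^ (1 - r) <= M `^ (1 - r).
    have -> : 1 - r = - (r - 1) by ring.
    rewrite !powRN lef_pV2 ?posrE ?powR_gt0//; last by apply: base; rewrite lexx ltW.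
    apply: ge0_ler_powR; rewrite ?nnegrE; [lra|exact: ltW|nra|nra].
  have -> : (2 * (1 - r) * u)^-1 = - (2 * (r - 1) * u)^-1.
    by field; rewrite u0 r0 -oppr_eq0 opprB r0.
  have -> : M `^ (1 - r) / (2 * (r - 1)) * u^-1 = M `^ (1 - r) * (2 * (r - 1) * u)^-1.
    by field; rewrite u0 -oppr_eq0 opprB r0.
  have : 0 < (2 * (r - 1) * u)^-1 by rewrite invr_gt0 mulr_gt0//; lra.
  nra.
move=> x hx.
have c1 : {for x, continuous (fun x : R => (x ^+ 2 * u + (M - 6^-1)) `^ (- r))}.
  by apply: continuous_powR; [exact: base|exact: (is_derive_continuous (dB x))].
exact: (@continuousM _ _ id _ x (@cvg_id _ _) c1).
Qed.

Lemma measurable_cone_integrand : measurable_fun setT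
  (fun z : mplane R => (z.1 * (z.1 ^+ 2 * (1 + z.2 ^+ 2) + (M - 6^-1)) `^ (- r))%R%:E).
Proof.
apply/measurable_EFinP; apply: measurable_funM; first exact: measurable_fst.
apply: (measurableT_comp (measurable_powR (- r))).
apply: measurable_funD => //; apply: measurable_funM.
  by apply: measurable_funX; exact: measurable_fst.
apply: measurable_funD => //.
by apply: measurable_funX; exact: measurable_snd.
Qed.

(** The remaining angular factor 1 / (1 + t^2) has integral pi / 2 over [-1, 1], and the radial
    bound carries another 1/2. Four cones then add up to the factor pi of the full plane. *)
Lemma cone_integral :
  (\int[mu]_(x in `[2^-1%R, N]) \int[mu]_(y in `[(- x)%R, x]) (shifted_radial x y)%:E
   <= (pi / 4 * (M `^ (1 - r) / (r - 1)))%R%:E)%E.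
Proof.
have M0' := M0; have r1' := r1; have N1' := N1.
under eq_integral => x xI.
  rewrite cone_substitution; last by move: xI; rewrite inE/= in_itv/= => /andP[].
  over.
have m1 := measurable_cone_integrand.
rewrite tonelli_setX//; last first.
  move=> x y /=; rewrite in_itv/= => /andP[x2 _] _.
  by rewrite lee_fin mulr_ge0 ?powR_ge0//; lra.
have K0 : 0 <= M `^ (1 - r) / (2 * (r - 1)).
  by rewrite divr_ge0 ?powR_ge0//; lra.
apply: (@le_trans _ _ (\int[mu]_(t in `[(-1)%R, 1%R])
   ((M `^ (1 - r) / (2 * (r - 1)))%R%:E * ((1 + t ^+ 2)^-1)%R%:E))%E); last first.
  rewrite ge0_integralZl//.
  - rewrite integral_oneDsqr lee_fin le_eqVlt; apply/orP; left; apply/eqP.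
    by field; rewrite subr_eq0 gt_eqF.
  - apply/measurable_EFinP; apply: measurable_funTS.
    by apply: continuous_measurable_fun; exact: continuous_oneDsqrV.
  - by move=> t _; rewrite lee_fin invr_ge0 addr_ge0// sqr_ge0.
apply: ge0_le_integral => //.
- move=> t _; apply: integral_ge0 => x /=; rewrite in_itv/= => /andP[x2 _].
  by rewrite lee_fin mulr_ge0 ?powR_ge0//; lra.
- apply: measurable_funTS.
  apply: (@measurable_integral_section _
    (fun x t => (x * (x ^+ 2 * (1 + t ^+ 2) + (M - 6^-1)) `^ (- r))%R%:E)) => //.
  move=> x t /=; rewrite in_itv/= => /andP[x2 _].
  by rewrite lee_fin mulr_ge0 ?powR_ge0//; lra.
- apply/measurable_EFinP; apply: measurable_funTS; apply: measurable_funM => //.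
  by apply: continuous_measurable_fun; exact: continuous_oneDsqrV.
- by move=> t _; exact: cone_radial.
Qed.

Definition cone (x y : R) : bool := [&& 2^-1 <= x, x <= N, - x <= y & y <= x].

Definition cone_fun (x y : R) : \bar R :=
  if cone x y then (shifted_radial x y)%:E else 0%E.

Lemma measurable_shifted_radial :
  measurable_fun setT (fun z : mplane R => shifted_radial z.1 z.2).
Proof.
apply: (measurableT_comp (measurable_powR (- r))).
apply: measurable_funD => //; apply: measurable_funD; apply: measurable_funX.
  exact: measurable_fst.
exact: measurable_snd.
Qed.

Lemma measurable_cone_fun : measurable_fun setT (fun z : mplane R => cone_fun z.1 z.2).
Proof.
apply: measurable_fun_ifT => //; last first.
  by apply/measurable_EFinP; exact: measurable_shifted_radial.
have m1 : measurable_fun setT (fun z : mplane R => z.1 : R) by exact: measurable_fst.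
have m2 : measurable_fun setT (fun z : mplane R => z.2 : R) by exact: measurable_snd.
apply: measurable_and; first exact: measurable_fun_ler.
apply: measurable_and; first exact: measurable_fun_ler.
apply: measurable_and; apply: measurable_fun_ler => //.
exact: measurable_funN.
Qed.

Lemma cone_fun_ge0 x y : (0 <= cone_fun x y)%E.
Proof. by rewrite /cone_fun; case: ifPn => // _; rewrite lee_fin powR_ge0. Qed.

Lemma shifted_radialC x y : shifted_radial x y = shifted_radial y x.
Proof. by rewrite /shifted_radial [x ^+ 2 + _]addrC. Qed.

Lemma shifted_radialN x y : shifted_radial (- x) y = shifted_radial x y.
Proof. by rewrite /shifted_radial sqrrN. Qed.

Lemma cone_fun_integral :
  (\int[mu]_x \int[mu]_y cone_fun x y <= (pi / 4 * (M `^ (1 - r) / (r - 1)))%R%:E)%E.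
Proof.
apply: le_trans cone_integral; rewrite [leRHS]integral_mkcond le_eqVlt.
apply/orP; left; apply/eqP; apply: eq_integral => x _; rewrite patchE.
case: ifPn => xI.
  rewrite [RHS]integral_mkcond; apply: eq_integral => y _; rewrite patchE /cone_fun /cone.
  move: xI; rewrite inE/= in_itv/= => /andP[-> ->] /=.
  by congr (if _ then _ else _); apply/idP/idP; rewrite inE/= in_itv.
apply: integral0_eq => y _; rewrite /cone_fun ifF//; apply/negbTE; move: xI.
apply: contra => /and4P[h1 h2 _ _].
by rewrite inE/= in_itv/= h1.
Qed.

(** The four images of the cone cover 1/2 <= max(|x|, |y|) <= N. They overlap on the diagonals,
    which only enlarges an upper bound. *)
Definition cones (x y : R) : \bar R :=
  (cone_fun x y + cone_fun (- x)%R y + (cone_fun y x + cone_fun (- y)%R x))%E.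

Lemma measurable_cones : measurable_fun setT (fun z : mplane R => cones z.1 z.2).
Proof.
have h (g : mplane R -> mplane R) : measurable_fun setT g ->
    measurable_fun setT (fun z => cone_fun (g z).1 (g z).2).
  by move=> mg; exact: (measurableT_comp measurable_cone_fun).
have m1 : measurable_fun setT (fun z : mplane R => z.1 : R) by exact: measurable_fst.
have m2 : measurable_fun setT (fun z : mplane R => z.2 : R) by exact: measurable_snd.
apply: emeasurable_funD; apply: emeasurable_funD.
- exact: measurable_cone_fun.
- apply: (h (fun z => (- z.1, z.2))); apply: measurable_fun_pair => //.
  exact: measurable_funN.
- by apply: (h (fun z => (z.2, z.1))); apply: measurable_fun_pair.
- apply: (h (fun z => (- z.2, z.1))); apply: measurable_fun_pair => //.
  exact: measurable_funN.
Qed.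

Lemma leb2_integralE (f : R -> R -> \bar R) :
  measurable_fun setT (fun z : mplane R => f z.1 z.2) ->
  (forall x y, (0 <= f x y)%E) ->
  (\int[leb2 R]_z f z.1 z.2 = \int[mu]_x \int[mu]_y f x y)%E.
Proof.
move=> mf f0.
exact: (fubini_tonelli1 (m1 := mu) (m2 := mu) (fun z => f z.1 z.2) mf (fun z => f0 _ _)).
Qed.

Lemma measurable_swap (f : R -> R -> \bar R) :
  measurable_fun setT (fun z : mplane R => f z.1 z.2) ->
  measurable_fun setT (fun z : mplane R => f z.2 z.1).
Proof.
move=> mf; apply: (measurableT_comp mf (g := fun z : mplane R => (z.2, z.1))).
by apply: measurable_fun_pair; [exact: measurable_snd|exact: measurable_fst].
Qed.

Lemma leb2_integral_swap (f : R -> R -> \bar R) :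
  measurable_fun setT (fun z : mplane R => f z.1 z.2) ->
  (forall x y, (0 <= f x y)%E) ->
  (\int[leb2 R]_z f z.2 z.1 = \int[leb2 R]_z f z.1 z.2)%E.
Proof.
move=> mf f0.
have E := leb2_integralE (f := fun x y => f y x) (measurable_swap mf) (fun x y => f0 y x).
apply: (etrans E); rewrite (leb2_integralE mf f0).
exact: (tonelli_setX (f := fun x y => f y x) measurableT measurableT
  (measurable_swap mf) (fun x y _ _ => f0 y x)).
Qed.

Lemma cones_integral :
  (\int[leb2 R]_z cones z.1 z.2 <= (pi * (M `^ (1 - r) / (r - 1)))%R%:E)%E.
Proof.
set J := (\int[leb2 R]_z cone_fun z.1 z.2)%E.
have mF := measurable_cone_fun.
have mN : measurable_fun setT (fun z : mplane R => cone_fun (- z.1) z.2).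
  apply: (measurableT_comp measurable_cone_fun (g := fun z : mplane R => (- z.1, z.2))).
  apply: measurable_fun_pair => //; apply: measurable_funN; exact: measurable_fst.
have mFI : measurable_fun setT (fun x : R => \int[mu]_y cone_fun x y)%E.
  have := measurable_integral_section (I := setT) measurableT
    (measurable_swap measurable_cone_fun) (fun x y _ => cone_fun_ge0 y x).
  by [].
have JN : (\int[leb2 R]_z cone_fun (- z.1)%R z.2 = J)%E.
  have E := leb2_integralE (f := fun x y => cone_fun (- x) y) mN
    (fun x y => cone_fun_ge0 _ _).
  apply: (etrans E); rewrite /J (leb2_integralE mF cone_fun_ge0).
  by apply: (ge0_integral_opp mFI) => x; apply: integral_ge0 => *; exact: cone_fun_ge0.
have K := leb2_integral_swap mF cone_fun_ge0.
have KN := leb2_integral_swap (f := fun x y => cone_fun (- x) y) mN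
  (fun x y => cone_fun_ge0 _ _).
rewrite /cones.
have mF' := measurable_swap mF; have mN' := measurable_swap (f := fun x y => cone_fun (- x) y) mN.
have c0 := cone_fun_ge0.
have E := ge0_integralD4 (leb2 R) mF mN mF' mN' (fun=> c0 _ _) (fun=> c0 _ _)
  (fun=> c0 _ _) (fun=> c0 _ _).
rewrite [leLHS]E JN K KN JN -/J.
have J4 : (J <= (pi / 4 * (M `^ (1 - r) / (r - 1)))%R%:E)%E.
  by rewrite /J (leb2_integralE mF c0); exact: cone_fun_integral.
apply: (le_trans (leeD (leeD J4 J4) (leeD J4 J4))).
rewrite -!EFinD lee_fin le_eqVlt; apply/orP; left; apply/eqP; field.
by rewrite subr_eq0 gt_eqF.
Qed.

End cone.

End calculus.

Section lattice.
Variable R : realType.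
Notation mu := (@lebesgue_measure R).

Lemma int_norm_ge1 (k : int) : k != 0 -> 1 <= `|k%:~R : R|.
Proof. by move=> k0; rewrite -intr_norm ler1z -gtz0_ge1 normr_gt0. Qed.

(** Half-open squares, so that distinct cells are disjoint and at most one term of a sum over cells
    is nonzero at a given point. *)
Definition in_cell (k : int * int) (x y : R) : bool :=
  [&& k.1%:~R - 2^-1 <= x, x < k.1%:~R + 2^-1, k.2%:~R - 2^-1 <= y & y < k.2%:~R + 2^-1].

Lemma int_half_unique (i j : int) (x : R) :
  i%:~R - 2^-1 <= x -> x < i%:~R + 2^-1 -> j%:~R - 2^-1 <= x -> x < j%:~R + 2^-1 ->
  i = j.
Proof.
move=> h1 h2 h3 h4; apply/eqP; rewrite -subr_eq0; apply/negP => /negP ij.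
have := int_norm_ge1 ij; rewrite rmorphB/=; apply/negP; rewrite -ltNge ltr_norml.
by apply/andP; split; lra.
Qed.

Lemma in_cell_unique k l x y : in_cell k x y -> in_cell l x y -> k = l.
Proof.
case: k => k1 k2; case: l => l1 l2 /and4P[/= a1 a2 a3 a4] /and4P[/= b1 b2 b3 b4].
by congr pair; [exact: (int_half_unique a1 a2 b1 b2)|exact: (int_half_unique a3 a4 b3 b4)].
Qed.

Lemma int_half_away (i : int) (x : R) : i != 0 ->
  i%:~R - 2^-1 <= x -> x <= i%:~R + 2^-1 -> 2^-1 <= `|x|.
Proof.
move=> i0 h1 h2; have := int_norm_ge1 i0.
have := ler_normD (i%:~R - x) x; rewrite subrK.
have : `|i%:~R - x| <= 2^-1 by rewrite ler_norml; apply/andP; split; lra.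
lra.
Qed.

Section shifted.
Variables (M r : R).
Hypotheses (M0 : 0 < M) (r1 : 1 < r).

Definition cell_fun k (x y : R) : \bar R :=
  if in_cell k x y then (shifted_radial M r x y)%:E else 0%E.

Lemma cell_fun_ge0 k x y : (0 <= cell_fun k x y)%E.
Proof. by rewrite /cell_fun; case: ifPn => // _; rewrite lee_fin powR_ge0. Qed.

Lemma measurable_cell_fun k :
  measurable_fun setT (fun z : mplane R => cell_fun k z.1 z.2).
Proof.
apply: measurable_fun_ifT => //; last first.
  by apply/measurable_EFinP; exact: measurable_shifted_radial.
have m1 : measurable_fun setT (fun z : mplane R => z.1 : R) by exact: measurable_fst.
have m2 : measurable_fun setT (fun z : mplane R => z.2 : R) by exact: measurable_snd.
apply: measurable_and; first exact: measurable_fun_ler.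
apply: measurable_and; first exact: measurable_fun_ltr.
by apply: measurable_and; [exact: measurable_fun_ler|exact: measurable_fun_ltr].
Qed.

(** Jensen's inequality once in each variable; each application restores 1/12 of the 1/6 subtracted
    in [shifted_radial]. *)
Lemma cell_fun_integral k : k != 0 ->
  (((k.1%:~R ^+ 2 + k.2%:~R ^+ 2 + M) `^ (- r))%R%:E
   <= \int[leb2 R]_z cell_fun k z.1 z.2)%E.
Proof.
have M0' := M0; have r1' := r1; have r0 : 0 < r by lra.
case: k => k1 k2 k0 /=; set i : R := k1%:~R; set j : R := k2%:~R.
rewrite (leb2_integralE (measurable_cell_fun (k1, k2)) (cell_fun_ge0 (k1, k2))).
(* A square around a nonzero lattice point has one coordinate of modulus at least 1/2 throughout, so
   the base stays positive since 1/4 > 1/6. *)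
have away x y : i - 2^-1 <= x <= i + 2^-1 -> j - 2^-1 <= y <= j + 2^-1 ->
    4^-1 <= x ^+ 2 + y ^+ 2.
  move=> /andP[x1 x2] /andP[y1 y2].
  have x0 : 0 <= x ^+ 2 by exact: sqr_ge0.
  have y0 : 0 <= y ^+ 2 by exact: sqr_ge0.
  have big (u : R) : 2^-1 <= `|u| -> 4^-1 <= u ^+ 2.
    by move=> h; rewrite -real_normK ?num_real//; nra.
  have [k1E|k1N] := eqVneq k1 0; last first.
    have := big x (int_half_away k1N x1 x2); lra.
  have k2N : k2 != 0 by apply: contra k0 => /eqP ->; rewrite k1E.
  have := big y (int_half_away k2N y1 y2); lra.
have mid (u : R) : u - 2^-1 <= u <= u + 2^-1 by apply/andP; split; lra.
have mS : measurable_fun setT (fun z : mplane R => (shifted_radial M r z.1 z.2)%:E).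
  by apply/measurable_EFinP; exact: measurable_shifted_radial.
have mSy x : measurable_fun setT (fun y => (shifted_radial M r x y)%:E).
  exact: (measurableT_comp mS (measurable_pair1 x)).
have mI : measurable_fun setT (fun x => \int[mu]_(y in `[(j - 2^-1)%R, (j + 2^-1)%R])
     (shifted_radial M r x y)%:E)%E.
  apply: (measurable_integral_section (I := `[(j - 2^-1)%R, (j + 2^-1)%R])
    (f := fun y x => (shifted_radial M r x y)%:E)).
  - exact: measurable_itv.
  - exact: (measurable_swap (f := fun x y => (shifted_radial M r x y)%:E) mS).
  - by move=> *; rewrite lee_fin powR_ge0.
apply: (@le_trans _ _ (\int[mu]_(x in `[(i - 2^-1)%R, (i + 2^-1)%R])
   \int[mu]_(y in `[(j - 2^-1)%R, (j + 2^-1)%R]) (shifted_radial M r x y)%:E)%E); last first.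
  rewrite -integral_itv_bndo_bndc; last exact: measurable_funTS.
  rewrite [leLHS]integral_mkcond le_eqVlt; apply/orP; left; apply/eqP.
  apply: eq_integral => x _; rewrite patchE; case: ifPn => xI.
    rewrite -integral_itv_bndo_bndc; last exact: measurable_funTS.
    rewrite [LHS]integral_mkcond; apply: eq_integral => y _.
    rewrite patchE /cell_fun /in_cell/=.
    move: xI; rewrite inE/= in_itv/= => /andP[-> ->] /=.
    by congr (if _ then _ else _); apply/idP/idP; rewrite inE/= in_itv.
  apply/esym/integral0_eq => y _; rewrite /cell_fun ifF//; apply/negbTE; move: xI.
  by apply: contra => /and4P[h1 h2 _ _]; rewrite inE/= in_itv/= h1.
(* C + x^2 is the base after y has been averaged out at fixed x. *)
pose C := j ^+ 2 + 12^-1 + (M - 6^-1).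
have Cpos x : i - 2^-1 <= x <= i + 2^-1 -> 0 < C + x ^+ 2.
  by move=> hx; have := away x j hx (mid j); rewrite /C; lra.
apply: (@le_trans _ _ (\int[mu]_(x in `[(i - 2^-1)%R, (i + 2^-1)%R])
   ((C + x ^+ 2) `^ (- r))%R%:E)%E).
  have -> : i ^+ 2 + j ^+ 2 + M = C + i ^+ 2 + 12^-1 by rewrite /C; field.
  apply: jensen_unit_interval => //.
  by have := Cpos i (mid i); rewrite /C; lra.
apply: ge0_le_integral => //.
- by move=> x _; rewrite lee_fin powR_ge0.
- apply/measurable_EFinP; apply: measurable_funTS.
  apply: (measurableT_comp (measurable_powR (- r))).
  by apply: measurable_funD => //; exact: measurable_funX.
- exact: measurable_funTS.
- move=> x /=; rewrite in_itv/= => hx.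
  have := @jensen_unit_interval R (x ^+ 2 + (M - 6^-1)) r j r0.
  have -> : x ^+ 2 + (M - 6^-1) + j ^+ 2 + 12^-1 = C + x ^+ 2 by rewrite /C; ring.
  under eq_integral do rewrite addrAC.
  apply; last exact: Cpos.
  by move=> y hy; have := away x y hx hy; lra.
Qed.

(** At most one cell contains (x, y). As its centre is not 0, the larger of |x| and |y| is at least
    1/2, and the point lies in the cone around that coordinate axis. *)
Lemma sum_cell_fun_le (N : R) (K : seq (int * int)) (x y : R) :
  uniq K -> (0 : int * int) \notin K ->
  (forall k, k \in K -> (`|k.1%:~R| + 1 <= N) && (`|k.2%:~R| + 1 <= N)) ->
  (\sum_(k <- K) cell_fun k x y <= cones M r N x y)%E.
Proof.
move=> uK K0 KN.
have c0 := @cone_fun_ge0 R M r N.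
have cones0 : (0 <= cones M r N x y)%E by rewrite /cones !adde_ge0.
have [/hasP[k kK kxy]|/hasPn no] := boolP (has (fun k => in_cell k x y) K); last first.
  by rewrite big_seq big1// => k /no; rewrite /cell_fun => /negbTE ->.
rewrite (bigD1_seq k)//= big1 ?adde0; last first.
  move=> l lk; rewrite /cell_fun ifF//; apply/negP => lxy.
  by move: lk; rewrite (in_cell_unique lxy kxy) eqxx.
rewrite /cell_fun kxy.
have kneq0 : k != 0 by apply: contra K0 => /eqP <-.
have /andP[kN1 kN2] := KN k kK.
move: kxy => /and4P[x1 x2 y1 y2].
have N1 : `|x| <= N.
  have := ler_normD (x - k.1%:~R) k.1%:~R; rewrite subrK.
  have : `|x - k.1%:~R| <= 2^-1 by rewrite ler_norml; apply/andP; split; lra.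
  lra.
have N2 : `|y| <= N.
  have := ler_normD (y - k.2%:~R) k.2%:~R; rewrite subrK.
  have : `|y - k.2%:~R| <= 2^-1 by rewrite ler_norml; apply/andP; split; lra.
  lra.
have far : (2^-1 <= `|x|) || (2^-1 <= `|y|).
  case: k x1 x2 y1 y2 kneq0 {kK kN1 kN2} => k1 k2 /= x1 x2 y1 y2 kneq0.
  have [k1E|k1N] := eqVneq k1 0; last first.
    by apply/orP; left; apply: (int_half_away k1N) => //; exact: ltW.
  have k2N : k2 != 0 by apply: contra kneq0 => /eqP ->; rewrite k1E.
  by apply/orP; right; apply: (int_half_away k2N) => //; exact: ltW.
have coneE (u v : R) : 2^-1 <= `|u| -> `|u| <= N -> `|v| <= `|u| ->
    ((shifted_radial M r u v)%:E <= cone_fun M r N u v + cone_fun M r N (- u)%R v)%E.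
  move=> u2 uN vu; have [u0|u0] := leP 0 u.
    rewrite (@le_trans _ _ (cone_fun M r N u v))//; last by rewrite leeDl.
    move: u2 uN vu; rewrite ger0_norm// ler_norml => u2 uN /andP[v1 v2].
    by rewrite /cone_fun /cone u2 uN v1 v2.
  rewrite (@le_trans _ _ (cone_fun M r N (- u) v))//; last by rewrite leeDr.
  move: u2 uN vu; rewrite ltr0_norm// ler_norml => u2 uN /andP[v1 v2].
  by rewrite /cone_fun /cone u2 uN v1 v2 shifted_radialN.
have [xy|xy] := leP `|y| `|x|.
  have x2' : 2^-1 <= `|x| by case/orP: far => // h; lra.
  by rewrite (le_trans (coneE x y x2' N1 xy))// leeDl// adde_ge0.
have y2' : 2^-1 <= `|y| by case/orP: far => // h; lra.
by rewrite shifted_radialC (le_trans (coneE y x y2' N2 (ltW xy)))// leeDr// adde_ge0.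
Qed.

Lemma lattice_sum_le (K : seq (int * int)) : uniq K -> (0 : int * int) \notin K ->
  \sum_(k <- K) (k.1%:~R ^+ 2 + k.2%:~R ^+ 2 + M) `^ (- r)
  <= pi * (M `^ (1 - r) / (r - 1)).
Proof.
move=> uK K0.
(* A crude radius for the truncated cones; the final bound does not depend on it. *)
pose N : R := 1 + \sum_(k <- K) (`|k.1%:~R| + `|k.2%:~R|).
have N1 : 1 <= N by rewrite lerDl sumr_ge0// => *; rewrite addr_ge0.
have KN k : k \in K -> (`|k.1%:~R| + 1 <= N) && (`|k.2%:~R| + 1 <= N).
  move=> kK; have : `|k.1%:~R| + `|k.2%:~R| <= \sum_(k <- K) (`|k.1%:~R : R| + `|k.2%:~R : R|).
    by rewrite (bigD1_seq k)//= lerDl sumr_ge0// => *; rewrite addr_ge0.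
  have := normr_ge0 (k.1%:~R : R); have := normr_ge0 (k.2%:~R : R).
  by rewrite /N => *; apply/andP; split; lra.
rewrite -lee_fin -sumEFin.
apply: (@le_trans _ _ (\sum_(k <- K) \int[leb2 R]_z cell_fun k z.1 z.2)%E).
  rewrite big_seq [leRHS]big_seq; apply: lee_sum => k kK.
  by apply: cell_fun_integral; apply: contra K0 => /eqP <-.
rewrite -ge0_integral_sum//.
- apply: le_trans (cones_integral M0 r1 N1); apply: ge0_le_integral => //.
  + by move=> z _; apply: sume_ge0 => k _; exact: cell_fun_ge0.
  + by apply: emeasurable_sum => k; exact: measurable_cell_fun.
  + exact: measurable_cones.
  + by move=> z _; exact: sum_cell_fun_le.
- by move=> k; exact: measurable_cell_fun.
- by move=> k z _; exact: cell_fun_ge0.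
Qed.

End shifted.
End lattice.

(** * Closedness of L^q bounds under L^2 approximation *)

Section closure.
Context d (T : measurableType d) (R : realType).
Variables (mu : {measure set T -> \bar R}) (D : set T).
Hypothesis mD : measurable D.

Lemma sum_half_le2 n : \sum_(0 <= i < n) (2^-1 : R) ^+ i <= 2.
Proof.
suff -> : \sum_(0 <= i < n) (2^-1 : R) ^+ i = 2 - 2 * 2^-1 ^+ n.
  by rewrite lerBlDr lerDl mulr_ge0// exprn_ge0// invr_ge0.
elim: n => [|n ih]; first by rewrite big_nil expr0; ring.
by rewrite big_nat_recr//= ih exprS; field.
Qed.

(** The integrals of the squared differences are summable, so the series of squared differences is
    finite almost everywhere and its terms tend to 0. *)
Lemma fast_L2_ae_cvg (F : T -> R) (G : (T -> R)^nat) :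
  measurable_fun D F -> (forall n, measurable_fun D (G n)) ->
  (forall n, (\int[mu]_(x in D) ((F x - G n x) ^+ 2)%:E <= (2^-1 ^+ n)%:E)%E) ->
  {ae mu, forall x, D x -> G n x @[n --> \oo] --> F x}.
Proof.
move=> mF mG FG.
have mFG n : measurable_fun D (fun x => ((F x - G n x) ^+ 2)%:E).
  by apply/measurable_EFinP; apply: measurable_funX; exact: measurable_funB.
pose S x := (\sum_(n <oo) ((F x - G n x) ^+ 2)%:E)%E.
have S0 x : (0 <= S x)%E.
  by apply: nneseries_ge0 => *; rewrite lee_fin sqr_ge0.
have mS : measurable_fun D S.
  by apply: ge0_emeasurable_sum => // n x Dx _; rewrite lee_fin sqr_ge0.
have iS : mu.-integrable D S.
  apply/integrableP; split => //.
  under eq_integral do rewrite gee0_abs//.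
  rewrite /S integral_nneseries//; last by move=> *; rewrite lee_fin sqr_ge0.
  apply: (@le_lt_trans _ _ 2%:E); last by rewrite ltry.
  apply: lime_le.
    by apply: is_cvg_nneseries => n _ _; apply: integral_ge0 => *; rewrite lee_fin sqr_ge0.
  apply: nearW => n; apply: (@le_trans _ _ (\sum_(0 <= i < n) ((2^-1 : R) ^+ i)%:E)%E).
    by apply: lee_sum => i _; exact: FG.
  by rewrite sumEFin lee_fin sum_half_le2.
have := integrable_ae mD iS.
apply: filterS => x hx Dx; have Sfin := hx Dx.
have : cvgn (series (fun n => (F x - G n x) ^+ 2)).
  apply: nnseries_is_cvg => [i|]; first exact: sqr_ge0.
  by rewrite ltey_eq Sfin.
move=> /cvg_series_cvg_0 h.
apply/cvgrPdist_le => eps eps0.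
have e2 : 0 < eps ^+ 2 by rewrite exprn_gt0.
move/cvgrPdist_le : h => /(_ _ e2); apply: filterS => n.
rewrite sub0r normrN ger0_norm ?sqr_ge0// -(real_normK (num_real (F x - G n x))).
by rewrite ler_sqr ?nnegrE// ltW.
Qed.

Lemma cvg_powR_gt1 (q x : R) (u : R^nat) : 1 < q -> 0 <= x -> (forall n, 0 <= u n) ->
  u @ \oo --> x -> u n `^ q @[n --> \oo] --> x `^ q.
Proof.
move=> q1 x0 u0 ux; apply/cvgrPdist_le => eps eps0.
pose c := q * (x + 1) `^ (q - 1).
have c0 : 0 < c by rewrite mulr_gt0 ?powR_gt0//; lra.
near=> n.
have h1 : `|x - u n| <= 1 by near: n; move/cvgrPdist_le : ux; exact.
have h2 : `|x - u n| <= eps / c.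
  by near: n; move/cvgrPdist_le : ux; apply; rewrite divr_gt0.
apply: le_trans (@powR_lipschitz R q (x + 1) _ _ q1 _ _) _.
- by rewrite x0 lerDl/= ler01.
- rewrite u0; move: h1; rewrite ler_norml => /andP[]; lra.
- by rewrite -/c mulrC -ler_pdivlMr.
Unshelve. all: by end_near. Qed.

(* Fatou's lemma along an almost everywhere convergent subsequence. *)
Lemma Lq_bound_closed (q C : R) (F : T -> R) : 1 < q ->
  measurable_fun D F -> (forall x, 0 <= F x) ->
  (forall eps, 0 < eps -> exists G : T -> R,
     [/\ measurable_fun D G, forall x, 0 <= G x,
      (\int[mu]_(x in D) ((F x - G x) ^+ 2)%:E <= eps%:E)%E &
      (\int[mu]_(x in D) (G x `^ q)%R%:E <= (C + eps)%R%:E)%E]) ->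
  (\int[mu]_(x in D) (F x `^ q)%R%:E <= C%:E)%E.
Proof.
move=> q1 mF F0 H.
have half0 n : 0 < (2^-1 : R) ^+ n by rewrite exprn_gt0// invr_gt0.
have /choice[G hG] n := H _ (half0 n).
have mGq n : measurable_fun D (fun x => (G n x `^ q)%:E).
  apply/measurable_EFinP; have [mG _ _ _] := hG n.
  exact: (measurableT_comp (measurable_powR q) mG).
have ae : {ae mu, forall x, D x -> G n x @[n --> \oo] --> F x}.
  by apply: fast_L2_ae_cvg => // n; case: (hG n).
have ge0 n x : D x -> (0 <= (G n x `^ q)%:E)%E by rewrite lee_fin powR_ge0.
apply: (@le_trans _ _ (\int[mu]_(x in D) limn_einf (fun n => (G n x `^ q)%:E))%E).
  apply: ae_ge0_le_integral => //.
  - by move=> x _; rewrite lee_fin powR_ge0.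
  - apply/measurable_EFinP; exact: (measurableT_comp (measurable_powR q) mF).
  - move=> x Dx; rewrite limn_einf_lim; apply: lime_ge; first exact: is_cvg_einfs.
    by apply: nearW => n; apply: le_ereal_inf_tmp => _ [k _ <-]; rewrite lee_fin powR_ge0.
  - rewrite /limn_einf; apply: measurableT_comp => //.
    apply: (measurable_fun_limn_esup (f := fun n x => (- (G n x `^ q)%:E)%E)) => n.
    by apply: measurableT_comp => //; exact: mGq.
  - move: ae; apply: filterS => x hx Dx.
    have h := @cvg_powR_gt1 q (F x) (fun n => G n x) q1 (F0 x) _ (hx Dx).
    have [-> _] : (limn_einf (fun n => (G n x `^ q)%:E) = (F x `^ q)%:E)%E *
      (limn_esup (fun n => (G n x `^ q)%:E) = (F x `^ q)%:E)%E.
      apply: cvg_limn_einf_sup; apply: cvg_EFin; first exact: nearW.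
      by apply: h => n; case: (hG n).
    by [].
have fat := @fatou _ _ _ mu D mD (fun n x => (G n x `^ q)%:E) mGq ge0.
apply: (le_trans fat).
rewrite limn_einf_lim.
have lim : ((C + 2^-1 ^+ n)%R%:E @[n --> \oo] --> C%:E)%E.
  apply: cvg_EFin; first exact: nearW.
  rewrite -[X in _ --> X]addr0; apply: cvgD; first exact: cvg_cst.
  by apply: cvg_expr; rewrite ger0_norm ?invr_ge0// invf_lt1// ltr1n.
rewrite -(cvg_lim _ lim)//; apply: lee_lim.
- exact: is_cvg_einfs.
- by apply/cvg_ex; exists C%:E.
- apply: nearW => n; apply: (@le_trans _ _ (\int[mu]_(x in D) (G n x `^ q)%:E)%E).
    by apply: ereal_inf_lbound; exists n => //=.
  by case: (hG n).
Qed.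

End closure.

(** * The weighted Hoelder bound and the optimal weight *)

Section weights.
Variables (R : realType) (n : nat) (q : R) (a : 'I_n -> R[i]) (kap : 'I_n -> int * int).
Hypotheses (q2 : 2 < q) (kapI : injective kap) (kap0 : forall k, kap k != 0).

Let nrm2 k : R := (kap k).1%:~R ^+ 2 + (kap k).2%:~R ^+ 2.

Lemma lattice_norm2_ge1 k : 1 <= nrm2 k.
Proof.
rewrite /nrm2; have sq (i : int) : i != 0 -> 1 <= (i%:~R : R) ^+ 2.
  move=> i0; rewrite -(real_normK (num_real i%:~R)).
  have := @int_norm_ge1 R i i0; nra.
have [k1|k1] := eqVneq (kap k).1 0; last first.
  by rewrite (le_trans (sq _ k1))// lerDl sqr_ge0.
have k2 : (kap k).2 != 0.
  apply: contra (kap0 k) => /eqP k2; apply/eqP; move: k1 k2.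
  by case: (kap k) => i j /= -> ->.
by rewrite (le_trans (sq _ k2))// lerDr sqr_ge0.
Qed.

(** The last factor is the lattice bound pi M^(1-r) / (r - 1) raised to the power (q - 2) / 2. As r
    - 1 = 2 / (q - 2), exactly M^-1 is left. *)
Lemma powsum_weighted (M : R) : 0 < M ->
  powsum (q / (q - 1)) a `^ (q - 1) <=
  (\sum_k (nrm2 k + M) * cmod (a k) ^+ 2) `^ (q / 2) *
  (pi `^ ((q - 2) / 2) * M^-1 * ((q - 2) / 2) `^ ((q - 2) / 2)).
Proof.
have q2' := q2; move=> M0.
have q0 : 0 < q by lra.
have q10 : 0 < q - 1 by lra.
have q20 : 0 < q - 2 by lra.
have q0n : q != 0 by rewrite gt_eqF.
have q1n : q - 1 != 0 by rewrite gt_eqF.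
have q2n : q - 2 != 0 by rewrite gt_eqF.
set p := q / (q - 1); set r := q / (q - 2).
have r1 : 1 < r by rewrite /r ltr_pdivlMr// mul1r; lra.
pose w k := nrm2 k + M.
have w0 k : 0 < w k by rewrite /w; have := lattice_norm2_ge1 k; lra.
have p0 : 0 < p by rewrite /p divr_gt0.
have P0 : 0 < 2 / p by rewrite divr_gt0.
have Q0 : 0 < 2 * (q - 1) / (q - 2) by rewrite divr_gt0// mulr_gt0.
have h := @hoelder_sum R 'I_n (index_enum _)
  (fun k => (w k * cmod (a k) ^+ 2) `^ (p / 2)) (fun k => w k `^ (- (p / 2)))
  (2 / p) (2 * (q - 1) / (q - 2)) P0 Q0.
have PQ : (2 / p)^-1 + (2 * (q - 1) / (q - 2))^-1 = 1.
  by rewrite /p; field; rewrite q0n q1n q2n.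
move: h => /(_ PQ (fun k => powR_ge0 _ _) (fun k => powR_ge0 _ _)).
rewrite [X in X <= _](_ : _ = powsum p a); last first.
  apply: eq_bigr => k _; rewrite powRM ?sqr_ge0 ?(ltW (w0 k))//.
  rewrite mulrAC -powRD; last by rewrite (gt_eqF (w0 k)) implybT.
  rewrite subrr powRr0 mul1r -(@powR_mulrn _ _ 2) ?cmod_ge0// -powRrM.
  by congr (_ `^ _); field.
rewrite [X in _ <= X `^ _ * _](_ : _ = \sum_k w k * cmod (a k) ^+ 2); last first.
  apply: eq_bigr => k _; rewrite -powRrM.
  have -> : p / 2 * (2 / p) = 1 by rewrite /p; field; rewrite ?q0n ?q1n.
  by rewrite powRr1// mulr_ge0 ?sqr_ge0// ltW.
rewrite [X in _ <= _ * X `^ _](_ : _ = \sum_k w k `^ (- r)); last first.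
  apply: eq_bigr => k _; rewrite -powRrM; congr (_ `^ _).
  by rewrite /p /r; field; rewrite ?q0n ?q1n ?q2n.
set W := \sum_k w k * _; set V := \sum_k w k `^ _ => h.
have W0 : 0 <= W by apply: sumr_ge0 => k _; rewrite mulr_ge0 ?sqr_ge0// ltW.
have V0 : 0 <= V by apply: sumr_ge0 => k _; exact: powR_ge0.
have VM : V <= pi * (M `^ (1 - r) / (r - 1)).
  have := @lattice_sum_le R M r M0 r1 [seq kap k | k <- index_enum 'I_n].
  rewrite big_map; apply.
    by rewrite map_inj_uniq// index_enum_uniq.
  by apply/mapP => -[k _ /esym/eqP]; apply/negP.
have pS : 0 <= powsum p a by exact: powsum_ge0.
have := @ge0_ler_powR R (q - 1) (ltW q10) _ _ _ _ h.
rewrite !nnegrE mulr_ge0 ?powR_ge0// => /(_ pS isT)/le_trans; apply.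
rewrite powRM ?powR_ge0// -!powRrM.
have -> : (2 / p)^-1 * (q - 1) = q / 2 by rewrite /p; field; rewrite ?q0n ?q1n.
have -> : (2 * (q - 1) / (q - 2))^-1 * (q - 1) = (q - 2) / 2 by field; rewrite ?q1n ?q2n.
rewrite ler_wpM2l ?powR_ge0//.
have e0 : 0 <= (q - 2) / 2 by rewrite divr_ge0// ltW.
have r10 : 0 <= r - 1 by lra.
have := @ge0_ler_powR R ((q - 2) / 2) e0 _ _ _ _ VM.
rewrite !nnegrE V0 mulr_ge0 ?pi_ge0 ?divr_ge0 ?powR_ge0// => /(_ isT isT)/le_trans; apply.
rewrite powRM ?pi_ge0 ?divr_ge0 ?powR_ge0// powRM ?powR_ge0 ?invr_ge0// -powRrM.
have -> : (1 - r) * ((q - 2) / 2) = - 1 by rewrite /r; field.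
have -> : (r - 1)^-1 = (q - 2) / 2.
  have -> : r - 1 = 2 / (q - 2) by rewrite /r; field.
  by rewrite invf_div.
by rewrite powR_inv1 ?(ltW M0)// mulrA.
Qed.

Lemma powsum_lattice_bound :
  powsum (q / (q - 1)) a `^ (q - 1) <=
  pi `^ ((q - 2) / 2) * (q / 2) `^ (q / 2) * (\sum_k cmod (a k) ^+ 2) *
  (\sum_k nrm2 k * cmod (a k) ^+ 2) `^ ((q - 2) / 2).
Proof.
have q2' := q2.
have q0 : 0 < q by lra.
have q10 : 0 < q - 1 by lra.
have q20 : 0 < q - 2 by lra.
set A := \sum_k cmod (a k) ^+ 2; set B := \sum_k nrm2 k * _.
have A0 : 0 <= A by apply: sumr_ge0 => k _; exact: sqr_ge0.
have AB : A <= B.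
  by apply: ler_sum => k _; rewrite ler_peMl ?sqr_ge0// lattice_norm2_ge1.
move: (A0); rewrite le_eqVlt => /predU1P[/esym A0E|Ap].
  rewrite A0E mulr0 mul0r /powsum big1 ?powR0 ?gt_eqF// => k _.
  move/eqP: A0E; rewrite psumr_eq0 => [/allP/(_ k (mem_index_enum _))|]; last first.
    by move=> *; exact: sqr_ge0.
  rewrite /= sqrf_eq0 => /eqP ->; rewrite powR0// gt_eqF// divr_gt0//.
have Bp : 0 < B by exact: lt_le_trans AB.
(* The minimizer of (B + M A)^(q/2) / M, for which B + M A = q B / (q - 2). It is positive because
   |k| >= 1 gives B >= A > 0. *)
pose M := 2 * B / ((q - 2) * A).
have M0 : 0 < M by rewrite /M divr_gt0// mulr_gt0.
apply: le_trans (powsum_weighted M0) _.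
have -> : \sum_k (nrm2 k + M) * cmod (a k) ^+ 2 = (q / (q - 2)) * B.
  under eq_bigr do rewrite mulrDl.
  rewrite big_split/= -mulr_sumr -/A -/B /M; field.
  by rewrite !gt_eqF.
have qq : 0 <= q / (q - 2) by rewrite divr_ge0// ltW.
rewrite powRM// ?(ltW Bp)//.
have -> : B `^ (q / 2) = B * B `^ ((q - 2) / 2).
  have -> : (q - 2) / 2 = q / 2 - 1 by field.
  by rewrite mulr_powRB1 ?(ltW Bp)// divr_gt0.
have -> : (q / 2) `^ (q / 2) = (q / (q - 2)) `^ (q / 2) * ((q - 2) / 2) `^ (q / 2).
  rewrite -powRM//; last by rewrite divr_ge0// ltW.
  by congr (_ `^ _); field; rewrite gt_eqF.
have -> : ((q - 2) / 2) `^ (q / 2) = (q - 2) / 2 * ((q - 2) / 2) `^ ((q - 2) / 2).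
  have {4}-> : (q - 2) / 2 = q / 2 - 1 by field.
  by rewrite mulr_powRB1 ?divr_ge0 ?divr_gt0// ltW.
rewrite le_eqVlt; apply/orP; left; apply/eqP.
rewrite /M; field.
by rewrite !gt_eqF.
Qed.

End weights.

(** * Density of the trigonometric polynomials *)

Section cis.
Variable R : realType.

Definition cis (t : R) : R[i] := Complex (cos t) (sin t).

Lemma cisD s t : cis (s + t) = cis s * cis t.
Proof. by rewrite /cis cosD sinD; simpc; congr Complex; ring. Qed.

Lemma cis_conj t : conjc (cis t) = cis (- t).
Proof. by rewrite /cis cosN sinN. Qed.

Lemma cmod_cis t : cmod (cis t) = 1.
Proof. by rewrite cmodE /= cos2Dsin2 sqrtr1. Qed.

Lemma cis0 : cis 0 = 1.
Proof. by rewrite /cis cos0 sin0. Qed.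

Lemma sinDz2pi (n : int) (x : R) : sin (x + n%:~R * (2 * pi)) = sin x.
Proof.
have E m : sin (x + m%:R * (2 * pi)) = sin x.
  rewrite -[RHS](periodicn (@sinD2pi R) m); congr sin; ring.
case: n => n; first exact: E.
rewrite NegzE mulrNz mulNr.
rewrite -[LHS](periodicn (@sinD2pi R) n.+1); congr sin.
by rewrite -[n.+1%:~R]/(n.+1%:R); ring.
Qed.

Lemma cosDz2pi (n : int) (x : R) : cos (x + n%:~R * (2 * pi)) = cos x.
Proof.
have E (y : R) : cos y = sin (y + pi / 2) by rewrite sinDpihalf.
by rewrite !E addrAC sinDz2pi.
Qed.

End cis.

Section fubini_rect.
Variable R : realType.
Notation mu := (@lebesgue_measure R).

Lemma leb2_fubini (I J : set R) (F : R -> R -> R) : measurable I -> measurable J ->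
  (leb2 R).-integrable (I `*` J) (fun z => (F z.1 z.2)%:E) ->
  (forall x, I x -> mu.-integrable J (EFin \o F x)) ->
  \int[leb2 R]_(z in I `*` J) F z.1 z.2 = \int[mu]_(x in I) \int[mu]_(y in J) F x y.
Proof.
move=> mI mJ iF iFx; rewrite /Rintegral.
have mIJ : measurable (I `*` J : set (mplane R)) by exact: measurableX.
have i2 := (integrable_mkcond (fun z : mplane R => (F z.1 z.2)%:E) mIJ).1 iF.
have E := integral12_prod_meas1 i2; rewrite -integral_mkcond in E.
rewrite -[X in fine X]E; congr fine; rewrite [RHS]integral_mkcond; apply: eq_integral => x _.
rewrite /fubini_F patchE; case: ifPn => xI.
  rewrite fineK; last by apply: integrable_fin_num => //; apply: iFx; exact: set_mem.
  rewrite [RHS]integral_mkcond; apply: eq_integral => y _; rewrite !patchE.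
  by congr (if _ then _ else _); apply/idP/idP; rewrite !inE/=; [case|split => //; exact: set_mem].
apply: integral0_eq => y _; rewrite patchE ifF//; apply/negbTE/negP.
by rewrite inE/= => -[xI' _]; move/negP: xI; apply; rewrite inE.
Qed.

Lemma leb2_fubini_swap (I J : set R) (F : R -> R -> R) : measurable I -> measurable J ->
  (leb2 R).-integrable (I `*` J) (fun z => (F z.1 z.2)%:E) ->
  (forall y, J y -> mu.-integrable I (EFin \o F ^~ y)) ->
  \int[leb2 R]_(z in I `*` J) F z.1 z.2 = \int[mu]_(y in J) \int[mu]_(x in I) F x y.
Proof.
move=> mI mJ iF iFx; rewrite /Rintegral.
have mIJ : measurable (I `*` J : set (mplane R)) by exact: measurableX.
have i2 := (integrable_mkcond (fun z : mplane R => (F z.1 z.2)%:E) mIJ).1 iF.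
have E := integral21_prod_meas1 i2; rewrite -integral_mkcond in E.
rewrite -[X in fine X]E; congr fine; rewrite [RHS]integral_mkcond; apply: eq_integral => y _.
rewrite /fubini_G patchE; case: ifPn => yJ.
  rewrite fineK; last by apply: integrable_fin_num => //; apply: iFx; exact: set_mem.
  rewrite [RHS]integral_mkcond; apply: eq_integral => x _; rewrite !patchE.
  by congr (if _ then _ else _); apply/idP/idP; rewrite !inE/=; [case|split => //; exact: set_mem].
apply: integral0_eq => x _; rewrite patchE ifF//; apply/negbTE/negP.
by rewrite inE/= => -[_ yJ']; move/negP: yJ; apply; rewrite inE.
Qed.

End fubini_rect.

Section cell.
Variables (R : realType) (c L : R).
Hypothesis L0 : 0 < L.
Notation mu := (@lebesgue_measure R).

Definition cellI : set R := `[c, c + L].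
Definition cell : set (mplane R) := cellI `*` cellI.

Lemma measurable_cell : measurable cell.
Proof. by apply: measurableX; exact: measurable_itv. Qed.

Lemma mu_cellI : mu cellI = L%:E.
Proof. rewrite lebesgue_measure_itv/= lte_fin ltrDl L0 -EFinB; congr EFin; ring. Qed.

Lemma leb2_cell : leb2 R cell = (L ^+ 2)%:E.
Proof.
have h := @product_measure1E _ _ _ _ R mu mu cellI cellI (measurable_itv _) (measurable_itv _).
by rewrite [LHS]h [X in (X * _)%E]mu_cellI [X in (_ * X)%E]mu_cellI -EFinM -expr2.
Qed.

Lemma leb2_cell_fin : (0 < leb2 R cell < +oo)%E.
Proof. by rewrite leb2_cell lte_fin exprn_gt0// ltry. Qed.

Definition omega : R := 2 * pi / L.

Lemma omega_neq0 : omega != 0.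
Proof. by rewrite /omega mulf_neq0 ?invr_neq0 ?mulf_neq0 ?gt_eqF// pi_gt0. Qed.

Definition ek (k : int * int) (z : mplane R) : R[i] :=
  cis (omega * (k.1%:~R * z.1 + k.2%:~R * z.2)).

Lemma cmod_ek k z : cmod (ek k z) = 1.
Proof. exact: cmod_cis. Qed.

Lemma ekD k l z : ek (k + l) z = ek k z * ek l z.
Proof. by rewrite /ek -cisD /= !rmorphD/=; congr cis; ring. Qed.

Lemma ek_conj k z : conjc (ek k z) = ek (- k) z.
Proof. by rewrite /ek cis_conj /= !rmorphN/=; congr cis; ring. Qed.

Lemma ek0 z : ek 0 z = 1.
Proof. by rewrite /ek /= !mul0r addr0 mulr0 cis0. Qed.

Lemma measurable_phase k : measurable_fun setT
  (fun z : mplane R => omega * (k.1%:~R * z.1 + k.2%:~R * z.2)).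
Proof.
by apply: measurable_funM => //; apply: measurable_funD; apply: measurable_funM.
Qed.

Lemma cbmeas_ek k : cbmeas (ek k).
Proof.
have h (f : R -> R) : continuous f -> (forall x, `|f x| <= 1) ->
    bmeas (fun z : mplane R => f (omega * (k.1%:~R * z.1 + k.2%:~R * z.2))).
  move=> cf f1; split; last by exists 1 => z.
  apply: (measurableT_comp _ (measurable_phase k)); exact: continuous_measurable_fun.
split; apply: h.
- exact: continuous_cos.
- exact: cos_max.
- exact: continuous_sin.
- exact: sin_max.
Qed.

Lemma integral_cos_period (n : int) (t : R) : n != 0 ->
  \int[mu]_(y in cellI) cos (t + omega * (n%:~R * y)) = 0.
Proof.
move=> n0; have w0 : omega * n%:~R != 0 by rewrite mulf_neq0 ?omega_neq0// intr_eq0.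
have cL : c < c + L by rewrite ltrDl.
have d0 (y : R) : is_derive y (1 : R) (fun y => t + omega * (n%:~R * y)) (omega * n%:~R).
  by apply: is_derive_eq; rewrite /GRing.scale/=; ring.
have dS (y : R) : is_derive y (1 : R) (fun y => sin (t + omega * (n%:~R * y)) / (omega * n%:~R))
    (cos (t + omega * (n%:~R * y))).
  have d1 := @is_derive1_comp R sin (fun y => t + omega * (n%:~R * y)) y _ _
    (is_derive_sin _) (d0 y).
  apply: is_derive_eq; rewrite /GRing.scale/=; field.
  by rewrite omega_neq0 intr_eq0 n0.
have cC (y : R) : {for y, continuous (fun y : R => cos (t + omega * (n%:~R * y)))}.
  have d1 := @is_derive1_comp R cos (fun y => t + omega * (n%:~R * y)) y _ _
    (is_derive_cos _) (d0 y).
  exact: (is_derive_continuous d1).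
rewrite /Rintegral (integral_derive_itv cL (fun y _ => dS y) (fun y _ => cC y)) /=.
have -> : t + omega * (n%:~R * (c + L)) = t + omega * (n%:~R * c) + n%:~R * (2 * pi).
  by rewrite /omega; field; rewrite gt_eqF.
by rewrite sinDz2pi subrr.
Qed.

Lemma integrable_itv_bmeas (f : R -> R) : bmeas (f : measurableTypeR R -> R) ->
  mu.-integrable cellI (EFin \o f).
Proof.
move=> [mf [M hM]]; apply: measurable_bounded_integrable.
- exact: measurable_itv.
- apply: (@le_lt_trans _ _ L%:E); last exact: ltry.
  by rewrite -mu_cellI.
- exact: measurable_funTS.
- exists `|M|; split; first exact: num_real.
  by move=> N MN x _ /=; rewrite (le_trans (hM x))// (le_trans (ler_norm _))// ltW.
Qed.

(** The inner integral is taken in a variable of nonzero frequency, over whole periods. The free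
    phase [t] absorbs the other variable, and its value - pi / 2 turns the cosine into the sine of
    the imaginary part. *)
Lemma avg_cos_phase k (t : R) : k != 0 ->
  avg (leb2 R) cell (fun z => cos (t + omega * (k.1%:~R * z.1 + k.2%:~R * z.2))) = 0.
Proof.
move=> k0; rewrite /avg; apply/eqP; rewrite mulf_eq0; apply/orP; right; apply/eqP.
have bm : bmeas (fun z : mplane R => cos (t + omega * (k.1%:~R * z.1 + k.2%:~R * z.2))).
  split; last by exists 1 => z; exact: cos_max.
  apply: (measurableT_comp _ (measurable_funD (measurable_cst t) (measurable_phase k))).
  apply: continuous_measurable_fun; exact: continuous_cos.
have ic := bmeas_rint measurable_cell leb2_cell_fin bm.
have sl (g : R -> R) : measurable_fun setT g -> mu.-integrable cellI (EFin \o (fun y => cos (g y))).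
  move=> mg; apply: integrable_itv_bmeas; split; last by exists 1 => x; exact: cos_max.
  by apply: measurableT_comp => //; apply: continuous_measurable_fun; exact: continuous_cos.
have [k2|k2] := eqVneq k.2 0.
  have k1 : k.1 != 0.
    by apply: contra k0 => /eqP k1; apply/eqP; move: k1 k2; case: (k) => i j /= -> ->.
  have -> := leb2_fubini_swap
    (F := fun x y => cos (t + omega * (k.1%:~R * x + k.2%:~R * y)))
    (measurable_itv _) (measurable_itv _) ic _.
    rewrite (@eq_Rintegral _ _ _ _ _ (fun=> 0)) ?Rintegral_cst ?mul0r// => y _.
    rewrite -[RHS](integral_cos_period t k1); apply: eq_Rintegral => x _ /=.
    by rewrite k2 mul0r addr0.
  move=> y _; apply: sl; apply: measurable_funD => //; apply: measurable_funM => //.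
  by apply: measurable_funD => //; apply: measurable_funM.
have -> := leb2_fubini
  (F := fun x y => cos (t + omega * (k.1%:~R * x + k.2%:~R * y)))
  (measurable_itv _) (measurable_itv _) ic _.
  rewrite (@eq_Rintegral _ _ _ _ _ (fun=> 0)) ?Rintegral_cst ?mul0r// => x _.
  rewrite -[RHS](integral_cos_period (t + omega * (k.1%:~R * x)) k2).
  by apply: eq_Rintegral => y _ /=; rewrite mulrDr addrA.
move=> x _; apply: sl; apply: measurable_funD => //; apply: measurable_funM => //.
by apply: measurable_funD => //; apply: measurable_funM.
Qed.

Lemma cavg_ek k : cavg (leb2 R) cell (ek k) = (k == 0)%:R.
Proof.
have [->|k0] := eqVneq k 0.
  rewrite (@eq_cavg _ _ _ (leb2 R) cell _ (fun=> 1)); last by move=> z _; rewrite ek0.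
  by rewrite /cavg /= !(avg_cst measurable_cell leb2_cell_fin).
rewrite /cavg /=; have E1 := avg_cos_phase 0 k0; have E2 := avg_cos_phase (- (pi / 2)) k0.
congr Complex.
  by rewrite -[RHS]E1; apply: eq_avg => z _; rewrite add0r.
rewrite -[RHS]E2; apply: eq_avg => z _.
by rewrite [in RHS]addrC cosBpihalf.
Qed.

Lemma ek_orthonormal k l :
  cavg (leb2 R) cell (fun z => ek k z * conjc (ek l z)) = (k == l)%:R.
Proof.
rewrite -subr_eq0 -cavg_ek; apply: eq_cavg => z _.
by rewrite ek_conj -ekD.
Qed.

End cell.

Section sign_iteration.
Variable R : realType.
Implicit Types (u : R) (n : nat).

(** An odd cubic with fixed points -1, 0 and 1, of slope 3/2 at 0 and slope 0 at the ends, so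
    iteration drives points of [-1, 1] to their sign. Being a polynomial, it maps real trigonometric
    polynomials to real trigonometric polynomials. *)
Definition smoothstep (u : R) : R := (3 * u - u ^+ 3) / 2.

Lemma smoothstep_bound u : `|u| <= 1 -> `|smoothstep u| <= 1.
Proof.
rewrite !ler_norml /smoothstep => /andP[u1 u2]; apply/andP; split.
  have : 0 <= (1 + u) ^+ 2 * (2 - u) by rewrite mulr_ge0 ?sqr_ge0//; lra.
  lra.
have : 0 <= (1 - u) ^+ 2 * (2 + u) by rewrite mulr_ge0 ?sqr_ge0//; lra.
lra.
Qed.

Lemma iter_smoothstep_bound n u : `|u| <= 1 -> `|iter n smoothstep u| <= 1.
Proof. by move=> u1; elim: n => //= n; exact: smoothstep_bound. Qed.

Lemma iter_smoothstepN n u : iter n smoothstep (- u) = - iter n smoothstep u.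
Proof. by elim: n => //= n ->; rewrite /smoothstep; field. Qed.

Lemma iter_smoothstep0 n : iter n smoothstep 0 = 0.
Proof. by elim: n => //= n ->; rewrite /smoothstep; field. Qed.

(** One step multiplies 1 - v by (1 - v) (2 + v) / 2, which is at most 1 - u / 2 because the
    iterates increase and stay above u. *)
Lemma iter_smoothstep_rate n u : 0 < u <= 1 ->
  (u <= iter n smoothstep u) && (1 - iter n smoothstep u <= (1 - u / 2) ^+ n).
Proof.
move=> /andP[u0 u1]; elim: n => [|n /andP[ih1 ih2]] /=.
  by rewrite lexx expr0 lerBlDr lerDl ltW.
have := iter_smoothstep_bound n (_ : `|u| <= 1).
rewrite ger0_norm ?(ltW u0)// => /(_ u1).
set v := iter n smoothstep u in ih1 ih2 *; rewrite ler_norml => /andP[_ v1].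
have E : 1 - smoothstep v = (1 - v) * ((1 - v) * (2 + v) / 2).
  by rewrite /smoothstep; field.
apply/andP; split.
  rewrite (le_trans ih1)// -subr_ge0.
  have -> : smoothstep v - v = v * (1 - v) * (1 + v) / 2 by rewrite /smoothstep; field.
  by rewrite divr_ge0// !mulr_ge0//; lra.
rewrite E exprS mulrC; apply: ler_pM.
- by rewrite divr_ge0// mulr_ge0//; lra.
- by rewrite subr_ge0.
- have h : 0 <= (v - u) * (1 + u + v) by rewrite mulr_ge0//; lra.
  have h2 : 0 <= u ^+ 2 by exact: sqr_ge0.
  by rewrite ler_pdivrMr//; nra.
- exact: ih2.
Qed.

(* The iterates of [smoothstep] on [-1, 1] converge to the sign of [u], so that
   these polynomials converge boundedly to the indicator of [0 < u]. *)
Definition posapprox n (u : R) : R :=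
  (iter n smoothstep u ^+ 2 + iter n smoothstep u) / 2.

Lemma posapprox_bound n u : `|u| <= 1 -> `|posapprox n u| <= 1.
Proof.
move=> /(iter_smoothstep_bound n); rewrite /posapprox.
set v := iter n _ u; rewrite !ler_norml => /andP[v1 v2]; apply/andP; split.
  have : 0 <= v ^+ 2 by exact: sqr_ge0.
  lra.
nra.
Qed.

Lemma posapprox_cvg (u : R) : `|u| <= 1 ->
  (fun n => posapprox n u) @ \oo --> ((0 < u)%R%:R : R).
Proof.
move=> u1.
have cvg1 (v : R) : 0 < v <= 1 -> iter n smoothstep v @[n --> \oo] --> (1 : R).
  move=> /andP[v0 v1].
  have l0 : (1 - v / 2) ^+ n @[n --> \oo] --> (0 : R).
    by apply: cvg_expr; rewrite ger0_norm; lra.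
  apply/cvgrPdist_le => eps eps0; near=> n.
  have /andP[h1 h2] : (v <= iter n smoothstep v) && (1 - iter n smoothstep v <= (1 - v / 2) ^+ n).
    by apply: iter_smoothstep_rate; rewrite v0.
  have vv : `|v| <= 1 by rewrite ger0_norm// ltW.
  have := iter_smoothstep_bound n vv; rewrite ler_norml => /andP[_ h3].
  rewrite ger0_norm ?subr_ge0// (le_trans h2)// -[leLHS]ger0_norm; last first.
    by rewrite exprn_ge0//; lra.
  rewrite -normrN -sub0r; near: n.
  by move/cvgrPdist_le : l0; exact.
have fin (l : R) : iter n smoothstep u @[n --> \oo] --> l ->
   posapprox n u @[n --> \oo] --> (l ^+ 2 + l) / 2.
  move=> hl; apply: cvgMr_tmp; apply: cvgD => //.
  by rewrite expr2; under eq_fun do rewrite expr2; exact: cvgM.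
have [u0|u0|u0] := ltgtP 0 u.
- have := fin 1 (cvg1 u _); have -> : ((1 : R) ^+ 2 + 1) / 2 = 1 by field.
  apply; rewrite u0; by move: u1; rewrite ler_norml => /andP[].
- have h : 0 < - u <= 1.
    by rewrite oppr_gt0 u0; move: u1; rewrite ler_norml => /andP[]; lra.
  have := fin (-1); have -> : ((-1 : R) ^+ 2 + -1) / 2 = 0 by field.
  apply; rewrite (_ : (fun n => _) = (fun n => - iter n smoothstep (- u))); last first.
    by apply/funext => n; rewrite iter_smoothstepN opprK.
  by apply: cvgN; exact: cvg1.
- have := fin 0; have -> : ((0 : R) ^+ 2 + 0) / 2 = 0 by field.
  apply; rewrite -u0; under eq_fun do rewrite iter_smoothstep0.
  exact: cvg_cst.
Unshelve. all: by end_near. Qed.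

End sign_iteration.

Section trigpoly.
Variables (R : realType) (c L : R).
Hypothesis L0 : 0 < L.
Notation mu := (@lebesgue_measure R).

(** Frequencies may repeat in the list, which keeps sums and products simple; [collect_frequencies]
    merges repetitions. *)
Definition trigpoly (Q : mplane R -> R[i]) := exists s : seq (R[i] * (int * int)),
  forall z, Q z = \sum_(p <- s) p.1 * ek L p.2 z.

Lemma trigpoly_ek k : trigpoly (ek L k).
Proof. by exists [:: (1, k)] => z; rewrite big_seq1 mul1r. Qed.

Lemma trigpolyD P Q : trigpoly P -> trigpoly Q -> trigpoly (fun z => P z + Q z).
Proof.
by move=> [s hs] [t ht]; exists (s ++ t) => z; rewrite big_cat/= hs ht.
Qed.

Lemma trigpolyM P Q : trigpoly P -> trigpoly Q -> trigpoly (fun z => P z * Q z).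
Proof.
move=> [s hs] [t ht].
exists [seq (p.1 * r.1, p.2 + r.2) | p <- s, r <- t] => z.
rewrite big_allpairs_dep hs ht mulr_suml; apply: eq_bigr => p _.
by rewrite mulr_sumr; apply: eq_bigr => r _ /=; rewrite ekD; ring.
Qed.

Lemma trigpoly_cst a : trigpoly (fun=> a).
Proof. by exists [:: (a, 0)] => z; rewrite big_seq1/= ek0 mulr1. Qed.

Lemma eq_trigpoly P Q : P =1 Q -> trigpoly P -> trigpoly Q.
Proof. by move=> PQ [s hs]; exists s => z; rewrite -PQ. Qed.

Lemma cbmeas_trigpoly Q : trigpoly Q -> cbmeas Q.
Proof.
move=> [s hs]; have -> : Q = (fun z => \sum_(p <- s) p.1 * ek L p.2 z) by exact/funext.
by apply: cbmeas_sum => p; apply: cbmeasM; [exact: cbmeas_cst|exact: cbmeas_ek].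
Qed.

Definition rtrigpoly (u : mplane R -> R) := trigpoly (fun z => Complex (u z) 0).

Lemma bmeas_rtrigpoly u : rtrigpoly u -> bmeas u.
Proof. by move=> /cbmeas_trigpoly[]. Qed.

Lemma rtrigpoly_cst a : rtrigpoly (fun=> a).
Proof. exact: trigpoly_cst. Qed.

Lemma rtrigpolyD u v : rtrigpoly u -> rtrigpoly v -> rtrigpoly (fun z => u z + v z).
Proof.
move=> hu hv; apply: eq_trigpoly (trigpolyD hu hv) => z.
by simpc.
Qed.

Lemma rtrigpolyM u v : rtrigpoly u -> rtrigpoly v -> rtrigpoly (fun z => u z * v z).
Proof.
move=> hu hv; apply: eq_trigpoly (trigpolyM hu hv) => z.
by simpc.
Qed.

Lemma rtrigpolyZ a u : rtrigpoly u -> rtrigpoly (fun z => a * u z).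
Proof. by move=> hu; apply: rtrigpolyM => //; exact: rtrigpoly_cst. Qed.

Lemma rtrigpolyB u v : rtrigpoly u -> rtrigpoly v -> rtrigpoly (fun z => u z - v z).
Proof.
move=> hu hv; have := rtrigpolyD hu (rtrigpolyZ (-1) hv).
by under eq_fun do rewrite mulN1r.
Qed.

Lemma rtrigpoly_cos k (t : R) :
  rtrigpoly (fun z => cos (t + omega L * (k.1%:~R * z.1 + k.2%:~R * z.2))).
Proof.
have h1 := trigpolyM (trigpoly_cst (Complex 2^-1 0 * cis t)) (trigpoly_ek k).
have h2 := trigpolyM (trigpoly_cst (Complex 2^-1 0 * cis (- t))) (trigpoly_ek (- k)).
apply: eq_trigpoly (trigpolyD h1 h2) => z.
rewrite -ek_conj -cis_conj /ek; set w := _ * _.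
by rewrite cosD /cis /=; simpc; congr Complex; field.
Qed.

Lemma rtrigpoly_smoothstep n u : rtrigpoly u -> rtrigpoly (fun z => iter n (@smoothstep R) (u z)).
Proof.
move=> hu; elim: n => //= n ih.
have h3 := rtrigpolyM ih (rtrigpolyM ih ih).
have := rtrigpolyZ 2^-1 (rtrigpolyB (rtrigpolyZ 3 ih) h3).
by apply: eq_trigpoly => z; congr Complex; rewrite /smoothstep; field.
Qed.

Lemma rtrigpoly_posapprox n u : rtrigpoly u -> rtrigpoly (fun z => posapprox n (u z)).
Proof.
move=> /(rtrigpoly_smoothstep n) h.
have := rtrigpolyZ 2^-1 (rtrigpolyD (rtrigpolyM h h) h).
by apply: eq_trigpoly => z; congr Complex; rewrite /posapprox; field.
Qed.

(** The uniform bound makes these limits stable under products and allows dominated convergence. *)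
Definition trig_limit_set (A : set (mplane R)) := exists u : (mplane R -> R)^nat,
  [/\ forall n, rtrigpoly (u n), forall n z, `|u n z| <= 1 &
      forall z, u n z @[n --> \oo] --> (\1_A z : R)].

Lemma trig_limit_setI A B : trig_limit_set A -> trig_limit_set B ->
  trig_limit_set (A `&` B).
Proof.
move=> [u [u1 u2 u3]] [v [v1 v2 v3]]; exists (fun n z => u n z * v n z); split.
- by move=> n; exact: rtrigpolyM.
- by move=> n z; rewrite normrM mulr_ile1.
- by move=> z; rewrite indicI; apply: cvgM.
Qed.

Lemma trig_limit_set_pos u : rtrigpoly u -> (forall z, `|u z| <= 1) ->
  trig_limit_set [set z | 0 < u z].
Proof.
move=> hu u1; exists (fun n z => posapprox n (u z)); split.
- by move=> n; exact: rtrigpoly_posapprox.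
- by move=> n z; exact: posapprox_bound.
- move=> z; rewrite indicE; have := posapprox_cvg (u1 z).
  congr (_ --> _); congr (_%:R); congr nat_of_bool.
  by apply/idP/idP; rewrite inE.
Qed.

Lemma trig_limit_set0 : trig_limit_set set0.
Proof.
exists (fun _ _ => 0); split.
- by move=> n; exact: rtrigpoly_cst.
- by move=> n z; rewrite normr0.
- by move=> z; rewrite indic0; exact: cvg_cst.
Qed.

(* On the circle of length [L], the arc from [c] to [a] is a superlevel set of a
   translate of the cosine. *)
Lemma arc_cos (a x : R) : c <= a <= c + L -> c < x < c + L ->
  (0 < cos (omega L * (x - (c + a) / 2)) - cos (omega L * (a - c) / 2)) = (x < a).
Proof.
move=> /andP[ca aL] /andP[cx xL]; have L0' := L0.
have w0 : 0 < omega L by rewrite /omega divr_gt0// mulr_gt0// pi_gt0.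
have wL : omega L * L = 2 * pi by rewrite /omega divfK// gt_eqF.
set th := omega L * (x - _); set be := omega L * (a - c) / 2.
have be0 : 0 <= be by rewrite /be divr_ge0// mulr_ge0 ?subr_ge0// ltW.
have bepi : be <= pi.
  have : omega L * (a - c) <= omega L * L by rewrite ler_pM2l//; lra.
  by rewrite wL /be; lra.
have thE : th + be = omega L * (x - c) by rewrite /th /be; field.
have thE2 : th - be = omega L * (x - a) by rewrite /th /be; field.
have th1 : 0 < th + be by rewrite thE mulr_gt0// subr_gt0.
have th2 : th + be < 2 * pi by rewrite thE -wL ltr_pM2l//; lra.
have mono := @ltr_cos R.
have [xa|ax] := ltP x a.
  have th3 : th < be.
    have : omega L * (x - a) < 0 by rewrite pmulr_rlt0// subr_lt0.
    lra.
  rewrite subr_gt0 -(cos_norm th).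
  have nth : `|th| < be by rewrite ltr_norml th3 andbT; lra.
  rewrite mono// in_itv/= ?be0 ?bepi//.
  by rewrite normr_ge0 (le_trans (ltW nth)).
have th3 : be <= th.
  have : 0 <= omega L * (x - a) by rewrite mulr_ge0 ?subr_ge0// ltW.
  lra.
apply/negbTE; rewrite -leNgt subr_le0.
have [thpi|thpi] := leP th pi.
  rewrite leNgt mono -?leNgt// in_itv/= ?be0 ?bepi// thpi andbT.
  exact: le_trans th3.
have -> : cos th = cos (2 * pi - th).
  by rewrite -[RHS]cosN -[RHS](cosDz2pi 1); congr cos; rewrite mul1r; ring.
rewrite leNgt mono -?leNgt//; rewrite ?in_itv/= ?be0 ?bepi//; first lra.
by apply/andP; split; lra.
Qed.

End trigpoly.

Section density.
Variables (R : realType) (c L : R).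
Hypothesis L0 : 0 < L.
Notation mu := (@lebesgue_measure R).
Notation m2 := (leb2 R).
Notation D := (cell c L).

Let mD : measurable D := measurable_cell c L.

Lemma integral_sqrD_le (f g : mplane R -> R) :
  measurable_fun D f -> measurable_fun D g ->
  (\int[m2]_(z in D) ((f z + g z) ^+ 2)%:E <=
   2%:E * \int[m2]_(z in D) (f z ^+ 2)%:E + 2%:E * \int[m2]_(z in D) (g z ^+ 2)%:E)%E.
Proof.
move=> mf mg.
have mf2 : measurable_fun D (fun z => (f z ^+ 2)%:E).
  by apply/measurable_EFinP; exact: measurable_funX.
have mg2 : measurable_fun D (fun z => (g z ^+ 2)%:E).
  by apply/measurable_EFinP; exact: measurable_funX.
have sq0 (h : mplane R -> R) z : (0 <= (h z ^+ 2)%:E)%E by rewrite lee_fin sqr_ge0.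
rewrite -!ge0_integralZl//; try by move=> z _; exact: sq0.
rewrite -ge0_integralD//; last 4 first.
- by move=> z _; rewrite mule_ge0// sq0.
- exact: measurable_funeM.
- by move=> z _; rewrite mule_ge0// sq0.
- exact: measurable_funeM.
apply: ge0_le_integral => //.
- by move=> z _; rewrite lee_fin sqr_ge0.
- by apply/measurable_EFinP; apply: measurable_funX; exact: measurable_funD.
- by apply: emeasurable_funD; exact: measurable_funeM.
- move=> z _; rewrite -!EFinM -EFinD lee_fin.
  have : 0 <= (f z - g z) ^+ 2 by exact: sqr_ge0.
  lra.
Qed.

Definition approximable (h : mplane R -> R) := measurable_fun D h /\
  forall eps, 0 < eps -> exists u, rtrigpoly L u /\
    (\int[m2]_(z in D) ((h z - u z) ^+ 2)%:E <= eps%:E)%E.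

Lemma measurable_rtrigpoly u : rtrigpoly L u -> measurable_fun D u.
Proof. by move=> /bmeas_rtrigpoly[mu' _]; exact: measurable_funTS. Qed.

Lemma approximable_rtrigpoly u : rtrigpoly L u -> approximable u.
Proof.
move=> hu; split; first exact: measurable_rtrigpoly.
move=> eps eps0; exists u; split => //.
rewrite (eq_integral (fun=> 0%E)) ?integral0 ?lee_fin ?ltW// => z _.
by rewrite subrr expr0n.
Qed.

Lemma approximable_close (h : mplane R -> R) : measurable_fun D h ->
  (forall eps, 0 < eps -> exists k, approximable k /\
    (\int[m2]_(z in D) ((h z - k z) ^+ 2)%:E <= eps%:E)%E) ->
  approximable h.
Proof.
move=> mh H; split=> // eps eps0.
have e4 : 0 < eps / 4 by rewrite divr_gt0.
have [k [[mk hk] hhk]] := H _ e4; have [u [tu hku]] := hk _ e4.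
exists u; split => //.
under eq_integral => z _ do rewrite -(subrKA (k z)).
apply: le_trans (integral_sqrD_le (measurable_funB mh mk)
  (measurable_funB mk (measurable_rtrigpoly tu))) _.
apply: (@le_trans _ _ (2%:E * (eps / 4)%:E + 2%:E * (eps / 4)%:E)%E).
  by apply: leeD; rewrite lee_pmul2l.
by rewrite -!EFinM -EFinD lee_fin; lra.
Qed.

Lemma approximableD h k : approximable h -> approximable k ->
  approximable (fun z => h z + k z).
Proof.
move=> [mh hh] [mk hk]; split; first exact: measurable_funD.
move=> eps eps0; have e4 : 0 < eps / 4 by rewrite divr_gt0.
have [u [tu hu]] := hh _ e4; have [v [tv hv]] := hk _ e4.
exists (fun z => u z + v z); split; first exact: rtrigpolyD.
under eq_integral => z _ do rewrite opprD addrACA.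
apply: le_trans (integral_sqrD_le (measurable_funB mh (measurable_rtrigpoly tu))
  (measurable_funB mk (measurable_rtrigpoly tv))) _.
apply: (@le_trans _ _ (2%:E * (eps / 4)%:E + 2%:E * (eps / 4)%:E)%E).
  by apply: leeD; rewrite lee_pmul2l.
by rewrite -!EFinM -EFinD lee_fin; lra.
Qed.

Lemma approximableZ a h : approximable h -> approximable (fun z => a * h z).
Proof.
move=> [mh hh]; split; first exact: measurable_funM.
move=> eps eps0; have e1 : 0 < eps / (a ^+ 2 + 1).
  by rewrite divr_gt0// ltr_wpDl// sqr_ge0.
have [u [tu hu]] := hh _ e1.
exists (fun z => a * u z); split; first exact: rtrigpolyZ.
under eq_integral => z _ do rewrite -mulrBr exprMn EFinM.
have mm : measurable_fun D (fun z => ((h z - u z) ^+ 2)%:E).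
  apply/measurable_EFinP; apply: measurable_funX; apply: measurable_funB => //.
  exact: measurable_rtrigpoly.
have nn z : D z -> (0 <= ((h z - u z) ^+ 2)%:E)%E by rewrite lee_fin sqr_ge0.
rewrite (ge0_integralZl _ mD mm nn) ?lee_fin ?sqr_ge0//.
apply: (@le_trans _ _ ((a ^+ 2)%:E * (eps / (a ^+ 2 + 1))%:E)%E).
  by rewrite lee_pmul// ?lee_fin ?sqr_ge0// integral_ge0// => z _; rewrite lee_fin sqr_ge0.
have a1 : 0 < a ^+ 2 + 1 by rewrite ltr_wpDl// sqr_ge0.
rewrite -EFinM lee_fin mulrCA (ler_piMr (ltW eps0))// ler_pdivrMr//.
by rewrite mul1r lerDl.
Qed.

Lemma approximable_sum (I : Type) (s : seq I) (F : I -> mplane R -> R) :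
  (forall i, approximable (F i)) -> approximable (fun z => \sum_(i <- s) F i z).
Proof.
move=> hF; elim: s => [|i s ih].
  under eq_fun do rewrite big_nil.
  by apply: approximable_rtrigpoly; exact: rtrigpoly_cst.
under eq_fun do rewrite big_cons.
exact: approximableD.
Qed.

(** Dominated convergence of the squared differences gives L^2 convergence, and approximability is
    closed in L^2. *)
Lemma approximable_dominated (h : mplane R -> R) (hn : (mplane R -> R)^nat)
    (G : mplane R -> R) :
  (forall n, approximable (hn n)) -> measurable_fun D h ->
  {ae m2, forall z, D z -> hn n z @[n --> \oo] --> h z} ->
  m2.-integrable D (EFin \o G) ->
  (forall n z, D z -> (h z - hn n z) ^+ 2 <= G z) -> approximable h.
Proof.
move=> hhn mh cv iG dom; apply: approximable_close => // eps eps0.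
have mn n : measurable_fun D (hn n) by have [] := hhn n.
have [] := @dominated_convergence _ _ R m2 D mD
  (fun n z => ((h z - hn n z) ^+ 2)%:E) (fun=> 0%E) (EFin \o G).
- by move=> n; apply/measurable_EFinP; apply: measurable_funX; exact: measurable_funB.
- exact: measurable_cst.
- move: cv; apply: filterS => z hz Dz; apply: cvg_EFin; first exact: nearW.
  have h0 : h z - hn n z @[n --> \oo] --> (0 : R).
    by rewrite -(subrr (h z)); apply: cvgB; [exact: cvg_cst|exact: hz].
  have hh := cvgM h0 h0; rewrite mulr0 in hh.
  have h2 : (h z - hn n z) ^+ 2 @[n --> \oo] --> (0 : R).
    by under eq_fun do rewrite expr2; exact: hh.
  exact: h2.
- exact: iG.
- apply: aeW => z n Dz; rewrite gee0_abs ?lee_fin ?sqr_ge0//.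
  exact: dom.
move=> _ _; rewrite integral0 => /fine_cvgP[_].
move=> /cvgrPdist_le/(_ eps eps0)[N _ HN].
have := HN N (leqnn N); rewrite /= sub0r normrN => hN.
exists (hn N); split => //.
have i0 : m2.-integrable D (fun z => ((h z - hn N z) ^+ 2)%:E).
  apply: (le_integrable mD _ _ iG).
    by apply/measurable_EFinP; apply: measurable_funX; exact: measurable_funB.
  move=> z Dz /=; rewrite lee_fin ger0_norm ?sqr_ge0// (le_trans (dom N z Dz))//.
  exact: ler_norm.
rewrite -[leLHS]fineK; last exact: integrable_fin_num.
by rewrite lee_fin (le_trans (ler_norm _)).
Qed.

Let muD := leb2_cell_fin c L0.

Lemma integrable_cell_cst (k : R) : m2.-integrable D (EFin \o (fun=> k)).
Proof. exact: (rint_cst mD muD k). Qed.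

(** The edges are removed because the exponentials take equal values at c and c + L and cannot
    separate them; the edges have measure zero. *)
Definition open_cell : set (mplane R) := `]c, c + L[ `*` `]c, c + L[.

Lemma ae_open_cell : {ae m2, forall z, D z -> open_cell z}.
Proof.
pose P : set R := [set c; c + L].
have mP : measurable P by apply: measurableU; exact: measurable_set1.
have P0 : mu P = 0%E.
  apply: countable_lebesgue_measure0; apply: finite_set_countable.
  exact: finite_set2.
exists ((P `*` setT) `|` (setT `*` P)); split.
- by apply: measurableU; apply: measurableX.
- apply/eqP; rewrite eq_le measure_ge0 andbT.
  have h1 : m2 (P `*` setT) = 0%E.
    have h := @product_measure1E _ _ _ _ R mu mu P setT mP measurableT.
    by rewrite [LHS]h [X in (X * _)%E]P0 mul0e.
  have h2 : m2 (setT `*` P) = 0%E.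
    have h := @product_measure1E _ _ _ _ R mu mu setT P measurableT mP.
    by rewrite [LHS]h [X in (_ * X)%E]P0 mule0.
  apply: (@le_trans _ _ (m2 (P `*` setT) + m2 (setT `*` P))%E).
    by apply: measureU2; apply: measurableX.
  by rewrite [X in (X + _)%E]h1 [X in (_ + X)%E]h2 adde0.
- move=> z /= /not_implyP[[]]; rewrite /cellI /= !in_itv/= => /andP[z1 z2] /andP[z3 z4].
  have [->|n1] := eqVneq z.1 c; first by left; split => //; left.
  have [->|n2] := eqVneq z.1 (c + L); first by left; split => //; right.
  have [->|n3] := eqVneq z.2 c; first by right; split => //; left.
  have [->|n4] := eqVneq z.2 (c + L); first by right; split => //; right.
  case; split; rewrite /= in_itv/=; apply/andP; split; rewrite lt_neqAle ?z1 ?z2 ?z3 ?z4 andbT//.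
  + by rewrite eq_sym.
  + by rewrite eq_sym.
Qed.

(** The generating class for Dynkin's theorem. Agreement is asked only off the edges, where periodic
    functions can distinguish points. *)
Definition pi_cell : set (set (mplane R)) := [set A | measurable A /\
  exists B, trig_limit_set L B /\ forall z, open_cell z -> A z <-> B z].

Lemma pi_cell_setI : setI_closed pi_cell.
Proof.
move=> A A' [mA [B [tB hB]]] [mA' [B' [tB' hB']]]; split; first exact: measurableI.
exists (B `&` B'); split; first exact: trig_limit_setI.
by move=> z oz; split=> -[h h']; split; apply/(hB z oz) || apply/(hB' z oz).
Qed.

Definition approximable_set : set (set (mplane R)) :=
  [set A | measurable A /\ approximable (\1_A : mplane R -> R)].

Lemma norm_indic_le1 (A : set (mplane R)) z : `|(\1_A z : R)| <= 1.
Proof. by rewrite indicE; case: (_ \in _); rewrite ?normr1 ?normr0. Qed.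

Lemma sqr_diff_le4 (a b : R) : `|a| <= 1 -> `|b| <= 1 -> (a - b) ^+ 2 <= 4.
Proof. rewrite !ler_norml => /andP[? ?] /andP[? ?]; nra. Qed.

Lemma pi_cell_approximable : pi_cell `<=` approximable_set.
Proof.
move=> A [mA [B [[u [u1 u2 u3]] AB]]]; split => //.
apply: (@approximable_dominated _ u (fun=> 4)).
- by move=> n; exact: approximable_rtrigpoly.
- exact: measurable_indic.
- have := ae_open_cell; apply: filterS => z hz Dz.
  have -> : \1_A z = \1_B z :> R.
    rewrite !indicE; congr (_%:R); congr nat_of_bool.
    by apply/idP/idP; rewrite !inE; apply AB; exact: hz.
  exact: u3.
- exact: integrable_cell_cst.
- by move=> n z _; apply: sqr_diff_le4 => //; exact: norm_indic_le1.
Qed.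

Lemma approximable_set_lambda : lambda_system setT approximable_set.
Proof.
split => //.
- split; first exact: measurableT.
  by rewrite indicT; apply: approximable_rtrigpoly; exact: rtrigpoly_cst.
- move=> A B BA [mA hA] [mB hB]; split; first exact: measurableD.
  have := approximableD hA (approximableZ (-1) hB).
  congr approximable; apply/funext => z; rewrite !indicE.
  have [zB|zB] := boolP (z \in B).
    have zA : z \in A by rewrite inE; apply: BA; rewrite inE in zB.
    by rewrite zA (memNset (_ : ~ (A `\` B) z)) ?mulr1 ?subrr// => -[_]; apply; exact: set_mem.
  rewrite mulr0 addr0; congr (_%:R); congr nat_of_bool.
  apply/idP/idP => /set_mem.
    by move=> zA; apply: mem_set; split => // zB'; move/negP: zB; apply; rewrite inE.
  by move=> [zA _]; exact: mem_set.
- move=> F ndF HF; split; first by apply: bigcupT_measurable => i; case: (HF i).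
  apply: (@approximable_dominated _ (fun n => \1_(F n)) (fun=> 4)).
  + by move=> n; case: (HF n).
  + by apply: measurable_indic; apply: bigcupT_measurable => i; case: (HF i).
  + apply: aeW => z _; have [[N _ FN]|nF] := pselect ((\bigcup_i F i) z).
      apply: cvg_near_cst; exists N => // n /= Nn.
      rewrite !indicE !mem_set//; first by exists N.
      by have /subsetPset := ndF _ _ Nn; exact.
    apply: cvg_near_cst; apply: nearW => n; rewrite !indicE !memNset//.
    by move=> Fn; apply: nF; exists n.
  + exact: integrable_cell_cst.
  + by move=> n z _; apply: sqr_diff_le4; exact: norm_indic_le1.
Qed.

Lemma pi_cell_ray1 a : pi_cell (`]-oo, a[ `*` setT).
Proof.
split; first by apply: measurableX => //; exact: measurable_itv.
have L0' := L0.
have [ac|ca] := leP a c.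
  exists set0; split; first exact: trig_limit_set0.
  move=> z [/=]; rewrite !in_itv/= => /andP[z1 _] _; split => // -[za _].
  by have := lt_trans za (le_lt_trans ac z1); rewrite ltxx.
(* A ray reaching beyond c + L contains the whole open cell; truncation keeps the endpoint within
   the range of [arc_cos]. The factor 1/2 below brings the difference of cosines into [-1, 1]. *)
pose a' := Num.min a (c + L).
have a'c : c <= a' <= c + L.
  by rewrite /a' le_min ge_min lexx orbT (ltW ca) lerDl ltW.
pose u z := 2^-1 * (cos (- (omega L * ((c + a') / 2))
   + omega L * ((1 : int)%:~R * z.1 + (0 : int)%:~R * z.2)) - cos (omega L * (a' - c) / 2)).
exists [set z | 0 < u z]; split.
  apply: trig_limit_set_pos.
    apply: rtrigpolyZ; apply: rtrigpolyB; last exact: rtrigpoly_cst.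
    exact: (rtrigpoly_cos L (1, 0)).
  move=> z; rewrite /u normrM ger0_norm ?invr_ge0//.
  rewrite mulrC ler_pdivrMr// (le_trans (ler_normB _ _))//.
  by rewrite [leRHS](_ : _ = 1 + 1) ?mul1r// lerD// cos_max.
move=> z [/=]; rewrite !in_itv/= => /[dup] zc /andP[z1 z2] _.
have := arc_cos L0 a'c zc.
have -> : omega L * (z.1 - (c + a') / 2) = - (omega L * ((c + a') / 2)) +
   omega L * ((1 : int)%:~R * z.1 + (0 : int)%:~R * z.2) by rewrite mul1r mul0r; ring.
rewrite /u pmulr_rgt0 ?invr_gt0// => ->.
have -> : (z.1 < a') = (z.1 < a) by rewrite /a' lt_min z2 andbT.
by split => [[]|].
Qed.

Lemma pi_cell_ray2 a : pi_cell (setT `*` `]-oo, a[).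
Proof.
split; first by apply: measurableX => //; exact: measurable_itv.
have L0' := L0.
have [ac|ca] := leP a c.
  exists set0; split; first exact: trig_limit_set0.
  move=> z [/=]; rewrite !in_itv/= => _ /andP[z1 _]; split => // -[_ za].
  by have := lt_trans za (le_lt_trans ac z1); rewrite ltxx.
pose a' := Num.min a (c + L).
have a'c : c <= a' <= c + L.
  by rewrite /a' le_min ge_min lexx orbT (ltW ca) lerDl ltW.
pose u z := 2^-1 * (cos (- (omega L * ((c + a') / 2))
   + omega L * ((0 : int)%:~R * z.1 + (1 : int)%:~R * z.2)) - cos (omega L * (a' - c) / 2)).
exists [set z | 0 < u z]; split.
  apply: trig_limit_set_pos.
    apply: rtrigpolyZ; apply: rtrigpolyB; last exact: rtrigpoly_cst.
    exact: (rtrigpoly_cos L (0, 1)).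
  move=> z; rewrite /u normrM ger0_norm ?invr_ge0//.
  rewrite mulrC ler_pdivrMr// (le_trans (ler_normB _ _))//.
  by rewrite [leRHS](_ : _ = 1 + 1) ?mul1r// lerD// cos_max.
move=> z [/=]; rewrite !in_itv/= => _ /[dup] zc /andP[z1 z2].
have := arc_cos L0 a'c zc.
have -> : omega L * (z.2 - (c + a') / 2) = - (omega L * ((c + a') / 2)) +
   omega L * ((0 : int)%:~R * z.1 + (1 : int)%:~R * z.2) by rewrite mul1r mul0r; ring.
rewrite /u pmulr_rgt0 ?invr_gt0// => ->.
have -> : (z.2 < a') = (z.2 < a) by rewrite /a' lt_min z2 andbT.
by split => [[]|].
Qed.

Lemma measurable_ray_ind (S : set (set R)) : sigma_algebra setT S ->
  (forall a, S `]-oo, a[%classic) -> forall B, measurable B -> S B.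
Proof.
move=> sS hS B mB; have E := RGenInftyO.measurableE R.
have {}mB : (@RGenInftyO.G R).-sigma.-measurable B by rewrite -E.
by apply: (smallest_sub sS _ mB) => _ [a ->].
Qed.

(** The rays generate the Borel sets of each axis, hence all cylinders, and rectangles are
    intersections of two cylinders. *)
Lemma pi_cell_generates (A : set (mplane R)) : measurable A -> <<s pi_cell >> A.
Proof.
have sa : sigma_algebra setT <<s pi_cell >> by exact: smallest_sigma_algebra.
have [sa0 saD saU] := sa.
have saC (B : set (mplane R)) : <<s pi_cell >> B -> <<s pi_cell >> (~` B).
  by move=> hB; rewrite -setTD; exact: saD.
have saI (B B' : set (mplane R)) : <<s pi_cell >> B -> <<s pi_cell >> B' -> <<s pi_cell >> (B `&` B').
  move=> hB hB'; rewrite -[B]setCK -[B']setCK -setCU.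
  suff U2 : <<s pi_cell >> (~` B `|` ~` B') by exact: (saC _ U2).
  rewrite -bigcup2E; apply: (saU (bigcup2 (~` B) (~` B'))) => -[|[|n]] /=.
  - exact: (saC _ hB).
  - exact: (saC _ hB').
  - exact: sa0.
have H1 (B : set R) : measurable B -> <<s pi_cell >> (B `*` setT : set (mplane R)).
  apply: (@measurable_ray_ind [set B : set R | <<s pi_cell >> (B `*` setT : set (mplane R))]).
    split => /=.
    - by rewrite set0X.
    - move=> X hX; have -> : (setT `\` X) `*` setT = ~` (X `*` setT) :> set (mplane R).
        by apply/seteqP; split => z /=; tauto.
      exact: (saC _ hX).
    - move=> F hF; have -> : (\bigcup_k F k) `*` setT = \bigcup_k (F k `*` setT) :> set (mplane R).
        by apply/seteqP; split => z /= => [[[k _ h] _]|[k _ [h _]]]; [exists k|split => //; exists k].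
      exact: (saU _ hF).
  by move=> x; apply: sub_sigma_algebra; exact: pi_cell_ray1.
have H2 (B : set R) : measurable B -> <<s pi_cell >> (setT `*` B : set (mplane R)).
  apply: (@measurable_ray_ind [set B : set R | <<s pi_cell >> (setT `*` B : set (mplane R))]).
    split => /=.
    - by rewrite setX0.
    - move=> X hX; have -> : setT `*` (setT `\` X) = ~` (setT `*` X) :> set (mplane R).
        by apply/seteqP; split => z /=; tauto.
      exact: (saC _ hX).
    - move=> F hF; have -> : setT `*` (\bigcup_k F k) = \bigcup_k (setT `*` F k) :> set (mplane R).
        by apply/seteqP; split => z /= => [[_ [k _ h]]|[k _ [_ h]]]; [exists k|split => //; exists k].
      exact: (saU _ hF).
  by move=> x; apply: sub_sigma_algebra; exact: pi_cell_ray2.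
have E := @measurable_prod_measurableType _ _ (measurableTypeR R) (measurableTypeR R).
move=> mA; rewrite [measurable]E in mA.
apply: (smallest_sub sa _ mA) => _ [B mB [B' mB'] <-].
have -> : B `*` B' = (B `*` setT) `&` (setT `*` B').
  by apply/seteqP; split => z /=; tauto.
by apply: saI; [exact: H1|exact: H2].
Qed.

Lemma approximable_indic (A : set (mplane R)) : measurable A -> approximable (\1_A).
Proof.
move=> mA; have := @lambda_system_subset _ _ pi_cell_setI _ _
  approximable_set_lambda pi_cell_approximable (fun _ _ _ _ => I) A.
by move=> /(_ (pi_cell_generates mA))[].
Qed.

End density.

From mathcomp Require finmap.
Import HBSimple HBNNSimple.

Section density_L2.
Variables (R : realType) (c L : R).
Hypothesis L0 : 0 < L.
Notation m2 := (leb2 R).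
Notation D := (cell c L).

Let mD : measurable D := measurable_cell c L.

Lemma approximable_nnsfun (s : {nnsfun mplane R >-> R}) : approximable c L s.
Proof.
pose t := finmap.enum_fset (fset_set (range s)).
have -> : (s : mplane R -> R) = fun z =>
    \sum_(i < size t) t`_i * \1_(s @^-1` [set t`_i]) z.
  by apply/funext => z; exact: fimfunEord.
apply: approximable_sum => i; apply: approximableZ; apply: approximable_indic => //.
Qed.

Lemma approximable_ge0 (h : mplane R -> R) : (forall z, 0 <= h z) ->
  measurable_fun D h -> m2.-integrable D (fun z => (h z ^+ 2)%:E) ->
  approximable c L h.
Proof.
move=> h0 mh ih.
have mf : measurable_fun D (EFin \o h) by exact/measurable_EFinP.
have cvgh z : D z -> (nnsfun_approx mD mf n z)%:E @[n --> \oo] --> (h z)%:E.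
  by move=> Dz; apply: (cvg_nnsfun_approx mD mf _ Dz) => w _; rewrite lee_fin.
have cvgr z : D z -> nnsfun_approx mD mf n z @[n --> \oo] --> h z.
  by move=> /cvgh/fine_cvgP[].
have leh n z : D z -> nnsfun_approx mD mf n z <= h z.
  move=> Dz; rewrite -(cvg_lim (@Rhausdorff R) (cvgr z Dz)).
  apply: (@nondecreasing_cvgn_le R (fun n => nnsfun_approx mD mf n z)).
    by move=> i j ij; have /lefP := nd_nnsfun_approx mD mf ij; exact.
  by apply/cvg_ex; exists (h z); exact: cvgr.
apply: (@approximable_dominated _ c L h (nnsfun_approx mD mf) (fun z => h z ^+ 2)) => //.
- by move=> n; exact: approximable_nnsfun.
- by apply: aeW => z; exact: cvgr.
- move=> n z Dz; have s0 : 0 <= nnsfun_approx mD mf n z by exact: fun_ge0.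
  by rewrite ler_sqr ?nnegrE// ?subr_ge0 ?leh// gerBl.
Qed.

Lemma approximable_L2 (h : mplane R -> R) :
  measurable_fun D h -> m2.-integrable D (fun z => (h z ^+ 2)%:E) ->
  approximable c L h.
Proof.
move=> mh ih.
have hE : h = fun z => Num.max (h z) 0 + -1 * Num.max (- h z) 0.
  apply/funext => z; rewrite mulN1r; have [h0|h0] := leP 0 (h z).
    by rewrite max_r ?oppr_le0// subr0.
  by rewrite max_l ?oppr_ge0 ?(ltW h0)// add0r opprK.
have mp : measurable_fun D (fun z => Num.max (h z) 0).
  exact: measurable_maxr.
have mn : measurable_fun D (fun z => Num.max (- h z) 0).
  by apply: measurable_maxr => //; exact: measurableT_comp.
have i2 (g : mplane R -> R) : measurable_fun D g -> (forall z, `|g z| <= `|h z|) ->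
    m2.-integrable D (fun z => (g z ^+ 2)%:E).
  move=> mg gh; apply: (le_integrable mD _ _ ih).
    by apply/measurable_EFinP; exact: measurable_funX.
  by move=> z _ /=; rewrite lee_fin !normrX lerXn2r ?nnegrE.
have nr (x : R) : `|Num.max x 0| <= `|x|.
  by have [x0|x0] := leP x 0; rewrite ?normr0.
rewrite hE; apply: approximableD.
  apply: approximable_ge0 => //; first by move=> z; rewrite le_max lexx orbT.
  by apply: i2 => // z.
apply: approximableZ.
apply: approximable_ge0 => //; first by move=> z; rewrite le_max lexx orbT.
by apply: i2 => // z; rewrite -[leRHS]normrN.
Qed.

Lemma trigpoly_dense (f : mplane R -> R[i]) (eps : R) : sqint m2 D f -> 0 < eps ->
  exists Q, trigpoly L Q /\
    (\int[m2]_(z in D) (cmod (f z - Q z) ^+ 2)%:E <= eps%:E)%E.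
Proof.
move=> [mr mi ii] eps0.
have i2 (g : mplane R -> R) : measurable_fun D g -> (forall z, `|g z| <= cmod (f z)) ->
    m2.-integrable D (fun z => (g z ^+ 2)%:E).
  move=> mg gh; apply: (le_integrable mD _ _ ii).
    by apply/measurable_EFinP; exact: measurable_funX.
  move=> z _ /=; rewrite lee_fin ger0_norm ?sqr_ge0// ger0_norm ?sqr_ge0//.
  by rewrite -real_normK ?num_real// lerXn2r ?nnegrE ?cmod_ge0.
have e2 : 0 < eps / 2 by rewrite divr_gt0.
have [_ /(_ _ e2)[u [tu hu]]] := approximable_L2 mr (i2 _ mr (fun z => Re_le_cmod _)).
have [_ /(_ _ e2)[v [tv hv]]] := approximable_L2 mi (i2 _ mi (fun z => Im_le_cmod _)).
exists (fun z => Complex (u z) 0 + Complex 0 1 * Complex (v z) 0); split.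
  by apply: trigpolyD => //; apply: trigpolyM => //; exact: trigpoly_cst.
have mu' := measurable_rtrigpoly (c := c) tu; have mv' := measurable_rtrigpoly (c := c) tv.
have E z : (cmod (f z - (Complex (u z) 0 + Complex 0 1 * Complex (v z) 0)) ^+ 2)%:E =
   (((complex.Re (f z) - u z) ^+ 2)%:E + ((complex.Im (f z) - v z) ^+ 2)%:E)%E.
  rewrite cmod_sqr -EFinD; congr EFin.
  by case: (f z) => a b /=; ring.
under eq_integral => z _ do rewrite E.
rewrite ge0_integralD//=.
- by rewrite [eps]splitr EFinD leeD.
- by move=> z _; rewrite lee_fin sqr_ge0.
- by apply/measurable_EFinP; apply: measurable_funX; exact: measurable_funB.
- by move=> z _; rewrite lee_fin sqr_ge0.
- by apply/measurable_EFinP; apply: measurable_funX; exact: measurable_funB.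
Qed.

End density_L2.

(** * The inequality on a square cell *)

Lemma measurable_cmod (d : measure_display) (T : measurableType d) (R : realType)
    (A : set T) (f : T -> R[i]) :
  measurable_fun A (fun x => complex.Re (f x)) ->
  measurable_fun A (fun x => complex.Im (f x)) ->
  measurable_fun A (fun x => cmod (f x)).
Proof.
move=> mr mi.
have m2 : measurable_fun A (fun x => cmod (f x) ^+ 2).
  under eq_fun do rewrite cmod_sqr.
  by apply: measurable_funD; apply: measurable_funX.
have := measurableT_comp (measurable_powR 2^-1) m2.
congr measurable_fun; apply/funext => x /=.
by rewrite powR12_sqrt ?sqr_ge0// sqrtr_sqr ger0_norm ?cmod_ge0.
Qed.

(** A real integral, which is the squared L^2 norm when it is finite; [sqint] guarantees this where
    it is used as such. *)
Definition sqnorm (R : realType) (D : set (mplane R)) (f : mplane R -> R[i]) : R :=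
  \int[leb2 R]_(z in D) cmod (f z) ^+ 2.

Lemma sqnorm_ge0 (R : realType) (D : set (mplane R)) f : 0 <= sqnorm D f.
Proof. by apply: Rintegral_ge0 => z _; exact: sqr_ge0. Qed.

Section cell_inequality.
Variables (R : realType) (c L : R).
Hypothesis L0 : 0 < L.
Notation m2 := (leb2 R).
Notation D := (cell c L).

Let mD : measurable D := measurable_cell c L.
Let muD := leb2_cell_fin c L0.

Definition fourier (f : mplane R -> R[i]) (k : int * int) : R[i] :=
  cavg m2 D (fun z => f z * conjc (ek L k z)).

Lemma avg_sqnorm f : avg m2 D (fun z => cmod (f z) ^+ 2) = (L ^+ 2)^-1 * sqnorm D f.
Proof. by rewrite /avg [X in fine X]leb2_cell. Qed.

Section modes.
Variable K : seq (int * int).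
Hypothesis Ku : uniq K.

Definition mode (i : 'I_(size K)) : mplane R -> R[i] := ek L (nth 0 K i).

Lemma cbmeas_mode i : cbmeas (mode i).
Proof. exact: cbmeas_ek. Qed.

Lemma nth_freq_inj : injective (fun i : 'I_(size K) => nth 0 K i).
Proof. by move=> i j /eqP; rewrite nth_uniq// => /eqP /val_inj. Qed.

Lemma mode_orthonormal i j :
  cavg m2 D (fun z => mode i z * conjc (mode j z)) = (i == j)%:R.
Proof. by rewrite /mode ek_orthonormal// (inj_eq nth_freq_inj). Qed.

Lemma synth_modeE (a : int * int -> R[i]) z :
  synth mode (fun i => a (nth 0 K i)) z = \sum_(k <- K) a k * ek L k z.
Proof. by rewrite /synth (big_nth 0) big_mkord. Qed.

Definition partial_fourier f : mplane R -> R[i] := synth mode (coef m2 D mode f).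

Lemma partial_fourierE f z :
  partial_fourier f z = \sum_(k <- K) fourier f k * ek L k z.
Proof. by rewrite -synth_modeE. Qed.

End modes.

Lemma collect_frequencies (K : seq (int * int)) (s : seq (R[i] * (int * int))) :
  uniq K -> (forall p, p \in s -> p.2 \in K) ->
  exists a : int * int -> R[i], forall z,
    \sum_(p <- s) p.1 * ek L p.2 z = \sum_(k <- K) a k * ek L k z.
Proof.
move=> Ku; elim: s => [|p s ih] sK.
  by exists (fun=> 0) => z; rewrite big_nil big1// => k _; rewrite mul0r.
have [|a ha] := ih; first by move=> r rs; apply: sK; rewrite inE rs orbT.
exists (fun k => (k == p.2)%:R * p.1 + a k) => z.
rewrite big_cons ha; under [RHS]eq_bigr do rewrite mulrDl.
rewrite big_split/=; congr (_ + _).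
rewrite (bigD1_seq p.2)//=; last by apply: sK; rewrite inE eqxx.
by rewrite eqxx mul1r big1 ?addr0// => k /negbTE ->; rewrite !mul0r.
Qed.

(** Frequency 0 is kept apart because the lattice bound excludes it: it is the mean that
    [cell_inequality] subtracts. *)
Lemma trigpoly_span Q : trigpoly L Q -> exists K (a : int * int -> R[i]),
  [/\ uniq K, 0 \notin K &
      forall z, Q z = \sum_(k <- 0 :: K) a k * ek L k z].
Proof.
move=> [s hs].
pose K := [seq k <- undup (map snd s) | k != 0].
have Ku : uniq (0 :: K).
  by rewrite /= filter_uniq ?undup_uniq// andbT mem_filter eqxx.
have [|a ha] := @collect_frequencies (0 :: K) s Ku.
  move=> p ps; rewrite inE mem_filter mem_undup map_f// andbT.
  by case: eqP.
by exists K, a; have /andP[h1 h2] := Ku; split => // z; rewrite hs.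
Qed.

Section inequality.
Variables (q : R) (f d1 d2 : mplane R -> R[i]).
Hypotheses (q2 : 2 < q) (hf : sqint m2 D f) (hd1 : sqint m2 D d1) (hd2 : sqint m2 D d2).
Hypothesis fd1 : forall k,
  cmod (fourier d1 k) ^+ 2 = (omega L * k.1%:~R) ^+ 2 * cmod (fourier f k) ^+ 2.
Hypothesis fd2 : forall k,
  cmod (fourier d2 k) ^+ 2 = (omega L * k.2%:~R) ^+ 2 * cmod (fourier f k) ^+ 2.

(** The q-th power of the right-hand side of the theorem. The gradient enters only through the
    moduli of Fourier coefficients, so weak gradients on the torus and classical ones of test
    functions are treated alike. *)
Definition sobolev_bound : R :=
  (1 / (4 * pi)) `^ ((q - 2) / 2) * (q / 2) `^ (q / 2) * sqnorm D f *
  (sqnorm D d1 + sqnorm D d2) `^ ((q - 2) / 2).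

Lemma avg_partial_fourier_le K : uniq K -> 0 \notin K ->
  avg m2 D (fun z => cmod (partial_fourier K f z) `^ q) <=
  (L ^+ 2)^-1 * sobolev_bound.
Proof.
move=> Ku K0; have q2' := q2.
have he := @cbmeas_mode K; have ho := mode_orthonormal Ku.
have e1 (i : 'I_(size K)) z : cmod (mode i z) <= 1 by rewrite /mode cmod_ek.
set a := coef m2 D (@mode K) f.
have := hausdorff_young mD muD he ho e1 a (ltW q2).
rewrite /powavg => /le_trans; apply.
have n0 (i : 'I_(size K)) : nth 0 K i != 0 by apply: contraNneq K0 => <-; exact: mem_nth.
apply: le_trans (powsum_lattice_bound a q2 (nth_freq_inj Ku) _) _.
  by move=> i; exact: n0.
set s := (q - 2) / 2.
have s0 : 0 <= s by rewrite /s; lra.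
have A := bessel mD muD he ho hf; rewrite avg_sqnorm in A.
have L2 : 0 < L ^+ 2 by rewrite exprn_gt0.
have w0 := omega_neq0 L0.
(* Bessel's inequality for the two derivatives carries the factors L^-2 and omega^-2, whose product
   (4 pi^2)^-1 is free of L. *)
have B : \sum_(k < size K) ((nth 0 K k).1%:~R ^+ 2 + (nth 0 K k).2%:~R ^+ 2) * cmod (a k) ^+ 2
    <= (4 * pi ^+ 2)^-1 * (sqnorm D d1 + sqnorm D d2).
  have h1 := bessel mD muD he ho hd1; rewrite avg_sqnorm in h1.
  have h2 := bessel mD muD he ho hd2; rewrite avg_sqnorm in h2.
  have h3 : omega L ^+ 2 * \sum_(k < size K) ((nth 0 K k).1%:~R ^+ 2 + (nth 0 K k).2%:~R ^+ 2) * cmod (a k) ^+ 2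
      <= (L ^+ 2)^-1 * (sqnorm D d1 + sqnorm D d2).
    rewrite mulrDr; apply: le_trans (lerD h1 h2).
    rewrite -big_split mulr_sumr; apply: ler_sum => k _.
    change (omega L ^+ 2 * (((nth 0 K k).1%:~R ^+ 2 + (nth 0 K k).2%:~R ^+ 2) * cmod (a k) ^+ 2)
      <= cmod (coef m2 D (@mode K) d1 k) ^+ 2 + cmod (coef m2 D (@mode K) d2 k) ^+ 2).
    have cE g : coef m2 D (@mode K) g k = fourier g (nth 0 K k) by [].
    rewrite !cE fd1 fd2 {}/a cE -mulrDl mulrA.
    by rewrite mulrDr -!exprMn.
  have wE : omega L ^+ 2 = (4 * pi ^+ 2) * (L ^+ 2)^-1.
    by rewrite /omega expr_div_n; field; rewrite gt_eqF.
  move: h3; rewrite wE [X in X * _ <= _]mulrC -mulrA ler_pM2l ?invr_gt0//.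
  by move=> h; rewrite ler_pdivlMl// mulr_gt0// exprn_gt0// pi_gt0.
have Ed0 : 0 <= sqnorm D d1 + sqnorm D d2 by rewrite addr_ge0 ?sqnorm_ge0.
have P0 : 0 <= (4 * pi ^+ 2)^-1 :> R by rewrite invr_ge0 mulr_ge0// sqr_ge0.
apply: (@le_trans _ _ (pi `^ s * (q / 2) `^ (q / 2) * ((L ^+ 2)^-1 * sqnorm D f) *
   ((4 * pi ^+ 2)^-1 * (sqnorm D d1 + sqnorm D d2)) `^ s)).
  apply: ler_pM; rewrite ?powR_ge0//.
  - by rewrite mulr_ge0 ?mulr_ge0 ?powR_ge0// sumr_ge0// => k _; exact: sqr_ge0.
  - by rewrite ler_wpM2l// mulr_ge0 ?powR_ge0.
  - apply: ge0_ler_powR => //; rewrite nnegrE ?mulr_ge0//.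
    by apply: sumr_ge0 => k _; rewrite mulr_ge0 ?addr_ge0 ?sqr_ge0.
rewrite /sobolev_bound -/s; have -> : 1 / (4 * pi) = pi * (4 * pi ^+ 2)^-1 :> R.
  have pn : (pi : R) != 0 by rewrite gt_eqF// pi_gt0.
  by move: (pi : R) pn => p pn; field.
rewrite (powRM s (pi_ge0 R) P0) (powRM s P0 Ed0) le_eqVlt; apply/orP; left; apply/eqP.
move: (pi `^ s) (_^-1 `^ s) ((q / 2) `^ _) (L ^- 2) (_ `^ s) => x1 x2 x3 x4 x5; ring.
Qed.

(** A trigonometric polynomial close to f supplies a finite set of frequencies; the Fourier partial
    sum on that set is at least as close in L^2 and satisfies the bound for finite sums. Removing
    the zero mode from both sides leaves f minus its mean. *)
Lemma cell_inequality :
  (\int[m2]_(z in D) (cmod (f z - fourier f 0) `^ q)%:E <= sobolev_bound%:E)%E.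
Proof.
have q2' := q2.
have q0 : 0 <= q by lra.
have L2 : 0 < L ^+ 2 by rewrite exprn_gt0.
have [mr mi ii] := hf.
have mF : measurable_fun D (fun z => cmod (f z - fourier f 0)).
  by apply: measurable_cmod; [under eq_fun do rewrite ReD ReN|under eq_fun do rewrite ImD ImN];
    apply: measurable_funB.
apply: (Lq_bound_closed mD (_ : 1 < q) mF) => //; first by lra.
  by move=> z; exact: cmod_ge0.
move=> eps eps0; have [Q [tQ hQ]] := trigpoly_dense L0 hf eps0.
have [K [a [K1u K0 aQ]]] := trigpoly_span tQ.
have Ku : uniq (0 :: K) by rewrite /= K0.
exists (fun z => cmod (partial_fourier K f z)).
have cP : cbmeas (partial_fourier K f) by apply: cbmeas_synth; exact: cbmeas_mode.
have bP := bmeas_powR q0 (cbmeas_cmod cP) (fun z => cmod_ge0 _).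
split.
- by have [mG _] := cbmeas_cmod cP; exact: measurable_funTS.
- by move=> z; exact: cmod_ge0.
- apply: le_trans hQ.
  pose b i := a (nth 0 (0 :: K) i).
  have QE z : Q z = synth (@mode (0 :: K)) (fun i => b i) z by rewrite aQ -synth_modeE.
  have best := synth_coef_best mD muD (@cbmeas_mode (0 :: K)) (mode_orthonormal Ku) (fun i => b i) hf.
  have i1 := rint_sub_synth mD muD (@cbmeas_mode (0 :: K)) (coef m2 D (@mode (0 :: K)) f) hf.
  have i2 := rint_sub_synth mD muD (@cbmeas_mode (0 :: K)) (fun i => b i) hf.
  rewrite /avg ler_pM2l ?invr_gt0 ?[X in fine X]leb2_cell// in best.
  under [leRHS]eq_integral => z _ do rewrite QE.
  rewrite -[leRHS]fineK; last exact: integrable_fin_num.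
  apply: (@le_trans _ _ (fine (\int[m2]_(z in D)
      (cmod (f z - partial_fourier (0 :: K) f z) ^+ 2)%:E))%:E); last by rewrite lee_fin.
  rewrite fineK; last exact: integrable_fin_num.
  apply: ge0_le_integral => //.
  + by move=> z _; rewrite lee_fin sqr_ge0.
  + apply/measurable_EFinP; apply: measurable_funX; apply: measurable_funB => //.
    by have [mG _] := cbmeas_cmod cP; exact: measurable_funTS.
  + by have /measurable_int := i1.
  + move=> z _; rewrite lee_fin -[leLHS]real_normK ?num_real// lerXn2r ?nnegrE ?cmod_ge0//.
    rewrite (le_trans (ler_dist_cmod _ _))// !partial_fourierE big_cons ek0 mulr1.
    by rewrite opprD addrA.
- have := avg_partial_fourier_le K1u K0; rewrite /avg [X in fine X](leb2_cell c L0).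
  rewrite ler_pM2l ?invr_gt0// => h.
  have iP : rint m2 D (fun z => cmod (partial_fourier K f z) `^ q) by exact: bmeas_rint.
  rewrite -[leLHS]fineK; last exact: integrable_fin_num.
  by rewrite lee_fin (le_trans h)// lerDl ltW.
Qed.

End inequality.
End cell_inequality.

(** * From integrals of powers to norms *)

Section Lq_norms.
Variables (R : realType) (D : set (mplane R)).
Hypothesis mD : measurable D.
Notation m2 := (leb2 R).

Lemma normL_powR (q : R) (g : mplane R -> R) : q != 0 -> (forall z, 0 <= g z) ->
  (normL D q g `^ q = \int[m2]_(z in D) (g z `^ q)%:E)%E.
Proof.
move=> q0 g0; rewrite /normL; apply: (etrans (poweR_Lnorm m2 _ q0)); rewrite [RHS]integral_mkcond.
apply: eq_integral => z _ /=; rewrite patchE indicE.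
case: ifPn => zD; first by rewrite mulr1 ger0_norm.
by rewrite mulr0 normr0 powR0.
Qed.

Lemma normLE (q I : R) (g : mplane R -> R) : q != 0 -> (forall z, 0 <= g z) ->
  (\int[m2]_(z in D) (g z `^ q)%:E = I%:E)%E -> normL D q g = (I `^ q^-1)%:E.
Proof.
move=> q0 g0; rewrite -normL_powR// => E.
by rewrite -poweR_EFin -E -poweRrM mulfV// poweRe1// Lnorm_ge0.
Qed.

Lemma normL2_sqnorm f : sqint m2 D f ->
  normL D 2 (cmod \o f) = (sqnorm D f `^ 2^-1)%:E.
Proof.
move=> [_ _ hi]; apply: normLE => [|z|]; first by rewrite pnatr_eq0.
  exact: cmod_ge0.
rewrite /sqnorm /Rintegral fineK; last exact: integrable_fin_num.
by apply: eq_integral => z _; rewrite /= -powR_mulrn ?cmod_ge0.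
Qed.

Lemma sqint_L2 f : L2 D f -> sqint m2 D f.
Proof.
move=> [mr mi fi]; split => //; rewrite /rint.
have mc := measurable_cmod mr mi.
apply/integrableP; split; first by apply/measurable_EFinP; exact: measurable_funX.
have n2 : (2 : R) != 0 by rewrite pnatr_eq0.
have := normL_powR n2 (fun z => cmod_ge0 (f z)).
have := poweR_lty 2 fi => /[swap]; rewrite /comp => ->.
congr (_ < _)%E; apply: eq_integral => z _.
by rewrite /= ger0_norm ?sqr_ge0// powR_mulrn ?cmod_ge0.
Qed.

Lemma sqnorm_grad (df : mplane R -> R[i] * R[i]) :
  sqint m2 D (fst \o df) -> sqint m2 D (snd \o df) ->
  normL D 2 (cmod2 \o df) =
  ((sqnorm D (fst \o df) + sqnorm D (snd \o df)) `^ 2^-1)%:E.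
Proof.
move=> [_ _ h1] [_ _ h2]; apply: normLE => [|z|]; first by rewrite pnatr_eq0.
  exact: sqrtr_ge0.
have h12 := integrableD mD h1 h2.
rewrite /sqnorm -RintegralD// /Rintegral fineK; last exact: integrable_fin_num.
apply: eq_integral => z _; rewrite /= powR_mulrn ?sqrtr_ge0// sqr_sqrtr//.
by rewrite addr_ge0 ?sqr_ge0.
Qed.

Lemma Lq_interpolation_normL (q : R) f df : 2 <= q ->
  L2 D f -> L2 D (fst \o df) -> L2 D (snd \o df) ->
  (2 < q -> (\int[m2]_(z in D) (cmod (f z) `^ q)%:E <=
    ((1 / (4 * pi)) `^ ((q - 2) / 2) * (q / 2) `^ (q / 2) * sqnorm D f *
     (sqnorm D (fst \o df) + sqnorm D (snd \o df)) `^ ((q - 2) / 2))%:E)%E) ->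
  (normL D q (cmod \o f)
      <= (((1 / (4 * pi)) `^ ((q - 2) / (2 * q)) * (q / 2) `^ (1 / 2))%R)%:E
         * normL D 2 (cmod \o f) `^ (2 / q)
         * normL D 2 (cmod2 \o df) `^ (1 - 2 / q))%E.
Proof.
move=> q2 /sqint_L2 hf /sqint_L2 h1 /sqint_L2 h2.
rewrite normL2_sqnorm// sqnorm_grad// !poweR_EFin -!EFinM.
set A := sqnorm D f; set B := sqnorm D _ + sqnorm D _.
have A0 : 0 <= A by exact: sqnorm_ge0.
have B0 : 0 <= B by rewrite addr_ge0// sqnorm_ge0.
(* At q = 2 both sides are the L^2 norm of f: the gradient appears to the power 0, which is 1 even
   if the gradient vanishes. *)
move: q2; rewrite le_eqVlt => /orP[/eqP <- _|q2 /(_ q2) hq].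
  rewrite normL2_sqnorm// -/A divff ?pnatr_eq0// subrr mul0r powRr0 powR1 subrr powRr0.
  by rewrite powRr1 ?powR_ge0// !mul1r mulr1.
have q0 : 0 < q by lra.
have qn : q != 0 by rewrite gt_eqF.
have := hq; set C := (X in (_ <= X%:E)%E) => hC.
have C0 : 0 <= C by rewrite !mulr_ge0 ?powR_ge0.
have I0 : (0 <= \int[m2]_(z in D) (cmod (f z) `^ q)%:E)%E.
  by apply: integral_ge0 => z _; rewrite lee_fin powR_ge0.
have Ifin : (\int[m2]_(z in D) (cmod (f z) `^ q)%:E)%E \is a fin_num.
  by rewrite ge0_fin_numE// (le_lt_trans hC)// ltry.
have cm0 z : 0 <= (cmod \o f) z by exact: cmod_ge0.
rewrite (normLE qn cm0 (esym (fineK Ifin))) lee_fin.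
apply: (@le_trans _ _ (C `^ q^-1)).
  apply: ge0_ler_powR; rewrite ?nnegrE ?invr_ge0 ?fine_ge0 ?(ltW q0)//.
  by rewrite -lee_fin fineK.
have K0 : 0 <= 1 / (4 * pi) :> R by rewrite mul1r invr_ge0 mulr_ge0// pi_ge0.
have p2 : 0 <= q / 2 by rewrite divr_ge0// ltW.
rewrite /C; set s := (q - 2) / 2.
have a0 := powR_ge0 (1 / (4 * pi)) s.
have b0 := powR_ge0 (q / 2) (q / 2).
rewrite (powRM _ (mulr_ge0 (mulr_ge0 a0 b0) A0) (powR_ge0 B s)).
rewrite (powRM _ (mulr_ge0 a0 b0) A0) (powRM _ a0 b0) -!powRrM.
have -> : s * q^-1 = (q - 2) / (2 * q) by rewrite ?/s; field.
have -> : q / 2 * q^-1 = 1 / 2 by field.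
have -> : 2^-1 * (2 / q) = q^-1 by field.
have -> : 2^-1 * (1 - 2 / q) = (q - 2) / (2 * q) by field.
by [].
Qed.

End Lq_norms.

(** * The torus *)

Section directional.
Variable R : realType.

Lemma is_derive_along (f : R * R -> R) (x v : R * R) (l : R) :
  is_derive (0 : R) 1 (fun t : R => f (t *: v + x)) l <-> is_derive x v f l.
Proof.
have E : (fun h : R => h^-1 *: (((fun t : R => f (t *: v + x)) \o shift 0) (h *: 1) -
            f (0 *: v + x))) =
         (fun h : R => h^-1 *: ((f \o shift x) (h *: v) - f x)).
  by apply/funext => h /=; rewrite addr0 scale0r add0r [h *: 1]mulr1.
split=> -[h1 h2]; split.
- by rewrite /derivable -E.
- by rewrite /derive -E.
- by rewrite /derivable E.
- by rewrite /derive E.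
Qed.

(** A family closed under directional derivatives that contains the real and imaginary parts of the
    exponentials, so that their smoothness follows by induction on the order. *)
Definition trig_phase (a b w : R) (k : R * R) (z : R * R) : R :=
  a * cos (w * (k.1 * z.1 + k.2 * z.2)) + b * sin (w * (k.1 * z.1 + k.2 * z.2)).

Lemma is_derive_trig_phase a b w k v z :
  is_derive z v (trig_phase a b w k)
    (trig_phase (w * (k.1 * v.1 + k.2 * v.2) * b)
       (- (w * (k.1 * v.1 + k.2 * v.2) * a)) w k z).
Proof.
apply/is_derive_along; rewrite /trig_phase /=.
have -> : (fun t : R => a * cos (w * (k.1 * (t *: v.1 + z.1) + k.2 * (t *: v.2 + z.2))) +
     b * sin (w * (k.1 * (t *: v.1 + z.1) + k.2 * (t *: v.2 + z.2)))) =
   (fun t : R => a * cos (w * (k.1 * v.1 + k.2 * v.2) * t + w * (k.1 * z.1 + k.2 * z.2)) +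
     b * sin (w * (k.1 * v.1 + k.2 * v.2) * t + w * (k.1 * z.1 + k.2 * z.2))).
  by apply/funext => t; rewrite /GRing.scale/=; congr (_ * cos _ + _ * sin _); ring.
apply: is_derive_eq.
by rewrite /GRing.scale/= !mulr0 !add0r; ring.
Qed.

Lemma continuous_trig_phase a b w k : continuous (trig_phase a b w k).
Proof.
move=> z; rewrite /trig_phase.
have hc : (fun z : R * R => w * (k.1 * z.1 + k.2 * z.2)) @ z --> w * (k.1 * z.1 + k.2 * z.2).
  apply: cvgM; first exact: cvg_cst.
  by apply: cvgD; apply: cvgM; [exact: cvg_cst|exact: cvg_fst|exact: cvg_cst|exact: cvg_snd].
apply: cvgD; apply: cvgM; try exact: cvg_cst.
- exact: (continuous_comp hc (@continuous_cos R _)).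
- exact: (continuous_comp hc (@continuous_sin R _)).
Qed.

Lemma derive_trig_phase a b w k v z :
  'D_v (trig_phase a b w k) z =
    trig_phase (w * (k.1 * v.1 + k.2 * v.2) * b) (- (w * (k.1 * v.1 + k.2 * v.2) * a)) w k z.
Proof. by have [_] := is_derive_trig_phase a b w k v z. Qed.

Lemma Ck_trig_phase n a b w k : Ck n (trig_phase a b w k).
Proof.
elim: n a b => [|n ih] a b /=; split => //; first exact: continuous_trig_phase.
  exact: continuous_trig_phase.
split.
- by move=> x; have [] := is_derive_trig_phase a b w k (e1 R) x.
- by move=> x; have [] := is_derive_trig_phase a b w k (e2 R) x.
- by rewrite (funext (derive_trig_phase a b w k (e1 R))).
- by rewrite (funext (derive_trig_phase a b w k (e2 R))).
Qed.

End directional.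

Section exponentials.
Variables (R : realType) (L : R).

Lemma ReF_ek k : ReF (ek L k) =
  trig_phase 1 0 (omega L) (k.1%:~R, k.2%:~R) :> (R * R -> R).
Proof. by apply/funext => z; rewrite /ReF /ek /trig_phase /=; ring. Qed.

Lemma ImF_ek k : ImF (ek L k) =
  trig_phase 0 1 (omega L) (k.1%:~R, k.2%:~R) :> (R * R -> R).
Proof. by apply/funext => z; rewrite /ImF /ek /trig_phase /=; ring. Qed.

Lemma Cinfty_ek k : Cinfty (ek L k).
Proof. by move=> n; rewrite ReF_ek ImF_ek; split; exact: Ck_trig_phase. Qed.

Lemma cpartial_ek v k z : cpartial v (ek L k) z =
  Complex 0 (omega L * (k.1%:~R * v.1 + k.2%:~R * v.2)) * ek L k z.
Proof.
rewrite /cpartial ReF_ek ImF_ek !derive_trig_phase /ek /trig_phase /=.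
by simpc; congr Complex; ring.
Qed.

Lemma cpartial1_ek k z :
  cpartial (e1 R) (ek L k) z = Complex 0 (omega L * k.1%:~R) * ek L k z.
Proof. by rewrite cpartial_ek /= mulr1 mulr0 addr0. Qed.

Lemma cpartial2_ek k z :
  cpartial (e2 R) (ek L k) z = Complex 0 (omega L * k.2%:~R) * ek L k z.
Proof. by rewrite cpartial_ek /= mulr1 mulr0 add0r. Qed.

Section weak.
Variable c : R.
Hypothesis L0 : 0 < L.
Notation D := (cell c L).
Notation m2 := (leb2 R).

Lemma cavg_cintegral f : cavg m2 D f = Complex (L ^+ 2)^-1 0 * cintegral D f.
Proof. by rewrite /cavg /avg /= [X in fine X](leb2_cell c L0) /cintegral; simpc. Qed.

(** The test function is e_(-k), the conjugate of e_k, so both sides of the weak identity are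
    Fourier coefficients up to the factor - i t, of which only the modulus is kept. *)
Lemma fourier_weak_derivative f d k v (t : R) : sqint m2 D f ->
  cpartial v (ek L (- k)) = (fun z => Complex 0 (- t) * ek L (- k) z) ->
  cintegral D (fun z => f z * cpartial v (ek L (- k)) z) =
    - cintegral D (fun z => d z * ek L (- k) z) ->
  cmod (fourier c L d k) ^+ 2 = t ^+ 2 * cmod (fourier c L f k) ^+ 2.
Proof.
move=> hf -> h; have mD := measurable_cell c L; have muD := leb2_cell_fin c L0.
rewrite /fourier.
under [in LHS]eq_fun do rewrite ek_conj.
under [in RHS]eq_fun do rewrite ek_conj.
rewrite [in LHS]cavg_cintegral -[cintegral _ _]opprK -h mulrN cmodN -cavg_cintegral.
have -> : (fun z => f z * (Complex 0 (- t) * ek L (- k) z)) =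
    (fun z => Complex 0 (- t) * (f z * ek L (- k) z)) by apply/funext => z; ring.
rewrite cavgZ//; last first.
  under eq_fun do rewrite mulrC.
  by apply: cbmeas_mul_crint => //; [exact: cbmeas_ek|exact: sqint_crint].
have tE : cmod (Complex 0 (- t)) ^+ 2 = t ^+ 2 by rewrite cmod_sqr /=; ring.
by rewrite cmodM exprMn tE.
Qed.

End weak.
End exponentials.

Section torus.
Variable R : realType.

Lemma T2_cell : T2 R = cell 0 (2 * pi).
Proof. by rewrite /T2 /cell /cellI add0r. Qed.

Lemma omega_2pi : omega (2 * pi) = 1 :> R.
Proof. by rewrite /omega divff// mulf_neq0// gt_eqF// pi_gt0. Qed.

Lemma Cinfty_T2_ek k : Cinfty_T2 (ek (2 * pi : R) k).
Proof.
split; first exact: Cinfty_ek.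
have period (x y s : R) (n : int) : x + n%:~R * (2 * pi) = y -> cis x = cis y.
  by move=> <-; rewrite /cis cosDz2pi sinDz2pi.
split=> z; rewrite /ek omega_2pi !mul1r /=.
  by symmetry; apply: (period _ _ 0 k.1); rewrite /=; ring.
by symmetry; apply: (period _ _ 0 k.2); rewrite /=; ring.
Qed.

Lemma torus_inequality (phi : R * R -> R[i]) (dphi : R * R -> R[i] * R[i]) (q : R) :
  H1dot_T2 phi dphi -> 2 <= q ->
  (normL (T2 R) q (cmod \o phi)
      <= (((1 / (4 * pi)) `^ ((q - 2) / (2 * q)) * (q / 2) `^ (1 / 2))%R)%:E
         * normL (T2 R) 2 (cmod \o phi) `^ (2 / q)
         * normL (T2 R) 2 (cmod2 \o dphi) `^ (1 - 2 / q))%E.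
Proof.
rewrite /H1dot_T2 T2_cell => -[_ _ [hf h1 h2 weak] mean0] q2.
have L0 : 0 < 2 * pi :> R by rewrite mulr_gt0// pi_gt0.
have mD := measurable_cell (0 : R) (2 * pi).
apply: Lq_interpolation_normL => // {}q2.
have sf := sqint_L2 hf; have s1 := sqint_L2 h1; have s2 := sqint_L2 h2.
have f0 : fourier 0 (2 * pi) phi 0 = 0.
  rewrite /fourier; under eq_fun do rewrite ek_conj oppr0 ek0 mulr1.
  by rewrite cavg_cintegral// mean0 mulr0.
have := @cell_inequality R 0 (2 * pi) L0 q phi (fst \o dphi) (snd \o dphi) q2 sf s1 s2.
rewrite f0 /sobolev_bound.
under eq_integral do rewrite subr0.
apply=> k; have [w1 w2] := weak _ (Cinfty_T2_ek (- k)).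
- apply: (fourier_weak_derivative L0 sf _ w1); apply/funext => z.
  by rewrite cpartial1_ek /= rmorphN/= mulrN.
- apply: (fourier_weak_derivative L0 sf _ w2); apply/funext => z.
  by rewrite cpartial2_ek /= rmorphN/= mulrN.
Qed.

End torus.

(** * Domains of the plane *)

Section plane_topology.
Variable R : realType.

Lemma open_measurable_plane (U : set (R * R)) : open U -> measurable (U : set (mplane R)).
Proof.
move=> oU.
pose box (r : rat * rat * (rat * rat)) : set (mplane R) :=
  `]ratr r.1.1, ratr r.1.2[ `*` `]ratr r.2.1, ratr r.2.2[.
(* The second set is everything or empty according to whether the box lies in U; this selects the
   contained boxes within one countable union. *)
have -> : (U : set (mplane R)) =
    \bigcup_r (box r `&` [set z | box r `<=` U]).
  apply/seteqP; split=> [z Uz|z [r _ [bz sub]]]; last exact: sub.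
  have [e e0 ez] : exists2 e : R, 0 < e & ball z e `<=` U.
    by move: oU; rewrite openE => /(_ z Uz) /nbhs_ballP[e]; exists e.
  have near_rat (x : R) : exists p, [/\ x - e < ratr p.1 & ratr p.1 < x] /\
      [/\ x < ratr p.2 & ratr p.2 < x + e] :> Prop.
    have [|p1] := @rat_in_itvoo R (x - e) x; first by rewrite ltrBlDr ltrDl.
    have [|p2] := @rat_in_itvoo R x (x + e); first by rewrite ltrDl.
    by rewrite !in_itv/= => /andP[? ?] /andP[? ?]; exists (p1, p2).
  have [p [[p1 p2] [p3 p4]]] := near_rat z.1.
  have [r [[r1 r2] [r3 r4]]] := near_rat z.2.
  exists (p, r) => //; split; first by split; rewrite /= in_itv/=; apply/andP.
  move=> w [/=]; rewrite !in_itv/= => /andP[w1 w2] /andP[w3 w4].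
  apply: ez; split; rewrite /ball/= ltr_norml; apply/andP; split; lra.
apply: countable_bigcupT_measurable; first exact: countableP.
move=> r; have [sub|nsub] := pselect (box r `<=` U).
  rewrite (_ : [set z | _] = setT) ?setIT; last by apply/seteqP; split.
  by apply: measurableX; exact: measurable_itv.
by rewrite (_ : [set z | _] = set0) ?setI0//; apply/seteqP; split.
Qed.

Lemma continuous_measurable_plane (f : R * R -> R) : continuous f ->
  measurable_fun setT (f : mplane R -> R).
Proof.
move=> cf; apply: (measurability _ (RGenOInfty.measurableE R)) => //.
move=> /= _ [_ [x ->] <-]; rewrite setTI; apply: open_measurable_plane.
by move/continuousP: cf; apply; exact: interval_open.
Qed.

Lemma compact_support_bmeas (f : R * R -> R) (S : set (R * R)) :
  continuous f -> compact S -> (forall z, ~ S z -> f z = 0) ->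
  bmeas (f : mplane R -> R).
Proof.
move=> cf cS f0; split; first exact: continuous_measurable_plane.
have : bounded_set (f @` S).
  by apply: compact_bounded; apply: continuous_compact => //; exact: continuous_subspaceT.
move=> [M [_ HM]]; exists (`|M| + 1) => z.
have [Sz|/f0 ->] := pselect (S z); last by rewrite normr0 addr_ge0.
by apply: HM; [rewrite ltr_pwDr// ler_norm|exists z].
Qed.

Lemma compact_in_cell (S : set (R * R)) : compact S ->
  exists2 M : R, 0 < M & forall z, S z -> `|z.1| < M /\ `|z.2| < M.
Proof.
move=> /compact_bounded[M [_ HM]]; exists (`|M| + 2); first by rewrite ltr_wpDl.
move=> z Sz; have : `|z| <= `|M| + 1.
  by apply: HM => //; rewrite ltr_pwDr// ler_norm.
rewrite prod_normE ge_max => /andP[z1 z2]; split; lra.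
Qed.

End plane_topology.

(** * Integration by parts against exponentials *)

Section slices.
Variable R : realType.
Implicit Types (G g : R * R -> R) (z : R * R).

Lemma is_derive_slice1 G z l :
  is_derive z (e1 R) G l -> is_derive z.1 1 (fun x => G (x, z.2)) l.
Proof.
have E : (fun h : R => h^-1 *: ((G \o shift z) (h *: e1 R) - G z)) =
    (fun h : R => h^-1 *: (((fun x => G (x, z.2)) \o shift z.1) (h *: 1) - G (z.1, z.2))).
  apply/funext => h; rewrite /= -surjective_pairing; congr (_ *: (G _ - _)).
  by congr pair; rewrite /= [h *: 0]mulr0 add0r.
by move=> [h1 h2]; split; [rewrite /derivable -E|rewrite /derive -E].
Qed.

Lemma is_derive_slice2 G z l :
  is_derive z (e2 R) G l -> is_derive z.2 1 (fun y => G (z.1, y)) l.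
Proof.
have E : (fun h : R => h^-1 *: ((G \o shift z) (h *: e2 R) - G z)) =
    (fun h : R => h^-1 *: (((fun y => G (z.1, y)) \o shift z.2) (h *: 1) - G (z.1, z.2))).
  apply/funext => h; rewrite /= -surjective_pairing; congr (_ *: (G _ - _)).
  by congr pair; rewrite /= [h *: 0]mulr0 add0r.
by move=> [h1 h2]; split; [rewrite /derivable -E|rewrite /derive -E].
Qed.

Lemma continuous_slice1 g y : continuous g -> continuous (fun x => g (x, y)).
Proof.
move=> cg x; have hp : (fun x : R => (x, y)) @ x --> (x, y).
  exact: (@cvg_pair _ _ _ (nbhs x) (nbhs x) (nbhs y) _ _ _ (fun t : R => t) (fun=> y)
    cvg_id (cvg_cst y)).
exact: (continuous_comp hp (cg _)).
Qed.

Lemma continuous_slice2 g x : continuous g -> continuous (fun y => g (x, y)).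
Proof.
move=> cg y; have hp : (fun y : R => (x, y)) @ y --> (x, y).
  exact: (@cvg_pair _ _ _ (nbhs y) (nbhs x) (nbhs y) _ _ _ (fun=> x) (fun t : R => t)
    (cvg_cst x) cvg_id).
exact: (continuous_comp hp (cg _)).
Qed.

Variables (c L : R).
Hypothesis L0 : 0 < L.
Notation D := (cell c L).
Notation m2 := (leb2 R).

Lemma integral_cell_derive1 G g : (forall z, is_derive z (e1 R) G (g z)) ->
  continuous g -> bmeas (g : mplane R -> R) ->
  (forall y, G (c, y) = 0) -> (forall y, G (c + L, y) = 0) ->
  \int[m2]_(z in D) g z = 0.
Proof.
move=> dG cg bg G0 G1; have cL : c < c + L by have L0' := L0; lra.
have gi := bmeas_rint (measurable_cell c L) (leb2_cell_fin c L0) bg.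
have E : \int[m2]_(z in D) g (z.1, z.2) = \int[lebesgue_measure]_(y in cellI c L)
     \int[lebesgue_measure]_(x in cellI c L) g (x, y).
  apply: (@leb2_fubini_swap R (cellI c L) (cellI c L) (fun x y => g (x, y))).
  - exact: measurable_itv.
  - exact: measurable_itv.
  - by under eq_fun do rewrite -surjective_pairing.
  - by move=> y _; apply: integrable_itv_continuous => x _; exact: continuous_slice1.
apply: (etrans (y := \int[m2]_(z in D) g (z.1, z.2))).
  by apply: eq_Rintegral => z _; rewrite -surjective_pairing.
apply: (etrans E); apply: (etrans (y := \int[lebesgue_measure]_(y in cellI c L) 0)).
  apply: eq_Rintegral => y _; rewrite /Rintegral.
  have I : (\int[lebesgue_measure]_(x in cellI c L) (g (x, y))%:E = (G (c + L, y) - G (c, y))%:E)%E.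
    apply: (@integral_derive_itv R (fun x => g (x, y)) (fun x => G (x, y)) _ _ cL) => x _.
    - exact: (@is_derive_slice1 G (x, y)).
    - exact: continuous_slice1.
  by rewrite [X in fine X]I G0 G1 subrr.
by rewrite /Rintegral integral0.
Qed.

Lemma integral_cell_derive2 G g : (forall z, is_derive z (e2 R) G (g z)) ->
  continuous g -> bmeas (g : mplane R -> R) ->
  (forall x, G (x, c) = 0) -> (forall x, G (x, c + L) = 0) ->
  \int[m2]_(z in D) g z = 0.
Proof.
move=> dG cg bg G0 G1; have cL : c < c + L by have L0' := L0; lra.
have gi := bmeas_rint (measurable_cell c L) (leb2_cell_fin c L0) bg.
have E : \int[m2]_(z in D) g (z.1, z.2) = \int[lebesgue_measure]_(x in cellI c L)
     \int[lebesgue_measure]_(y in cellI c L) g (x, y).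
  apply: (@leb2_fubini R (cellI c L) (cellI c L) (fun x y => g (x, y))).
  - exact: measurable_itv.
  - exact: measurable_itv.
  - by under eq_fun do rewrite -surjective_pairing.
  - by move=> x _; apply: integrable_itv_continuous => y _; exact: continuous_slice2.
apply: (etrans (y := \int[m2]_(z in D) g (z.1, z.2))).
  by apply: eq_Rintegral => z _; rewrite -surjective_pairing.
apply: (etrans E); apply: (etrans (y := \int[lebesgue_measure]_(x in cellI c L) 0)).
  apply: eq_Rintegral => x _; rewrite /Rintegral.
  have I : (\int[lebesgue_measure]_(y in cellI c L) (g (x, y))%:E = (G (x, c + L) - G (x, c))%:E)%E.
    apply: (@integral_derive_itv R (fun y => g (x, y)) (fun y => G (x, y)) _ _ cL) => y _.
    - exact: (@is_derive_slice2 G (x, y)).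
    - exact: continuous_slice2.
  by rewrite [X in fine X]I G0 G1 subrr.
by rewrite /Rintegral integral0.
Qed.

End slices.

Section test_functions.
Variable R : realType.

Definition C1_supported (S : set (R * R)) (f : R * R -> R) :=
  Ck 1 f /\ forall z, ~ S z -> f z = 0.

Lemma C1_supported_derive (S : set (R * R)) f v : compact S -> closed S -> C1_supported S f ->
  v = e1 R \/ v = e2 R ->
  [/\ forall z, is_derive z v f ('D_v f z), continuous (fun z => 'D_v f z),
      bmeas (fun z : mplane R => 'D_v f z) & forall z, ~ S z -> 'D_v f z = 0].
Proof.
move=> cS clS [[cf [d1 d2 [c1 _] [c2 _]]] f0] hv.
have dv z : is_derive z v f ('D_v f z).
  by split => //; case: hv => ->; [exact: d1|exact: d2].
have cv : continuous (fun z => 'D_v f z) by case: hv => ->; [exact: c1|exact: c2].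
have v0 z : ~ S z -> 'D_v f z = 0.
  move=> Sz; have nz : \near z, (cst 0 : R * R -> R) z = f z.
    have : open (~` S) by exact: closed_openC.
    rewrite openE => /(_ z Sz); apply: filterS => w Sw.
    by rewrite f0.
  have [_] := near_eq_is_derive nz (is_derive_cst (0 : R) z v).
  by [].
by split => //; exact: (compact_support_bmeas cv cS v0).
Qed.

Section supported.
Variables (S : set (R * R)) (psi : R * R -> R[i]).
Hypotheses (cS : compact S) (clS : closed S).
Hypotheses (sRe : C1_supported S (ReF psi)) (sIm : C1_supported S (ImF psi)).

Lemma supported0 z : ~ S z -> psi z = 0.
Proof.
move=> Sz; have := sRe.2 z Sz; have := sIm.2 z Sz.
by rewrite /ReF /ImF; case: (psi z) => a b /= -> ->.
Qed.

Lemma cbmeas_supported : cbmeas (psi : mplane R -> R[i]).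
Proof.
by split; apply: (compact_support_bmeas _ cS); [case: sRe => -[]|exact: sRe.2|case: sIm => -[]|exact: sIm.2].
Qed.

Variable v : R * R.
Hypothesis hv : v = e1 R \/ v = e2 R.

Lemma cbmeas_cpartial_supported : cbmeas (cpartial v psi : mplane R -> R[i]).
Proof.
have [_ _ bR _] := C1_supported_derive cS clS sRe hv.
by have [_ _ bI _] := C1_supported_derive cS clS sIm hv.
Qed.

Lemma cpartial_supported0 z : ~ S z -> cpartial v psi z = 0.
Proof.
have [_ _ _ hR] := C1_supported_derive cS clS sRe hv.
have [_ _ _ hI] := C1_supported_derive cS clS sIm hv.
by move=> Sz; rewrite /cpartial (hR _ Sz) (hI _ Sz).
Qed.

Variables (c L : R).
Hypothesis L0 : 0 < L.
Notation D := (cell c L).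
Notation m2 := (leb2 R).
Hypothesis Scell : S `<=` open_cell c L.

Lemma integral_cell_derive (G g : R * R -> R) : (forall z, is_derive z v G (g z)) ->
  continuous g -> bmeas (g : mplane R -> R) -> (forall z, ~ S z -> G z = 0) ->
  \int[m2]_(z in D) g z = 0.
Proof.
move=> dG cg bg G0.
have out z : z.1 = c \/ z.1 = c + L \/ z.2 = c \/ z.2 = c + L -> G z = 0.
  move=> hz; apply: G0 => /Scell[/=]; rewrite !in_itv/= => /andP[h1 h2] /andP[h3 h4].
  by case: hz => [|[|[|]]] E; rewrite E ltxx in h1 h2 h3 h4.
case: hv dG => -> dG.
- by apply: (integral_cell_derive1 L0 dG cg bg) => y; apply: out; [left|right; left].
- by apply: (integral_cell_derive2 L0 dG cg bg) => y; apply: out; right; right; [left|right].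
Qed.

Lemma is_derive_mul_Re (f g : R * R -> R[i]) z a a' b b' :
  is_derive z v (ReF f) a -> is_derive z v (ImF f) a' ->
  is_derive z v (ReF g) b -> is_derive z v (ImF g) b' ->
  is_derive z v (ReF (fun w => f w * g w)) (complex.Re (Complex a a' * g z + f z * Complex b b')).
Proof.
move=> da da' db db'.
have := is_deriveB (is_deriveM da db) (is_deriveM da' db').
have -> : (ReF f * ReF g - ImF f * ImF g : R * R -> R) = ReF (fun w => f w * g w).
  by apply/funext => w; rewrite /ReF ReM.
move=> h; apply: (is_derive_eq h); rewrite /GRing.scale/=.
by rewrite /ReF /ImF; case: (f z) => x y; case: (g z) => x' y' /=; ring.
Qed.

Lemma is_derive_mul_Im (f g : R * R -> R[i]) z a a' b b' :
  is_derive z v (ReF f) a -> is_derive z v (ImF f) a' ->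
  is_derive z v (ReF g) b -> is_derive z v (ImF g) b' ->
  is_derive z v (ImF (fun w => f w * g w)) (complex.Im (Complex a a' * g z + f z * Complex b b')).
Proof.
move=> da da' db db'.
have := is_deriveD (is_deriveM da db') (is_deriveM da' db).
have -> : (ReF f * ImF g + ImF f * ReF g : R * R -> R) = ImF (fun w => f w * g w).
  by apply/funext => w; rewrite /ImF ImM.
move=> h; apply: (is_derive_eq h); rewrite /GRing.scale/=.
by rewrite /ReF /ImF; case: (f z) => x y; case: (g z) => x' y' /=; ring.
Qed.

(** The product of psi and e_k vanishes on the boundary of the cell because psi does, so its
    derivative has integral zero. This gives the weak identity although the exponentials do not have
    compact support. *)
Lemma integration_by_parts_ek k :
  cintegral D (fun z => psi z * cpartial v (ek L k) z) =
    - cintegral D (fun z => cpartial v psi z * ek L k z).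
Proof.
have mD := measurable_cell c L; have muD := leb2_cell_fin c L0.
have [dR cR bR _] := C1_supported_derive cS clS sRe hv.
have [dI cI bI _] := C1_supported_derive cS clS sIm hv.
have [cRe _] := sRe.1; have [cIm _] := sIm.1.
have dek z : is_derive z v (ReF (ek L k)) ('D_v (ReF (ek L k)) z).
  by rewrite ReF_ek derive_trig_phase; exact: is_derive_trig_phase.
have dek' z : is_derive z v (ImF (ek L k)) ('D_v (ImF (ek L k)) z).
  by rewrite ImF_ek derive_trig_phase; exact: is_derive_trig_phase.
have b1 : cbmeas (fun z : mplane R => psi z * cpartial v (ek L k) z).
  apply: cbmeasM; first exact: cbmeas_supported.
  rewrite (funext (cpartial_ek L v k)).
  by apply: cbmeasM; [exact: cbmeas_cst|exact: cbmeas_ek].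
have b2 : cbmeas (fun z : mplane R => cpartial v psi z * ek L k z).
  by apply: cbmeasM; [exact: cbmeas_cpartial_supported|exact: cbmeas_ek].
have [bp1 bp2] := cbmeasD b2 b1.
have off z : ~ S z -> psi z * ek L k z = 0 by move=> /supported0 ->; rewrite mul0r.
have ct : continuous (ReF (ek L k)) /\ continuous (ImF (ek L k)).
  by rewrite ReF_ek ImF_ek; split; exact: continuous_trig_phase.
have ct' : continuous (fun z => 'D_v (ReF (ek L k)) z) /\ continuous (fun z => 'D_v (ImF (ek L k)) z).
  rewrite ReF_ek ImF_ek; split.
    by rewrite (funext (derive_trig_phase _ _ _ _ v)); exact: continuous_trig_phase.
  by rewrite (funext (derive_trig_phase _ _ _ _ v)); exact: continuous_trig_phase.
have [ct1 ct2] := ct; have [ct3 ct4] := ct'.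
have IR : \int[m2]_(z in D) complex.Re (cpartial v psi z * ek L k z + psi z * cpartial v (ek L k) z) = 0.
  apply: (integral_cell_derive (G := ReF (fun w => psi w * ek L k w))) => //.
  - by move=> z; exact: is_derive_mul_Re.
  - under eq_fun do rewrite ReD !ReM.
    by move=> z; apply: cvgD; apply: cvgB; apply: cvgM;
      [exact: cR|exact: ct1|exact: cI|exact: ct2|exact: cRe|exact: ct3|exact: cIm|exact: ct4].
  - by move=> z Sz; rewrite /ReF off.
have II : \int[m2]_(z in D) complex.Im (cpartial v psi z * ek L k z + psi z * cpartial v (ek L k) z) = 0.
  apply: (integral_cell_derive (G := ImF (fun w => psi w * ek L k w))) => //.
  - by move=> z; exact: is_derive_mul_Im.
  - under eq_fun do rewrite ImD !ImM.
    by move=> z; apply: cvgD; apply: cvgD; apply: cvgM;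
      [exact: cR|exact: ct2|exact: cI|exact: ct1|exact: cRe|exact: ct4|exact: cIm|exact: ct3].
  - by move=> z Sz; rewrite /ImF off.
have C0 : cavg m2 D (fun z => cpartial v psi z * ek L k z + psi z * cpartial v (ek L k) z) = 0.
  by rewrite /cavg /avg IR II !mulr0.
have := cavgD mD (cbmeas_crint mD muD b2) (cbmeas_crint mD muD b1).
rewrite C0 !cavg_cintegral// -mulrDr => /esym/eqP.
rewrite mulf_eq0 => /orP[|/eqP h].
  rewrite eq_complex /= invr_eq0 expf_eq0 /= => /andP[/eqP L00 _].
  by move: L0; rewrite L00 ltxx.
by apply/eqP; rewrite -addr_eq0 addrC h.
Qed.

End supported.
End test_functions.

(** * The inequality for test functions *)

Section compact_support.
Variable R : realType.
Notation m2 := (leb2 R).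

Lemma integral_supported (S A B : set (mplane R)) (g : mplane R -> \bar R) :
  S `<=` A -> S `<=` B -> (forall z, ~ S z -> g z = 0%E) ->
  (\int[m2]_(z in A) g z = \int[m2]_(z in B) g z)%E.
Proof.
move=> SA SB g0.
have E (X : set (mplane R)) : S `<=` X -> g \_ X = g.
  move=> SX; apply/funext => z; rewrite patchE; case: ifPn => // zX.
  by rewrite g0// => /SX zX'; move/negP: zX; apply; rewrite inE.
by rewrite integral_mkcond [RHS]integral_mkcond !E.
Qed.

Variables (Omega : set (R * R)) (psi : R * R -> R[i]).
Hypothesis hpsi : Cc_infty Omega psi.

Let S := closure [set z | psi z != 0].
Let cS : compact S. Proof. by case: hpsi. Qed.
Let clS : closed S. Proof. exact: closed_closure. Qed.
Let SO : S `<=` Omega. Proof. by case: hpsi. Qed.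

Let psi0 z : ~ S z -> psi z = 0.
Proof.
move=> Sz; apply/eqP/negP => /negP pz; apply: Sz.
exact: (@subset_closure _ [set z | psi z != 0]).
Qed.

Let sRe : C1_supported S (ReF psi).
Proof.
by split; [have [h _ _] := hpsi; case: (h 1%N)|move=> z /psi0 E; rewrite /ReF E].
Qed.

Let sIm : C1_supported S (ImF psi).
Proof.
by split; [have [h _ _] := hpsi; case: (h 1%N)|move=> z /psi0 E; rewrite /ImF E].
Qed.

Lemma Rintegral_supported (A B : set (mplane R)) (g : mplane R -> R) :
  S `<=` A -> S `<=` B -> (forall z, ~ S z -> g z = 0) ->
  \int[m2]_(z in A) g z = \int[m2]_(z in B) g z.
Proof.
move=> SA SB g0; rewrite /Rintegral; congr fine.
by apply: (integral_supported SA SB) => z Sz; rewrite g0.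
Qed.

Lemma sqnorm_supported (A : set (mplane R)) (f : R * R -> R[i]) :
  S `<=` A -> (forall z, ~ S z -> f z = 0) -> sqnorm A f = sqnorm Omega f.
Proof.
move=> SA f0; apply: (Rintegral_supported SA SO) => z Sz.
by rewrite f0// cmod0 expr0n.
Qed.

Lemma sqint_supported (f : R * R -> R[i]) : cbmeas (f : mplane R -> R[i]) ->
  (forall z, ~ S z -> f z = 0) -> sqint m2 Omega f.
Proof.
move=> [b1 b2] f0; split.
- by case: b1 => h _; exact: measurable_funTS.
- by case: b2 => h _; exact: measurable_funTS.
have [M M0 hM] := compact_in_cell cS.
have L0 : 0 < 2 * M by rewrite mulr_gt0.
have Sc : S `<=` cell (- M) (2 * M).
  move=> z /hM[]; rewrite !ltr_norml => /andP[? ?] /andP[? ?].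
  by split; rewrite /cellI/= in_itv/=; apply/andP; split; lra.
have := cbmeas_sqint (measurable_cell (- M) (2 * M)) (leb2_cell_fin (- M) L0) (conj b1 b2).
move=> [_ _ /integrableP[mm ii]]; apply/integrableP; split.
  by apply/measurable_EFinP; have [h _] := cbmeas_sqr (conj b1 b2); exact: measurable_funTS.
congr (_ < _)%E : ii; apply: (integral_supported Sc SO) => z Sz.
by rewrite /= f0// cmod0 expr0n normr0.
Qed.

Lemma sqint_Cc : sqint m2 Omega psi.
Proof. by apply: sqint_supported => //; exact: (cbmeas_supported cS). Qed.

Lemma sqint_cpartial v : v = e1 R \/ v = e2 R -> sqint m2 Omega (cpartial v psi).
Proof.
move=> hv; apply: sqint_supported; first exact: (cbmeas_cpartial_supported cS clS sRe sIm hv).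
exact: (cpartial_supported0 cS clS sRe sIm hv).
Qed.

(** The cell inequality controls psi minus its mean, with a bound independent of the cell. On a cell
    of side 2T the mean is J / (2T)^2, with J the integral of psi, so on a fixed cell containing the
    support it disappears as T grows. *)
Lemma Cc_inequality (q : R) : 2 < q ->
  (\int[m2]_(z in Omega) (cmod (psi z) `^ q)%:E <=
    ((1 / (4 * pi)) `^ ((q - 2) / 2) * (q / 2) `^ (q / 2) * sqnorm Omega psi *
     (sqnorm Omega (cpartial (e1 R) psi) + sqnorm Omega (cpartial (e2 R) psi))
       `^ ((q - 2) / 2))%:E)%E.
Proof.
move=> q2; have q0 : 0 < q by lra.
have [M M0 hM] := compact_in_cell cS.
have h1 : e1 R = e1 R \/ e1 R = e2 R by left.
have h2 : e2 R = e1 R \/ e2 R = e2 R by right.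
have scell T : M <= T -> S `<=` open_cell (- T) (2 * T).
  move=> MT z /hM[]; rewrite !ltr_norml => /andP[? ?] /andP[? ?].
  by split; rewrite /= in_itv/=; apply/andP; split; lra.
have Scell T : M <= T -> S `<=` cell (- T) (2 * T).
  move=> MT z /(scell T MT)[/=]; rewrite !in_itv/= => /andP[? ?] /andP[? ?].
  by split; rewrite /cellI/= in_itv/=; apply/andP; split; exact: ltW.
have bpsi := cbmeas_supported cS sRe sIm.
have bd1 := cbmeas_cpartial_supported cS clS sRe sIm h1.
have bd2 := cbmeas_cpartial_supported cS clS sRe sIm h2.
have d10 := cpartial_supported0 cS clS sRe sIm h1.
have d20 := cpartial_supported0 cS clS sRe sIm h2.
set C := (X in (_ <= X%:E)%E).
have big T : M <= T -> (\int[m2]_(z in cell (- T) (2 * T))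
    (cmod (psi z - fourier (- T) (2 * T) psi 0) `^ q)%:E <= C%:E)%E.
  move=> MT; have L0 : 0 < 2 * T by rewrite mulr_gt0// (lt_le_trans M0).
  have mD := measurable_cell (- T) (2 * T); have muD := leb2_cell_fin (- T) L0.
  have sp := cbmeas_sqint mD muD bpsi.
  have -> : C = sobolev_bound (- T) (2 * T) q psi (cpartial (e1 R) psi) (cpartial (e2 R) psi).
    by rewrite /C /sobolev_bound !(sqnorm_supported (Scell _ MT))//; exact: psi0.
  apply: (cell_inequality L0 q2 sp (cbmeas_sqint mD muD bd1) (cbmeas_sqint mD muD bd2)) => k.
  - apply: (fourier_weak_derivative L0 sp _ (integration_by_parts_ek cS clS sRe sIm h1 L0 (scell _ MT) _)).
    by apply/funext => z; rewrite cpartial1_ek /= rmorphN/= mulrN.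
  - apply: (fourier_weak_derivative L0 sp _ (integration_by_parts_ek cS clS sRe sIm h2 L0 (scell _ MT) _)).
    by apply/funext => z; rewrite cpartial2_ek /= rmorphN/= mulrN.
have SM := Scell _ (lexx M).
have L0 : 0 < 2 * M by rewrite mulr_gt0.
have mD := measurable_cell (- M) (2 * M).
have [mF _] := cbmeas_cmod bpsi.
rewrite (integral_supported SO SM); last first.
  by move=> z Sz; rewrite psi0// cmod0 powR0// gt_eqF.
apply: (Lq_bound_closed mD (_ : 1 < q)); first by lra.
- exact: measurable_funTS.
- by move=> z; exact: cmod_ge0.
move=> eps eps0; pose J := cintegral Omega psi.
(* The mean has squared L^2 norm (2M)^2 |J|^2 / (2T)^4 on the fixed cell. As |J|^2 <= eps T, M <= T
   and T >= 1, this is at most eps. *)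
pose T := M + 1 + cmod J ^+ 2 / eps.
have J0 : 0 <= cmod J ^+ 2 / eps by rewrite divr_ge0 ?sqr_ge0// ltW.
have MT : M <= T by rewrite /T; lra.
have T1 : 1 <= T by rewrite /T; lra.
have T0 : 0 < T by lra.
have LT : 0 < 2 * T by rewrite mulr_gt0.
set a := fourier (- T) (2 * T) psi 0.
have aE : cmod a ^+ 2 = cmod J ^+ 2 / (2 * T) ^+ 4.
  rewrite /a /fourier; under eq_fun do rewrite ek_conj oppr0 ek0 mulr1.
  rewrite cavg_cintegral// [cintegral _ _](_ : _ = J); last first.
    by rewrite /cintegral !(Rintegral_supported (Scell _ MT) SO) // => z Sz;
      rewrite /ReF /ImF psi0.
  rewrite cmodM exprMn mulrC; congr (_ * _).
  by rewrite cmod_sqr /= expr0n addr0 -exprVn -exprM exprVn.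
have m1 : measurable_fun setT (fun z : mplane R => cmod (psi z - a)).
  by have [h _] := cbmeas_cmod (cbmeasD bpsi (cbmeas_cst _ (- a))).
exists (fun z => cmod (psi z - a)); split.
- exact: measurable_funTS.
- by move=> z; exact: cmod_ge0.
- apply: (@le_trans _ _ (\int[m2]_(z in cell (- M) (2 * M)) (cmod a ^+ 2)%:E)%E).
    apply: ge0_le_integral => //.
    + by move=> z _; rewrite lee_fin sqr_ge0.
    + apply/measurable_EFinP; apply: measurable_funX; apply: measurable_funB;
        exact: measurable_funTS.
    + move=> z _; rewrite lee_fin -[leLHS]real_normK ?num_real// lerXn2r ?nnegrE ?cmod_ge0//.
      by rewrite (le_trans (ler_dist_cmod _ _))// subKr.
  have Ec := integral_cst m2 mD (cmod a ^+ 2)%:E.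
  rewrite [leLHS]Ec [X in (_ * X)%E](leb2_cell (- M) L0) -EFinM lee_fin aE.
  rewrite mulrAC ler_pdivrMr ?exprn_gt0//.
  have Je : cmod J ^+ 2 <= eps * T by rewrite mulrC -ler_pdivrMr// /T; lra.
  have M2 : (2 * M) ^+ 2 <= (2 * T) ^+ 2.
    by rewrite lerXn2r ?nnegrE ?(ltW L0) ?(ltW LT)// ler_pM2l.
  apply: le_trans (ler_pM (sqr_ge0 _) (sqr_ge0 _) Je M2) _.
  rewrite -mulrA (ler_pM2l eps0).
  have T3 : 0 <= T ^+ 3 * (4 * T - 1) by rewrite mulr_ge0 ?exprn_ge0 ?(ltW T0)//; lra.
  have -> : (2 * T) ^+ 4 = 16 * T ^+ 4 by ring.
  have : 16 * T ^+ 4 - T * (2 * T) ^+ 2 = 4 * (T ^+ 3 * (4 * T - 1)) by ring.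
  lra.
- apply: (@le_trans _ _ C%:E); last by rewrite lee_fin lerDl ltW.
  apply: le_trans (big T MT); apply: ge0_subset_integral => //.
  + exact: measurable_cell.
  + apply/measurable_EFinP; apply: measurable_funTS.
    by have := measurableT_comp (measurable_powR q) m1.
  + by move=> z _; rewrite lee_fin powR_ge0.
  + move=> z [z1 z2]; move: z1 z2; rewrite /cellI/= !in_itv/= => /andP[? ?] /andP[? ?].
    by split; rewrite /cellI/= in_itv/=; apply/andP; split; lra.
Qed.

End compact_support.

(** * From test functions to H10 by density *)

Section closure.
Variable R : realType.
Notation m2 := (leb2 R).

(** The exponent (q - 2) / 2 may be smaller than 1, so there is no Lipschitz bound near 0 and the
    limit 0 needs its own argument; elsewhere exp and ln are continuous. *)
Lemma cvg_powR_gt0 (s x : R) (u : R^nat) : 0 < s -> 0 <= x -> (forall n, 0 < u n) ->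
  u @ \oo --> x -> u n `^ s @[n --> \oo] --> x `^ s.
Proof.
move=> s0 x0 u0 ux; have sn : s != 0 by rewrite gt_eqF.
move: x0; rewrite le_eqVlt => /orP[/eqP x0|x0].
  rewrite -x0 powR0//; apply/cvgrPdist_le => eps eps0; near=> n.
  rewrite sub0r normrN ger0_norm ?powR_ge0//.
  have h : u n <= eps `^ s^-1.
    rewrite -[leLHS]ger0_norm ?(ltW (u0 n))// -normrN -sub0r x0; near: n.
    by move/cvgrPdist_le : ux; apply; exact: powR_gt0.
  apply: (@le_trans _ _ ((eps `^ s^-1) `^ s)).
    by apply: ge0_ler_powR => //; rewrite ?nnegrE ?powR_ge0 ?(ltW s0) ?(ltW (u0 n)).
  by rewrite -powRrM mulVf// powRr1// ltW.
have E (y : R) : 0 < y -> y `^ s = expR (s * ln y) by move=> y0; rewrite /powR gt_eqF.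
rewrite E// (_ : (fun n => _) = (fun n => expR (s * ln (u n)))); last first.
  by apply/funext => n; rewrite E.
have hl : s * ln (u n) @[n --> \oo] --> s * ln x.
  apply: cvgM; first exact: cvg_cst.
  exact: (cvg_comp u (@ln R) ux (@continuous_ln R x x0)).
exact: (cvg_comp (fun n => s * ln (u n)) (@expR R) hl (@continuous_expR R _)).
Unshelve. all: by end_near. Qed.

Variable D : set (mplane R).
Hypothesis mD : measurable D.

(** From (x + y)^2 <= (1 + eta) x^2 + (1 + 1/eta) y^2, where the second term integrates to at most
    (1 + 1/eta) eta^2 = eta^2 + eta. *)
Lemma sqnorm_perturb (f g : mplane R -> R[i]) (eta : R) : 0 < eta ->
  sqint m2 D f -> sqint m2 D g ->
  (\int[m2]_(z in D) (cmod (f z - g z) ^+ 2)%:E <= (eta ^+ 2)%:E)%E ->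
  sqnorm D g <= sqnorm D f + eta * (sqnorm D f + 1 + eta).
Proof.
move=> eta0 [mr mi fi] [mr' mi' gi] h.
have md : measurable_fun D (fun z => cmod (f z - g z)).
  by apply: measurable_cmod; [under eq_fun do rewrite ReD ReN|under eq_fun do rewrite ImD ImN];
    apply: measurable_funB.
have di : rint m2 D (fun z => cmod (f z - g z) ^+ 2).
  apply/integrableP; split; first by apply/measurable_EFinP; exact: measurable_funX.
  under eq_integral => z _ do rewrite /= ger0_norm ?sqr_ge0//.
  by rewrite (le_lt_trans h)// ltry.
have i1 := rintZ mD (1 + eta) fi; have i2 := rintZ mD (1 + eta^-1) di.
have : sqnorm D g <= \int[m2]_(z in D) ((1 + eta) * cmod (f z) ^+ 2 + (1 + eta^-1) * cmod (f z - g z) ^+ 2).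
  apply: le_Rintegral => //; first exact: (rintD mD i1 i2).
  move=> z _; have e1 : 0 < eta^-1 by rewrite invr_gt0.
  have ee : eta * eta^-1 = 1 by rewrite mulfV// gt_eqF.
  have t : cmod (g z) <= cmod (f z) + cmod (f z - g z).
    rewrite -[X in cmod X <= _](subKr (f z)) (le_trans (cmodD _ _))// cmodN//.
  have x0 := cmod_ge0 (f z); have y0 := cmod_ge0 (f z - g z); have z0 := cmod_ge0 (g z).
  move: t x0 y0 z0; move: (cmod (g z)) (cmod (f z)) (cmod (f z - g z)) => w x y t x0 y0 w0.
  have h1 : w ^+ 2 <= (x + y) ^+ 2 by rewrite lerXn2r ?nnegrE ?(addr_ge0 x0 y0).
  have h2 : 0 <= eta^-1 * (eta * x - y) ^+ 2 by rewrite mulr_ge0 ?sqr_ge0// ltW.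
  have h3 : eta^-1 * (eta * x - y) ^+ 2 =
      (eta * eta^-1) * eta * x ^+ 2 - 2 * (eta * eta^-1) * x * y + eta^-1 * y ^+ 2 by ring.
  rewrite h3 ee in h2; apply: (le_trans h1); lra.
rewrite RintegralD// RintegralZl// RintegralZl// => /le_trans; apply.
have hd : \int[m2]_(z in D) cmod (f z - g z) ^+ 2 <= eta ^+ 2.
  by rewrite -lee_fin /Rintegral fineK//; exact: integrable_fin_num.
rewrite -[X in (1 + eta) * X]/(sqnorm D f).
have : (1 + eta^-1) * \int[m2]_(z in D) cmod (f z - g z) ^+ 2 <= (1 + eta^-1) * eta ^+ 2.
  by rewrite ler_wpM2l// addr_ge0// invr_ge0 ltW.
have -> : (1 + eta^-1) * eta ^+ 2 = eta ^+ 2 + eta by field; rewrite gt_eqF.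
lra.
Qed.

Lemma H1norm_lt (f : mplane R -> R[i]) (df : mplane R -> R[i] * R[i]) (del : R) : 0 < del ->
  measurable_fun D (fun z => cmod ((df z).1)) -> measurable_fun D (fun z => cmod ((df z).2)) ->
  (H1norm D f df < del%:E)%E ->
  [/\ (\int[m2]_(z in D) (cmod (f z) ^+ 2)%:E <= (del ^+ 2)%:E)%E,
      (\int[m2]_(z in D) (cmod (df z).1 ^+ 2)%:E <= (del ^+ 2)%:E)%E &
      (\int[m2]_(z in D) (cmod (df z).2 ^+ 2)%:E <= (del ^+ 2)%:E)%E].
Proof.
move=> del0 md1 md2; rewrite /H1norm => h.
have n2 : (2 : R) != 0 by rewrite pnatr_eq0.
set X := (normL D 2 (cmod \o f) `^ 2 + normL D 2 (cmod2 \o df) `^ 2)%E in h.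
have X0 : (0 <= X)%E by rewrite adde_ge0 ?poweR_ge0.
have {h} hX : (X <= (del ^+ 2)%:E)%E.
  have -> : X = ((X `^ 2^-1) `^ 2)%E by rewrite -poweRrM mulVf// poweRe1.
  rewrite -[del ^+ 2]powR_mulrn ?(ltW del0)// -poweR_EFin.
  apply: gt0_ler_poweR; rewrite ?in_itv/= ?leey ?andbT ?poweR_ge0 ?lee_fin ?(ltW del0)//.
  exact: ltW.
have f0 z : 0 <= (cmod \o f) z by exact: cmod_ge0.
have df0 z : 0 <= (cmod2 \o df) z by exact: sqrtr_ge0.
have E1 : (normL D 2 (cmod \o f) `^ 2 = \int[m2]_(z in D) (cmod (f z) ^+ 2)%:E)%E.
  by rewrite normL_powR//; apply: eq_integral => z _; rewrite /= powR_mulrn ?cmod_ge0.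
have E2 : (normL D 2 (cmod2 \o df) `^ 2 =
    \int[m2]_(z in D) ((cmod (df z).1 ^+ 2)%:E + (cmod (df z).2 ^+ 2)%:E))%E.
  rewrite normL_powR//; apply: eq_integral => z _.
  by rewrite /= powR_mulrn ?sqrtr_ge0// sqr_sqrtr ?addr_ge0 ?sqr_ge0.
have sq0 (u : mplane R -> R) z : D z -> (0 <= (u z ^+ 2)%:E)%E by rewrite lee_fin sqr_ge0.
have ms (u : mplane R -> R) : measurable_fun D u -> measurable_fun D (fun z => (u z ^+ 2)%:E).
  by move=> mu'; apply/measurable_EFinP; exact: measurable_funX.
have i0 (u : mplane R -> R) : (0 <= \int[m2]_(z in D) (u z ^+ 2)%:E)%E.
  by apply: integral_ge0 => z; exact: sq0.
have E3 := ge0_integralD m2 mD (sq0 (fun z => cmod (df z).1)) (ms _ md1)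
  (sq0 (fun z => cmod (df z).2)) (ms _ md2).
rewrite /X E1 E2 [X in (_ + X)%E]E3 in hX.
split; apply: le_trans hX.
- by rewrite leeDl// adde_ge0.
- by rewrite -[leLHS]add0e leeD// leeDl.
- by rewrite -[leLHS]add0e leeD// -[leLHS]add0e leeD.
Qed.

End closure.

Section H10_inequality.
Variable R : realType.

Lemma H10_inequality (Omega : set (R * R)) (phi : R * R -> R[i])
    (dphi : R * R -> R[i] * R[i]) (q : R) :
  open Omega -> H10 Omega phi dphi -> 2 <= q ->
  (normL Omega q (cmod \o phi)
      <= (((1 / (4 * pi)) `^ ((q - 2) / (2 * q)) * (q / 2) `^ (1 / 2))%R)%:E
         * normL Omega 2 (cmod \o phi) `^ (2 / q)
         * normL Omega 2 (cmod2 \o dphi) `^ (1 - 2 / q))%E.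
Proof.
move=> oO [[hf h1 h2 _] dens] q2.
have mO : measurable (Omega : set (mplane R)) by exact: open_measurable_plane.
apply: Lq_interpolation_normL => // {}q2.
have sf := sqint_L2 hf; have s1 := sqint_L2 h1; have s2 := sqint_L2 h2.
set K := _ `^ _ * _ `^ _; set A := sqnorm Omega phi; set s := (q - 2) / 2.
set B1 := sqnorm _ (fst \o _); set B2 := sqnorm _ (snd \o _).
have A0 : 0 <= A by exact: sqnorm_ge0.
have B10 : 0 <= B1 by exact: sqnorm_ge0.
have B20 : 0 <= B2 by exact: sqnorm_ge0.
have K0 : 0 <= K by rewrite mulr_ge0 ?powR_ge0.
have s0 : 0 < s by rewrite /s; lra.
have [mr mi _] := sf; have [mr1 mi1 _] := s1; have [mr2 mi2 _] := s2.
apply: (Lq_bound_closed mO (_ : 1 < q)); first by lra.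
- exact: measurable_cmod.
- by move=> z; exact: cmod_ge0.
move=> eps eps0.
pose eta n : R := n.+1%:R^-1.
have eta0 n : 0 < eta n by rewrite invr_gt0.
have ceta : eta @ \oo --> (0 : R) by exact: cvg_harmonic.
(* [a n] and [b n] are the bounds that [sqnorm_perturb] yields for a test function within [eta n] of
   phi. They are fixed before the test function, so n can be chosen from their limits. *)
pose a n := A + eta n * (A + 1 + eta n).
pose b n := B1 + eta n * (B1 + 1 + eta n) + (B2 + eta n * (B2 + 1 + eta n)).
have b0 n : 0 < b n.
  have e := eta0 n; rewrite /b; have : 0 < eta n * (B1 + 1 + eta n) by rewrite mulr_gt0//; lra.
  have : 0 < eta n * (B2 + 1 + eta n) by rewrite mulr_gt0//; lra.
  lra.
have cx (x : R) : x + eta n * (x + 1 + eta n) @[n --> \oo] --> x.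
  have h := cvgD (cvg_cst x) (cvgM ceta (cvgD (cvg_cst (x + 1)) ceta)).
  by rewrite mul0r addr0 in h; exact: h.
have cb : b n `^ s @[n --> \oo] --> (B1 + B2) `^ s.
  by apply: cvg_powR_gt0 => //; [rewrite addr_ge0|apply: cvgD; exact: cx].
have ch : K * a n * b n `^ s @[n --> \oo] --> K * A * (B1 + B2) `^ s.
  by apply: cvgM => //; apply: cvgM; [exact: cvg_cst|exact: cx].
have [n [hn1 hn2]] : exists n, K * a n * b n `^ s <= K * A * (B1 + B2) `^ s + eps /\ eta n ^+ 2 <= eps.
  have ce2 : eta n ^+ 2 @[n --> \oo] --> (0 : R).
    have h := cvgM ceta ceta; rewrite mulr0 in h.
    by under eq_fun do rewrite expr2; exact: h.
  move/cvgrPdist_le : ch => /(_ _ eps0)[N1 _ H1].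
  move/cvgrPdist_le : ce2 => /(_ _ eps0)[N2 _ H2].
  exists (maxn N1 N2); split.
    have := H1 _ (leq_maxl N1 N2); rewrite /= ler_norml => /andP[]; lra.
  by have := H2 _ (leq_maxr N1 N2); rewrite /= sub0r normrN ger0_norm ?sqr_ge0.
have [psi [hpsi hH]] := dens _ (eta0 n).
have v1 : e1 R = e1 R \/ e1 R = e2 R by left.
have v2 : e2 R = e1 R \/ e2 R = e2 R by right.
have sp := sqint_Cc hpsi; have sp1 := sqint_cpartial hpsi v1; have sp2 := sqint_cpartial hpsi v2.
have [mp mp' _] := sp; have [mp1 mp1' _] := sp1; have [mp2 mp2' _] := sp2.
have mB (f g : mplane R -> R[i]) : sqint (leb2 R) Omega f -> sqint (leb2 R) Omega g ->
    measurable_fun (Omega : set (mplane R)) (fun z => cmod (f z - g z)).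
  move=> [? ? _] [? ? _]; by apply: measurable_cmod;
    [under eq_fun do rewrite ReD ReN|under eq_fun do rewrite ImD ImN]; apply: measurable_funB.
have [i0 i1 i2] := @H1norm_lt R _ mO (fun x => phi x - psi x)
  (fun x => ((dphi x).1 - (cgrad psi x).1, (dphi x).2 - (cgrad psi x).2)) _
  (eta0 n) (mB _ _ s1 sp1) (mB _ _ s2 sp2) hH.
exists (fun z => cmod (psi z)); split.
- exact: measurable_cmod.
- by move=> z; exact: cmod_ge0.
- apply: (@le_trans _ _ (eta n ^+ 2)%:E); last by rewrite lee_fin.
  apply: le_trans i0; apply: ge0_le_integral => //.
  + by move=> z _; rewrite lee_fin sqr_ge0.
  + by apply/measurable_EFinP; apply: measurable_funX; apply: measurable_funB; exact: measurable_cmod.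
  + by apply/measurable_EFinP; apply: measurable_funX; exact: mB.
  + move=> z _; rewrite lee_fin -[leLHS]real_normK ?num_real// lerXn2r ?nnegrE ?cmod_ge0//.
    exact: ler_dist_cmod.
- apply: le_trans (Cc_inequality hpsi q2) _; rewrite lee_fin; apply: le_trans hn1.
  have p0 := sqnorm_perturb mO (eta0 n) sf sp i0.
  have p1 := sqnorm_perturb mO (eta0 n) s1 sp1 i1.
  have p2 := sqnorm_perturb mO (eta0 n) s2 sp2 i2.
  apply: ler_pM.
  + exact: (mulr_ge0 K0 (sqnorm_ge0 _ _)).
  + exact: powR_ge0.
  + exact: (ler_wpM2l K0).
  apply: ge0_ler_powR; rewrite ?nnegrE ?(ltW s0) ?(ltW (b0 n)) ?addr_ge0 ?sqnorm_ge0//.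
  by rewrite lerD.
Qed.

End H10_inequality.

Unset Implicit Arguments.

Theorem corollary4p1 (R : realType) :
  (forall (phi : R * R -> R[i]) (dphi : R * R -> R[i] * R[i]),
     H1dot_T2 phi dphi ->
     forall q : R, 2 <= q ->
     (normL (T2 R) q (cmod \o phi)
      <= (((1 / (4 * pi)) `^ ((q - 2) / (2 * q)) * (q / 2) `^ (1 / 2))%R)%:E
         * normL (T2 R) 2 (cmod \o phi) `^ (2 / q)
         * normL (T2 R) 2 (cmod2 \o dphi) `^ (1 - 2 / q))%E) /\
  (forall (Omega : set (R * R)) (phi : R * R -> R[i])
          (dphi : R * R -> R[i] * R[i]),
     domain Omega -> H10 Omega phi dphi ->
     forall q : R, 2 <= q ->
     (normL Omega q (cmod \o phi)
      <= (((1 / (4 * pi)) `^ ((q - 2) / (2 * q)) * (q / 2) `^ (1 / 2))%R)%:E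
         * normL Omega 2 (cmod \o phi) `^ (2 / q)
         * normL Omega 2 (cmod2 \o dphi) `^ (1 - 2 / q))%E).
Proof.
split=> [phi dphi H q q2|Omega phi dphi [oO _ _] H q q2].
  exact: torus_inequality.
exact: H10_inequality.
Qed.
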